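(* Let $J$ be a circular hyperbolic Coxeter diagram with nodes $0,\dots,n$, let $\Gamma=W_J$ be the associated Coxeter group and $X_J=\mathbb{H}^n/\Gamma$ the associated hyperbolic simplicial Coxeter orbifold. Let $P\subset\mathbb{P}^n$ be an $n$-simplex, let $\{\rho_t\}_{t\in\mathbb{R}_+}$ be a simplicial deformation family for $(J,P)$ with properly convex open sets $\Omega_t=\bigcup_{\gamma\in\Gamma}\rho_t(\gamma)(P)$, and let $d_t$ be the Hilbert metric on $\Omega_t$. Then $$\delta(\Omega_t,d_t,\Gamma)\rightarrow 0\quad\text{as } t\rightarrow 0 \text{ or } t\rightarrow+\infty,$$ where $\Gamma$ acts on $\Omega_t$ through $\rho_t$.
   Context: $\mathbb{P}^n$ is real projective $n$-space, $\mathbb{R}_+=(0,+\infty)$. **Coxeter diagrams.** A Coxeter diagram $J$ with nodes $0,\dots,n$ is a collection $J=(m_{ij})_{i\ne j}$, $m_{ij}=m_{ji}\in\{2,3,\dots\}\cup\{\infty\}$, viewed as a graph with an edge of weight $m_{ij}$ between $i$ and $j$ iff $m_{ij}\ge 3$. Its Coxeter group is $W_J=\langle\tau_0,\dots,\tau_n\mid \tau_i^2=(\tau_i\tau_j)^{m_{ij}}=1\ (i\neq j)\rangle$ (no relation when $m_{ij}=\infty$). Its Cartan matrix $\mathbf{C}_J$ is the symmetric matrix with diagonal entries $1$ and off-diagonal entries $-\cos(\pi/m_{ij})$. $J$ is *hyperbolic* if $\mathbf{C}_J$ is non-degenerate and not positive definite but every proper principal submatrix of $\mathbf{C}_J$ is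 positive definite; then $W_J$ is identified with a group $\Gamma\subset\mathrm{Isom}(\mathbb{H}^n)$ generated by the orthogonal reflections $\tau_i$ in the faces of a bounded hyperbolic $n$-simplex which is a fundamental domain, the faces numbered $i,j$ meeting at angle $\pi/m_{ij}$. $J$ is *circular* if its graph is a single cycle through all the nodes $0,\dots,n$. **Moduli space.** An open set $\Omega\subset\mathbb{P}^n$ is properly convex if it is a bounded convex subset of some affine chart $\mathbb{R}^n\subset\mathbb{P}^n$. $\mathfrak{P}(X_J)\subset \mathrm{Hom}(\Gamma,\mathrm{PGL}_{n+1}\mathbb{R})/\mathrm{PGL}_{n+1}\mathbb{R}$ (quotient by conjugation) is the set of classes of faithful representations $\rho$ for which there are a properly convex open set $\Omega\subset\mathbb{P}^n$ preserved by $\rho(\Gamma)$ and a $\rho$-equivariant homeomorphism $\mathbb{H}^n\to\Omega$. **Simplicial deformation family.** A projective reflection is an element of $\mathrm{PGL}_{n+1}\mathbb{R}$ conjugate to $\pm\mathrm{diag}(-1,1,\dots,1)$; it is a reflection with respect to an $(n-1)$-face of a simplex if it fixes that face pointwise. Let $P\subset\mathbb{P}^n$ be a (closed) $n$-simplex with $(n-1)$-dimensional faces $P_0,\dots,P_n$. A *simplicial deformation family* for $(J,P)$ is a family of representations $\rho_t:\Gamma\to\mathrm{PGL}_{n+1}\mathbb{R}$, $t\in\mathbb{R}_+$, such that: (1) $\rho_t(\tau_i)$ is a projective reflection with respect to $P_i$ for each $i$; (2) $t\mapsto[\rho_t]$ is a bijection $\mathbb{R}_+\to\mathfrak{P}(X_J)$;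 (3) $\Omega_t=\bigcup_{\gamma\in\Gamma}\rho_t(\gamma)(P)$ is the properly convex open set preserved by $\rho_t$, and $\Omega_t$ converges to $P$ in the Hausdorff topology as $t\to0$ and as $t\to+\infty$. **Hilbert metric.** For $\Omega$ properly convex open and $x\ne y\in\Omega$, in an affine chart containing $\overline\Omega$ let $x',y'\in\partial\Omega$ be such that $x',x,y,y'$ lie in this order on the segment $[x',y']$. Then $d_\Omega(x,y)=\frac12\log\frac{|x'-y||y'-x|}{|x'-x||y'-y|}$. **Entropy.** For a group $\Gamma$ acting properly discontinuously by isometries on a metric space $(\widetilde X,d)$ and a base point $x_0\in\widetilde X$, $\delta(\widetilde X,d,\Gamma)=\delta(\widetilde X,d,\Gamma,x_0)=\limsup_{R\to+\infty}\frac1R\log\#\big(\Gamma.x_0\cap B(x_0,R)\big)$, with $B(x_0,R)$ the ball of radius $R$ about $x_0$; in the present case this does not depend on the choice of $x_0$. *)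

(* Defs.v *)
From HB Require Import structures.
From mathcomp Require Import all_boot all_order all_algebra perm.
From mathcomp Require Import all_classical all_reals all_analysis.

Set Implicit Arguments.
Unset Strict Implicit.
Unset Printing Implicit Defensive.

Import Order.TTheory GRing.Theory Num.Theory.
Import numFieldNormedType.Exports.

Local Open Scope classical_set_scope.
Local Open Scope ring_scope.
Local Open Scope quotient_scope.

(** * Coxeter diagrams and Coxeter groups *)

(* [None] is the weight oo; the diagonal weights are never used. *)
Record coxeter_diagram (n : nat) := CoxeterDiagram {
  weight :> 'I_n.+1 -> 'I_n.+1 -> option nat;
  weight_sym : forall i j, weight i j = weight j i;
  weight_ge2 : forall i j m, i != j -> weight i j = Some m -> (2 <= m)%N
}.

(* The generators are involutions, so every element of the group is a word in
   the generators themselves, and the group is the quotient of the free monoid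
   on the nodes by the congruence generated by the relators. *)
Inductive coxeter_eq n (J : coxeter_diagram n) : seq 'I_n.+1 -> seq 'I_n.+1 -> Prop :=
| CoxRefl w : coxeter_eq J w w
| CoxSym w1 w2 : coxeter_eq J w1 w2 -> coxeter_eq J w2 w1
| CoxTrans w1 w2 w3 : coxeter_eq J w1 w2 -> coxeter_eq J w2 w3 -> coxeter_eq J w1 w3
| CoxInvol u w i : coxeter_eq J (u ++ [:: i; i] ++ w) (u ++ w)
| CoxBraid u w i j m : i != j -> J i j = Some m ->
    coxeter_eq J (u ++ flatten (nseq m [:: i; j]) ++ w) (u ++ w).

Section CoxeterGroup.
Variables (n : nat) (J : coxeter_diagram n).

Definition coxeter_rel (w1 w2 : seq 'I_n.+1) : bool := `[< coxeter_eq J w1 w2 >].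

Lemma coxeter_rel_refl : reflexive coxeter_rel.
Proof. by move=> w; apply/asboolP; exact: CoxRefl. Qed.

Lemma coxeter_rel_sym : symmetric coxeter_rel.
Proof. by move=> w1 w2; apply: asbool_equiv_eq; split; exact: CoxSym. Qed.

Lemma coxeter_rel_trans : transitive coxeter_rel.
Proof. by move=> w2 w1 w3 /asboolP h /asboolP k; apply/asboolP; exact: CoxTrans h k. Qed.

Canonical coxeter_equiv :=
  EquivRel coxeter_rel coxeter_rel_refl coxeter_rel_sym coxeter_rel_trans.

Definition coxeter_group := {eq_quot coxeter_equiv}.
HB.instance Definition _ := Choice.on coxeter_group.
HB.instance Definition _ := EqQuotient.on coxeter_group.

Definition coxeter_word (w : seq 'I_n.+1) : coxeter_group := \pi_coxeter_group w.

Definition coxeter_gen (i : 'I_n.+1) : coxeter_group := coxeter_word [:: i].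

Lemma coxeter_wordP w1 w2 : coxeter_eq J w1 w2 <-> coxeter_word w1 = coxeter_word w2.
Proof.
by split=> [h|/eqmodP/asboolP //]; apply/eqmodP/asboolP.
Qed.

Lemma coxeter_repr w : coxeter_eq J (repr (coxeter_word w)) w.
Proof. by apply/coxeter_wordP; rewrite /coxeter_word reprK. Qed.

Lemma coxeter_eq_cat u u' w w' :
  coxeter_eq J u u' -> coxeter_eq J w w' -> coxeter_eq J (u ++ w) (u' ++ w').
Proof.
move=> hu hw; apply: (@CoxTrans _ _ _ (u' ++ w)).
  elim: hu w {hw} => [||w1 w2 w3 _ IH1 _ IH2 w|a b i w|a b i j m ij Jm w].
  - by move=> x w; exact: CoxRefl.
  - by move=> w1 w2 _ IH w; exact: CoxSym.
  - exact: CoxTrans (IH1 w) (IH2 w).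
  - by rewrite -!catA; exact: CoxInvol.
  - by rewrite -!catA; exact: CoxBraid.
elim: hw u' {hu} => [||w1 w2 w3 _ IH1 _ IH2 v|a b i v|a b i j m ij Jm v].
- by move=> x v; exact: CoxRefl.
- by move=> w1 w2 _ IH v; exact: CoxSym.
- exact: CoxTrans (IH1 v) (IH2 v).
- by rewrite !(catA v); exact: CoxInvol.
- by rewrite !(catA v); exact: CoxBraid.
Qed.

Lemma coxeter_eq_rev w : coxeter_eq J (rev w ++ w) [::].
Proof.
elim: w => [|i w IH]; first exact: CoxRefl.
rewrite rev_cons -cats1 -catA; apply: CoxTrans IH.
exact: (CoxInvol J (rev w) w i).
Qed.

Definition coxeter_mul (g h : coxeter_group) : coxeter_group :=
  coxeter_word (repr g ++ repr h).

Definition coxeter_inv (g : coxeter_group) : coxeter_group :=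
  coxeter_word (rev (repr g)).

Lemma coxeter_reprK (g : coxeter_group) : coxeter_word (repr g) = g.
Proof. by rewrite /coxeter_word reprK. Qed.

Lemma coxeter_mulE u w :
  coxeter_mul (coxeter_word u) (coxeter_word w) = coxeter_word (u ++ w).
Proof. by apply/coxeter_wordP/coxeter_eq_cat; exact: coxeter_repr. Qed.

Lemma coxeter_mulA : associative coxeter_mul.
Proof.
move=> a b c; rewrite -(coxeter_reprK a) -(coxeter_reprK b) -(coxeter_reprK c).
by rewrite !coxeter_mulE catA.
Qed.

Lemma coxeter_mul1 : left_id (coxeter_word [::]) coxeter_mul.
Proof. by move=> a; rewrite -(coxeter_reprK a) coxeter_mulE. Qed.

Lemma coxeter_1mul : right_id (coxeter_word [::]) coxeter_mul.
Proof. by move=> a; rewrite -(coxeter_reprK a) coxeter_mulE cats0. Qed.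

Lemma coxeter_mulV : left_inverse (coxeter_word [::]) coxeter_inv coxeter_mul.
Proof.
move=> a; rewrite -{2}(coxeter_reprK a) coxeter_mulE.
by apply/coxeter_wordP; exact: coxeter_eq_rev.
Qed.

Lemma coxeter_Vmul : right_inverse (coxeter_word [::]) coxeter_inv coxeter_mul.
Proof.
move=> a; rewrite -{1}(coxeter_reprK a) coxeter_mulE.
apply/coxeter_wordP; rewrite -{1}[repr a]revK; exact: coxeter_eq_rev.
Qed.

HB.instance Definition _ := isGroup.Build coxeter_group
  coxeter_mulA coxeter_mul1 coxeter_1mul coxeter_mulV coxeter_Vmul.

Definition coxeter_edge (i j : 'I_n.+1) : bool :=
  (i != j) && (if J i j is Some m then 3 <= m else true)%N.

(* [s] enumerates the nodes along the cycle, [ordS] being the cyclic successor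
   on ['I_n.+1]; a cycle of a simple graph has at least three nodes. *)
Definition circular : Prop :=
  (2 <= n)%N /\
  exists s : {perm 'I_n.+1}, forall i j,
    coxeter_edge (s i) (s j) = (j == ordS i) || (i == ordS j).

End CoxeterGroup.

Section Hyperbolic.
Variables (R : realType) (n : nat).

(* pi / m, with pi / oo = 0 *)
Definition dihedral_angle (m : option nat) : R :=
  if m is Some k then pi / k%:R else 0.

Definition cartan (J : coxeter_diagram n) : 'M[R]_n.+1 :=
  \matrix_(i, j) (if i == j then 1 else - cos (dihedral_angle (J i j))).

Definition posdef k (A : 'M[R]_k) : Prop :=
  forall x : 'cV[R]_k, x != 0 -> 0 < (x^T *m A *m x) 0 0.

Definition principal_submatrix (A : 'M[R]_n.+1) (S : {set 'I_n.+1}) : 'M[R]_#|S| :=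
  mxsub enum_val enum_val A.

Definition hyperbolic (J : coxeter_diagram n) : Prop :=
  [/\ cartan J \in unitmx, ~ posdef (cartan J) &
      forall S : {set 'I_n.+1}, S \proper [set: 'I_n.+1] ->
        posdef (principal_submatrix (cartan J) S)].

(** * Hyperbolic space (hyperboloid model) *)

Definition lorentz (x y : 'cV[R]_n.+1) : R :=
  \sum_(i < n.+1) (if i == 0 then - (x i 0 * y i 0) else x i 0 * y i 0).

Definition hyperbolic_space : set 'cV[R]_n.+1 :=
  [set x | lorentz x x = -1 /\ 0 < x 0 0].

Definition lorentz_reflection (v x : 'cV[R]_n.+1) : 'cV[R]_n.+1 :=
  x - (2 * lorentz x v) *: v.

(* The bounded hyperbolic simplex with vertices [u i], [v i] being the outward
   unit normal of the face opposite to [u i]. The angle between the faces i and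
   j is pi / m_ij, i.e. the outward normals have product - cos (pi / m_ij). *)
Record coxeter_simplex (J : coxeter_diagram n) (u v : 'I_n.+1 -> 'cV[R]_n.+1) : Prop := {
  vertex_hyperbolic : forall i, hyperbolic_space (u i);
  vertex_in_face : forall i j, i != j -> lorentz (u j) (v i) = 0;
  vertex_inner_side : forall i, lorentz (u i) (v i) < 0;
  normal_unit : forall i, lorentz (v i) (v i) = 1;
  face_angle : forall i j, i != j ->
    lorentz (v i) (v j) = - cos (dihedral_angle (J i j))
}.

(* The isometry of hyperbolic space by which the class of the word
   i1 ... ik acts: the product of the reflections in the faces i1, ..., ik. *)
Definition word_isometry (v : 'I_n.+1 -> 'cV[R]_n.+1) (w : seq 'I_n.+1)
    (x : 'cV[R]_n.+1) : 'cV[R]_n.+1 :=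
  foldr (fun i => lorentz_reflection (v i)) x w.

End Hyperbolic.

(** * Real projective space: [pspace R n] is P^n and [PGL R n] is PGL_{n+1}(R) *)

Section Projective.
Variables (R : realType) (n : nat).

Definition nzvec : topologicalType := set_type [set v : 'cV[R]_n.+1 | v != 0].

Definition nzval (v : nzvec) : 'cV[R]_n.+1 := \val v.

Lemma nzval_neq0 (v : nzvec) : nzval v != 0.
Proof. by rewrite /nzval; case: v => v v0; exact: set_mem v0. Qed.

Definition NzVec (v : 'cV[R]_n.+1) (v0 : v != 0) : nzvec :=
  SigSub (mem_set (v0 : [set v : 'cV[R]_n.+1 | v != 0] v)).

Definition collinear (v w : nzvec) : bool :=
  `[< exists2 c : R, c != 0 & nzval w = c *: nzval v >].

Lemma collinear_refl : reflexive collinear.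
Proof. by move=> v; apply/asboolP; exists 1; rewrite ?oner_eq0 ?scale1r. Qed.

Lemma collinear_sym : symmetric collinear.
Proof.
have h v w : collinear v w -> collinear w v.
  move=> /asboolP[c c0 e]; apply/asboolP; exists c^-1; first by rewrite invr_eq0.
  by rewrite e scalerA mulVf // scale1r.
by move=> v w; apply/idP/idP; exact: h.
Qed.

Lemma collinear_trans : transitive collinear.
Proof.
move=> w v z /asboolP[c c0 e] /asboolP[d d0 f]; apply/asboolP; exists (d * c).
  by rewrite mulf_neq0.
by rewrite f e scalerA.
Qed.

Canonical collinear_equiv :=
  EquivRel collinear collinear_refl collinear_sym collinear_trans.

Definition pspace := quotient_topology {eq_quot collinear_equiv}.
HB.instance Definition _ := Quotient.on pspace.
HB.instance Definition _ := Topological.on pspace.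

(* homogeneous coordinates of [x] *)
Definition hcoord (x : pspace) : 'cV[R]_n.+1 := nzval (repr x).

Definition represents (v : 'cV[R]_n.+1) (x : pspace) : Prop :=
  exists2 c : R, c != 0 & hcoord x = c *: v.

Record GL := MkGL { glval : 'M[R]_n.+1; _ : glval \in unitmx }.
HB.instance Definition _ := [isSub for glval].
HB.instance Definition _ := [Choice of GL by <:].

Lemma glval_unit (A : GL) : glval A \in unitmx.
Proof. by case: A. Qed.

Definition gl_one : GL := MkGL (unitmx1 R n.+1).
Definition gl_inv (A : GL) : GL := MkGL (etrans (unitmx_inv _) (glval_unit A)).
Lemma gl_mul_subproof (A B : GL) : glval A *m glval B \in unitmx.
Proof. by rewrite unitmx_mul !glval_unit. Qed.
Definition gl_mul (A B : GL) : GL := MkGL (gl_mul_subproof A B).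

Lemma gl_mulA : associative gl_mul.
Proof. by move=> A B C; apply: val_inj; rewrite /= mulmxA. Qed.
Lemma gl_mul1 : left_id gl_one gl_mul.
Proof. by move=> A; apply: val_inj; rewrite /= mul1mx. Qed.
Lemma gl_1mul : right_id gl_one gl_mul.
Proof. by move=> A; apply: val_inj; rewrite /= mulmx1. Qed.
Lemma gl_mulV : left_inverse gl_one gl_inv gl_mul.
Proof. by move=> A; apply: val_inj; rewrite /= mulVmx // glval_unit. Qed.
Lemma gl_Vmul : right_inverse gl_one gl_inv gl_mul.
Proof. by move=> A; apply: val_inj; rewrite /= mulmxV // glval_unit. Qed.

HB.instance Definition _ := isGroup.Build GL gl_mulA gl_mul1 gl_1mul gl_mulV gl_Vmul.

Definition proportional (A B : GL) : bool :=
  `[< exists2 c : R, c != 0 & glval B = c *: glval A >].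

Lemma proportional_refl : reflexive proportional.
Proof. by move=> v; apply/asboolP; exists 1; rewrite ?oner_eq0 ?scale1r. Qed.

Lemma proportional_sym : symmetric proportional.
Proof.
have h v w : proportional v w -> proportional w v.
  move=> /asboolP[c c0 e]; apply/asboolP; exists c^-1; first by rewrite invr_eq0.
  by rewrite e scalerA mulVf // scale1r.
by move=> v w; apply/idP/idP; exact: h.
Qed.

Lemma proportional_trans : transitive proportional.
Proof.
move=> w v z /asboolP[c c0 e] /asboolP[d d0 f]; apply/asboolP; exists (d * c).
  by rewrite mulf_neq0.
by rewrite f e scalerA.
Qed.

Canonical proportional_equiv :=
  EquivRel proportional proportional_refl proportional_sym proportional_trans.

Definition PGL := {eq_quot proportional_equiv}.
HB.instance Definition _ := Choice.on PGL.
HB.instance Definition _ := EqQuotient.on PGL.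

Definition pgl_class (A : GL) : PGL := \pi_PGL A.

Lemma pgl_classP A B : proportional A B <-> pgl_class A = pgl_class B.
Proof. by split=> [h|/eqmodP //]; apply/eqmodP. Qed.

Lemma pgl_reprK (g : PGL) : pgl_class (repr g) = g.
Proof. by rewrite /pgl_class reprK. Qed.

Lemma pgl_repr A : exists2 c : R, c != 0 & glval (repr (pgl_class A)) = c *: glval A.
Proof. by apply/asboolP/pgl_classP; rewrite pgl_reprK. Qed.

Definition pgl_mul (g h : PGL) : PGL := pgl_class (repr g * repr h)%g.
Definition pgl_inv (g : PGL) : PGL := pgl_class (repr g)^-1%g.

Lemma pgl_mulE A B : pgl_mul (pgl_class A) (pgl_class B) = pgl_class (A * B)%g.
Proof.
apply/esym/pgl_classP/asboolP; have [c c0 e] := pgl_repr A.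
have [d d0 f] := pgl_repr B; exists (c * d); first by rewrite mulf_neq0.
by rewrite /= e f -scalemxAl -scalemxAr scalerA.
Qed.

Lemma pgl_mulA : associative pgl_mul.
Proof.
move=> a b c; rewrite -(pgl_reprK a) -(pgl_reprK b) -(pgl_reprK c).
by rewrite !pgl_mulE mulgA.
Qed.

Lemma pgl_mul1 : left_id (pgl_class 1%g) pgl_mul.
Proof. by move=> a; rewrite -(pgl_reprK a) pgl_mulE mul1g. Qed.

Lemma pgl_1mul : right_id (pgl_class 1%g) pgl_mul.
Proof. by move=> a; rewrite -(pgl_reprK a) pgl_mulE mulg1. Qed.

Lemma pgl_mulV : left_inverse (pgl_class 1%g) pgl_inv pgl_mul.
Proof. by move=> a; rewrite -{2}(pgl_reprK a) pgl_mulE mulVg. Qed.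

Lemma pgl_Vmul : right_inverse (pgl_class 1%g) pgl_inv pgl_mul.
Proof. by move=> a; rewrite -{1}(pgl_reprK a) pgl_mulE mulgV. Qed.

HB.instance Definition _ := isGroup.Build PGL pgl_mulA pgl_mul1 pgl_1mul pgl_mulV pgl_Vmul.

Lemma gl_act_subproof (A : GL) (v : nzvec) : glval A *m nzval v != 0.
Proof.
apply: contra (nzval_neq0 v) => /eqP e.
by rewrite -(mulKmx (glval_unit A) (nzval v)) e mulmx0.
Qed.

Definition gl_act (A : GL) (v : nzvec) : nzvec := NzVec (gl_act_subproof A v).

Definition pgl_act (g : PGL) (x : pspace) : pspace :=
  \pi_pspace (gl_act (repr g) (repr x)).

Lemma pgl_act_class A (v : nzvec) :
  pgl_act (pgl_class A) (\pi_pspace v) = \pi_pspace (gl_act A v).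
Proof.
have [c c0 e] := pgl_repr A.
have /asboolP[d d0 f] : collinear v (repr (\pi_pspace v)).
  by apply/(@eqmodP _ collinear_equiv); rewrite reprK.
apply/esym/(@eqmodP _ collinear_equiv)/asboolP; exists (c * d).
  by rewrite mulf_neq0.
by rewrite /nzval/= e; move: f; rewrite /nzval => ->; rewrite -scalemxAl -scalemxAr scalerA.
Qed.

(** * Projective simplices and reflections *)

(* The columns of [B] are lifts of the vertices. *)
Definition psimplex (B : GL) : set pspace :=
  [set x | exists2 a : 'cV[R]_n.+1, (forall j, 0 <= a j 0) & represents (glval B *m a) x].

Definition pface (B : GL) (i : 'I_n.+1) : set pspace :=
  [set x | exists2 a : 'cV[R]_n.+1, (forall j, 0 <= a j 0) /\ a i 0 = 0 &
     represents (glval B *m a) x].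

Lemma std_reflection_subproof :
  diag_mx (\row_(j < n.+1) (if j == 0 then -1 else 1 : R)) \in unitmx.
Proof.
rewrite unitmxE det_diag unitfE; apply/prodf_neq0 => i _; rewrite mxE.
by case: ifP; rewrite ?oppr_eq0 oner_eq0.
Qed.

(* the class of both diag (-1, 1, ..., 1) and its opposite *)
Definition std_reflection : PGL := pgl_class (MkGL std_reflection_subproof).

Definition projective_reflection (g : PGL) : Prop :=
  exists h : PGL, g = (h * std_reflection * h^-1)%g.

Definition projective_reflection_wrt (g : PGL) (F : set pspace) : Prop :=
  projective_reflection g /\ (forall x, F x -> pgl_act g x = x).

(** * Convexity and the Hilbert metric *)

(* The affine chart attached to a linear form [phi] is the complement of the
   hyperplane phi = 0, identified with the affine space phi = 1. *)
Definition in_chart (phi : 'rV[R]_n.+1) : set pspace :=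
  [set x | (phi *m hcoord x) 0 0 != 0].

Definition chart (phi : 'rV[R]_n.+1) (x : pspace) : 'cV[R]_n.+1 :=
  ((phi *m hcoord x) 0 0)^-1 *: hcoord x.

Definition properly_convex (Om : set pspace) : Prop :=
  exists2 phi : 'rV[R]_n.+1, phi != 0 &
    [/\ Om `<=` in_chart phi,
        convex_set (chart phi @` Om : set (convex_lmodType 'cV[R]_n.+1)) &
        bounded_set (chart phi @` Om)].

Definition segment_order (a b c d : 'cV[R]_n.+1) : Prop :=
  exists s r : R, [/\ 0 <= s, s <= r, r <= 1,
    b = a + s *: (d - a) & c = a + r *: (d - a)].

Definition boundary (Om : set pspace) : set pspace := closure Om `\` interior Om.

(* The cross-ratio depends neither on the chart nor on the norm, the four
   points being collinear: the set below is a singleton when [Om] is a properly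
   convex open set and [x], [y] are distinct points of [Om]. *)
Definition hilbert_dist (Om : set pspace) (x y : pspace) : R :=
  if x == y then 0 else
  get [set d : R | exists phi x' y',
    [/\ closure Om `<=` in_chart phi, boundary Om x', boundary Om y',
        segment_order (chart phi x') (chart phi x) (chart phi y) (chart phi y') &
        d = 2^-1 * ln ((`|chart phi x' - chart phi y| * `|chart phi y' - chart phi x|) /
                       (`|chart phi x' - chart phi x| * `|chart phi y' - chart phi y|))]].

(** * The Hausdorff topology on subsets of P^n *)

(* angle between two lines of the Euclidean space R^(n+1) *)
Definition pdist (x y : pspace) : R :=
  let dot (v w : 'cV[R]_n.+1) := (v^T *m w) 0 0 in
  acos (`|dot (hcoord x) (hcoord y)| /
        (Num.sqrt (dot (hcoord x) (hcoord x)) * Num.sqrt (dot (hcoord y) (hcoord y)))).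

(* [A t] converges to [K] for the Hausdorff distance, as t tends to [F] *)
Definition hausdorff_cvg (A : R -> set pspace) (F : set_system R) (K : set pspace) : Prop :=
  forall e : R, 0 < e -> \forall t \near F,
    (forall x, A t x -> exists2 y, K y & pdist x y < e) /\
    (forall y, K y -> exists2 x, A t x & pdist x y < e).

End Projective.

(** * Convex projective structures and simplicial deformation families *)

Section Deformation.
Variables (R : realType) (n : nat) (J : coxeter_diagram n).

Definition representation := {multiplicative coxeter_group J -> PGL R n}.

(* [v] are the normals of a simplex as in [coxeter_simplex]; they determine the
   action of the Coxeter group on hyperbolic space. *)
Definition convex_domain (v : 'I_n.+1 -> 'cV[R]_n.+1) (rho : representation)
    (Om : set (pspace R n)) : Prop :=
  [/\ open Om, properly_convex Om,
      forall g, pgl_act (rho g) @` Om = Om &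
      exists (f : 'cV[R]_n.+1 -> pspace R n) (f' : pspace R n -> 'cV[R]_n.+1),
        [/\ set_bij (@hyperbolic_space R n) Om f,
            {in @hyperbolic_space R n, cancel f f'},
            {within @hyperbolic_space R n, continuous f},
            {within Om, continuous f'} &
            forall w x, hyperbolic_space x ->
              f (word_isometry v w x) = pgl_act (rho (coxeter_word J w)) (f x)]].

Definition conj_class (rho : representation) : set representation :=
  [set rho' | exists h : PGL R n, forall g, rho' g = (h * rho g * h^-1)%g].

Definition moduli (v : 'I_n.+1 -> 'cV[R]_n.+1) : set (set representation) :=
  [set conj_class rho | rho in
    [set rho : representation | injective rho /\ exists Om, convex_domain v rho Om]].

Definition tiled_set (rho : representation) (B : GL R n) : set (pspace R n) :=
  \bigcup_(g in [set: coxeter_group J]) (pgl_act (rho g) @` psimplex B).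

(* Only the [rho t] with 0 < t matter. *)
Record simplicial_deformation_family (v : 'I_n.+1 -> 'cV[R]_n.+1) (B : GL R n)
    (rho : R -> representation) : Prop := {
  sdf_reflection : forall (t : R) i, 0 < t ->
    projective_reflection_wrt (rho t (coxeter_gen J i)) (pface B i);
  sdf_bij : set_bij [set t : R | 0 < t] (moduli v) (fun t => conj_class (rho t));
  sdf_domain : forall t : R, 0 < t -> convex_domain v (rho t) (tiled_set (rho t) B);
  sdf_cvg0 : hausdorff_cvg (fun t => tiled_set (rho t) B) (0 : R)^'+ (psimplex B);
  sdf_cvgy : hausdorff_cvg (fun t => tiled_set (rho t) B) (pinfty_nbhs R) (psimplex B)
}.

End Deformation.

(** * Entropy *)

(* [counting] is +oo on infinite sets. *)
Definition entropy (R : realType) (G : Type) (T : choiceType) (d : T -> T -> R)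
    (act : G -> T -> T) (x0 : T) : \bar R :=
  limf_esup (fun r : R => (r^-1)%:E *
      lne (counting ([set act g x0 | g in [set: G]] `&` [set y | d x0 y < r]))%R)%E
    (pinfty_nbhs R).

(* Main.v *)
(* Write a_0, ..., a_n for the barycentric coordinates of P, normalised to have
   sum 1. Once Omega_t is Hausdorff close to P one has a_i >= - eps on Omega_t,
   and comparing cross-ratios shows that for x, z in P the Hilbert distance is at
   least h_i(x) - h_i(z), where h_i = log((a_i + eps) / eps) / 2. Every x in P
   has a coordinate a_i >= 1/(n+1), so it is at distance at least
   L = log((1/(n+1) + eps) / eps) / 2 from the face P_i, and L tends to infinity
   as eps tends to 0. Cut the segment from x in P to gamma(y), y in P, along the
   walls it crosses and fold it back into P; since the Hilbert metric is additive
   along segments, a stretch shorter than L stays in a translate of the star of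
   a vertex, so that gamma(y) = s_1 ... s_N (y), where N <= d(x, gamma(y)) / L + 2
   and each s_k lies in a parabolic subgroup generated by all reflections but
   one. These subgroups are finite and independent of t, so the entropy is O(1/L).
   That the folding makes sense is Tits' theorem for the action on hyperbolic
   space, carried over to Omega_t by the equivariant homeomorphism; it says that
   no translate of P crosses a wall and that crossing the walls between P and
   gamma(P) shortens gamma. *)

(* The reflections acting on Omega_t are known only through the faces they fix; their centres vary
   with t in an unspecified way. The dihedral computation behind Tits' theorem is therefore made in
   hyperbolic space, where the angles are given, and only its conclusion is transported, namely the
   side of each wall on which a translate lies: fixed points identify the walls, and connectedness
   identifies the sides. A parabolic subgroup is finite because it fixes a vertex inside hyperbolic
   space, so that the orbit of an interior point stays in a bounded slice of the hyperboloid.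

   On the projective side everything is lifted to an open convex cone K over Omega_t. There the
   Hilbert distance is - log (m(X,Y) m(Y,X)) / 2, where m(X,Y) is the supremum of the l with X - l Y
   in K. A linear form nonnegative on K bounds m from above, which is the comparison of
   cross-ratios, and additivity along segments becomes an inequality between such suprema. In
   homogeneous coordinates the condition a_i >= - eps becomes a_i + eps (a_0 + ... + a_n) >= 0 on
   K. *)
Require Import Defs.
From HB Require Import structures.
From mathcomp Require Import all_boot all_order all_algebra.
From mathcomp Require Import all_classical all_reals all_analysis.
From mathcomp Require Import ring lra.

Set Implicit Arguments.
Unset Strict Implicit.
Unset Printing Implicit Defensive.

Import Order.TTheory GRing.Theory Num.Theory.
Import numFieldNormedType.Exports.

Local Open Scope classical_set_scope.
Local Open Scope ring_scope.

(** * Length and reduced words in a Coxeter group *)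

Section CoxeterLength.
Variables (n : nat) (J : coxeter_diagram n).
Local Notation W := (coxeter_group J).
Local Notation word := (coxeter_word J).
Local Notation gen := (coxeter_gen J).
Implicit Types (g h : W) (w : seq 'I_n.+1).

Lemma coxeter_word_cat w1 w2 : word (w1 ++ w2) = (word w1 * word w2)%g.
Proof. exact: (esym (coxeter_mulE J w1 w2)). Qed.

Lemma coxeter_word_nil : word [::] = 1%g.
Proof. by []. Qed.

Lemma coxeter_word_cons i w : word (i :: w) = (gen i * word w)%g.
Proof. exact: (coxeter_word_cat [:: i]). Qed.

Lemma coxeter_gen_invol i : (gen i * gen i = 1)%g.
Proof.
rewrite -coxeter_word_cons -coxeter_word_nil; apply/coxeter_wordP.
exact: (CoxInvol J [::] [::] i).
Qed.

Lemma coxeter_genK i g : (gen i * (gen i * g) = g)%g.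
Proof. by rewrite mulgA coxeter_gen_invol mul1g. Qed.

Lemma coxeter_len_subproof g : exists k, `[< exists2 w, word w = g & size w = k >].
Proof. by exists (size (repr g)); apply/asboolP; exists (repr g) => //; exact: coxeter_reprK. Qed.

Definition coxeter_len g : nat := ex_minn (coxeter_len_subproof g).

Lemma coxeter_len_word w : (coxeter_len (word w) <= size w)%N.
Proof.
rewrite /coxeter_len; case: ex_minnP => k _; apply; apply/asboolP.
by exists w.
Qed.

Lemma coxeter_reduced g : exists2 w, word w = g & size w = coxeter_len g.
Proof. by rewrite /coxeter_len; case: ex_minnP => k /asboolP. Qed.

Lemma coxeter_lenM g h : (coxeter_len (g * h)%g <= coxeter_len g + coxeter_len h)%N.
Proof.
have [w <- <-] := coxeter_reduced g; have [w' <- <-] := coxeter_reduced h.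
by rewrite -coxeter_word_cat (leq_trans (coxeter_len_word _)) // size_cat.
Qed.

Lemma coxeter_len_descent g : g != 1%g -> exists i, (coxeter_len (gen i * g)%g < coxeter_len g)%N.
Proof.
have [[|i w] <- Ew g1] := coxeter_reduced g; first by rewrite coxeter_word_nil eqxx in g1.
by exists i; rewrite coxeter_word_cons coxeter_genK -coxeter_word_cons -Ew ltnS coxeter_len_word.
Qed.

Lemma coxeter_ind (P : W -> Prop) :
  P 1%g -> (forall i g, P g -> P (gen i * g)%g) -> forall g, P g.
Proof.
move=> P1 PS g; rewrite -(coxeter_reprK g); elim: (repr g) => // i w IH.
by rewrite coxeter_word_cons; exact: PS.
Qed.

Fixpoint altword (s t : 'I_n.+1) (k : nat) : seq 'I_n.+1 :=
  if k is k'.+1 then s :: altword t s k' else [::].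

Lemma size_altword s t k : size (altword s t k) = k.
Proof. by elim: k s t => //= k IH s t; rewrite IH. Qed.

Lemma altword_cat s t k l : (l <= k)%N -> exists w, altword s t k = altword s t l ++ w.
Proof.
elim: k s t l => [|k IH] s t [|l] //; [by exists [::] | by eexists|].
by rewrite ltnS => /(IH t s)[w /= ->]; exists w.
Qed.

(** The inverse of [altword t s k] prolongs the alternation of [altword s t k], to 2 k letters in
    all. *)
Lemma word_altword s t k :
  word (altword s t k) = ((gen s * gen t) ^+ k * word (altword t s k))%g.
Proof.
elim: k s t => [|k IH] s t; first by rewrite expg0 mul1g.
rewrite [altword s t _]/= [altword t s _]/= !coxeter_word_cons.
rewrite expgSr -[((_ ^+ k * _) * _)%g]mulgA -[((gen s * _) * _)%g]mulgA coxeter_genK.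
have comm : ((gen s * gen t) ^+ k * gen s = gen s * (gen t * gen s) ^+ k)%g.
  elim: k {IH} => [|k IHk]; first by rewrite !expg0 mul1g mulg1.
  by rewrite expgS -!mulgA IHk expgS -!mulgA.
by rewrite mulgA comm -mulgA (IH t s).
Qed.

Lemma word_altword_braid s t m : s != t -> J s t = Some m ->
  word (altword s t m) = word (altword t s m).
Proof.
move=> st Jm; rewrite word_altword.
suff -> : ((gen s * gen t) ^+ m = 1)%g by rewrite mul1g.
have -> : ((gen s * gen t) ^+ m = word (flatten (nseq m [:: s; t])))%g.
  elim: m {Jm} => [|m IH]; first by rewrite expg0.
  by rewrite expgS IH /= !coxeter_word_cons mulgA.
rewrite -coxeter_word_nil; apply/coxeter_wordP.
by have := CoxBraid [::] [::] st Jm; rewrite cats0.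
Qed.

Lemma altwordP s t w : all (fun i => (i == s) || (i == t)) w ->
  (forall a b i, w <> a ++ [:: i; i] ++ b) ->
  w = altword s t (size w) \/ w = altword t s (size w).
Proof.
elim: w => [|i w IH] /=; first by move=> *; left.
case/andP=> ist wst red.
have red' a b j : w <> a ++ [:: j; j] ++ b.
  by move=> E; apply: (red (i :: a) b j); rewrite E.
have [E|E] := IH wst red'.
  case/orP: ist red => /eqP-> red {IH}; last by right; rewrite {1}E.
  case: w E wst red red' => [|j w] /=; first by move=> *; left.
  by case=> -> E _ red; case: (red [::] w s).
case/orP: ist red => /eqP-> red {IH}; first by left; rewrite {1}E.
case: w E wst red red' => [|j w] /=; first by move=> *; right.
by case=> -> E _ red; case: (red [::] w t).
Qed.

End CoxeterLength.

(** * The Lorentz form *)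

Section Lorentz.
Variables (R : realType) (n : nat).
Implicit Types (x y z v : 'cV[R]_n.+1).

Lemma lorentzC x y : lorentz x y = lorentz y x.
Proof. by apply: eq_bigr => i _; rewrite (mulrC (x i 0)). Qed.

Lemma lorentzDl x y z : lorentz (x + y) z = lorentz x z + lorentz y z.
Proof. by rewrite -big_split; apply: eq_bigr => i _ /=; rewrite !mxE; case: ifP => _; ring. Qed.

Lemma lorentzZl a x z : lorentz (a *: x) z = a * lorentz x z.
Proof. by rewrite mulr_sumr; apply: eq_bigr => i _ /=; rewrite !mxE; case: ifP => _; ring. Qed.

Lemma lorentzNl x z : lorentz (- x) z = - lorentz x z.
Proof. by rewrite -scaleN1r lorentzZl mulN1r. Qed.

Lemma lorentzBl x y z : lorentz (x - y) z = lorentz x z - lorentz y z.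
Proof. by rewrite lorentzDl lorentzNl. Qed.

Lemma lorentzDr x y z : lorentz x (y + z) = lorentz x y + lorentz x z.
Proof. by rewrite lorentzC lorentzDl !(lorentzC x). Qed.

Lemma lorentzZr a x z : lorentz x (a *: z) = a * lorentz x z.
Proof. by rewrite lorentzC lorentzZl (lorentzC x). Qed.

Lemma lorentzBr x y z : lorentz x (y - z) = lorentz x y - lorentz x z.
Proof. by rewrite lorentzC lorentzBl !(lorentzC x). Qed.

Lemma lorentz_suml (I : finType) (F : I -> 'cV[R]_n.+1) z :
  lorentz (\sum_i F i) z = \sum_i lorentz (F i) z.
Proof.
elim/big_ind2: _ => [|x1 a x2 b <- <-|//]; last by rewrite lorentzDl.
by rewrite -(scale0r 0) lorentzZl mul0r.
Qed.

Lemma lorentzE x y :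
  lorentz x y = - (x 0 0 * y 0 0) + \sum_(i | i != 0) x i 0 * y i 0.
Proof.
rewrite /lorentz (bigD1 0) //=; congr (_ + _).
by apply: eq_bigr => i /negPf ->.
Qed.

Lemma cauchy_schwarz (I : finType) (P : pred I) (F G : I -> R) :
  (\sum_(i | P i) F i * G i) ^+ 2 <= (\sum_(i | P i) F i * F i) * (\sum_(i | P i) G i * G i).
Proof.
set A := \sum_(i | P i) F i * F i; set B := \sum_(i | P i) F i * G i.
set C := \sum_(i | P i) G i * G i.
have pos (a b : R) : 0 <= a ^+ 2 * A + 2 * a * b * B + b ^+ 2 * C.
  rewrite /A /B /C !mulr_sumr -!big_split /=; apply: sumr_ge0 => i _.
  by have := sqr_ge0 (a * F i + b * G i); congr (_ <= _); ring.
have A0 : 0 <= A by apply: sumr_ge0 => i _; rewrite -expr2 sqr_ge0.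
have C0 : 0 <= C by apply: sumr_ge0 => i _; rewrite -expr2 sqr_ge0.
(* The first instance is A (A C - B^2) >= 0 and settles A > 0. When A = 0 the other two read - C B^2
   >= 0 and (C - 2) B^2 >= 0, which force B = 0. *)
have := pos B (- A); have := pos C (- B); have := pos 1 (- B).
have [A_gt0|] := ltP 0 A; last first.
  move=> A_le0; have -> : A = 0 by lra.
  nra.
by move=> _ _ h; rewrite -subr_ge0 -(pmulr_rge0 _ A_gt0); nra.
Qed.

(** Reverse Cauchy-Schwarz inequality: a nonnegative product would give x_0 y_0 <= S, with S the
    Euclidean product of the other coordinates, whereas S^2 <= (x_0^2 - 1) (y_0^2 - 1) < (x_0
    y_0)^2. *)
Lemma hyperbolic_lorentz_lt0 x y :
  hyperbolic_space x -> lorentz y y <= -1 -> 0 < y 0 0 -> lorentz x y < 0.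
Proof.
rewrite /hyperbolic_space /= !lorentzE => -[xx x0] yy y0.
have := cauchy_schwarz (fun i : 'I_n.+1 => i != 0) (fun i => x i 0) (fun i => y i 0) => /=.
move: xx yy; set X := \sum_(i | _) x i 0 * x i 0; set Y := \sum_(i | _) y i 0 * y i 0.
set S := \sum_(i | _) _; move=> xx yy cs.
rewrite ltNge; apply/negP => h.
have X0 : 0 <= X by apply: sumr_ge0 => i _; rewrite -expr2 sqr_ge0.
have Y0 : 0 <= Y by apply: sumr_ge0 => i _; rewrite -expr2 sqr_ge0.
have : (x 0 0 * y 0 0) ^+ 2 <= S ^+ 2.
  by rewrite lerXn2r ?nnegrE //; have := mulr_gt0 x0 y0; lra.
move=> hS; move: cs; have -> : X = x 0 0 ^+ 2 - 1 by rewrite expr2; lra.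
have Yle : Y <= y 0 0 ^+ 2 - 1 by rewrite expr2; lra.
have : 0 < x 0 0 ^+ 2 by rewrite exprn_gt0.
have : 0 < y 0 0 ^+ 2 by rewrite exprn_gt0.
move: hS; rewrite exprMn; nra.
Qed.

Lemma lorentz_reflectionE v x y : lorentz v v = 1 ->
  lorentz (lorentz_reflection v x) (lorentz_reflection v y) = lorentz x y.
Proof.
move=> vv; rewrite /lorentz_reflection !(lorentzBl, lorentzBr, lorentzZl, lorentzZr) vv.
by rewrite (lorentzC v y); ring.
Qed.

Lemma lorentz_reflectionC v x y :
  lorentz (lorentz_reflection v x) y = lorentz x (lorentz_reflection v y).
Proof.
rewrite /lorentz_reflection !(lorentzBl, lorentzBr, lorentzZl, lorentzZr).
by rewrite (lorentzC v y); ring.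
Qed.

(** The two sheets are not exchanged: the product of x with its mirror image is - 1 - 2 (lorentz x
    v)^2 < 0, while it would be positive if the image were on the opposite sheet. *)
Lemma lorentz_reflection_hyperbolic v x : lorentz v v = 1 ->
  hyperbolic_space x -> hyperbolic_space (lorentz_reflection v x).
Proof.
move=> vv Hx; have [xx x0] := Hx; have := lorentz_reflectionE x x vv; rewrite xx => rxrx.
split=> //; rewrite ltNge; apply/negP; rewrite le_eqVlt => /orP[/eqP rx0|rx0].
  move: rxrx; rewrite lorentzE rx0 mul0r oppr0 add0r => h.
  suff : 0 <= (-1 : R) by lra.
  by rewrite -h; apply: sumr_ge0 => i _; rewrite -expr2 sqr_ge0.
have : lorentz x (- lorentz_reflection v x) < 0.
  apply: hyperbolic_lorentz_lt0 => //; last by rewrite mxE oppr_gt0.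
  by rewrite lorentzNl lorentzC lorentzNl opprK rxrx.
rewrite lorentzC lorentzNl /lorentz_reflection lorentzBl lorentzZl (lorentzC v x) xx.
by have := sqr_ge0 (lorentz x v); rewrite expr2; lra.
Qed.

End Lorentz.

(** * Tits' theorem *)

Section DihedralSequence.
Variable R : realType.

(* [p k] is [sin (k theta) / sin theta], read as [k] when [theta = 0]. *)
Lemma dihedral_sequence (m : option nat) :
  (forall k, m = Some k -> (2 <= k)%N) ->
  exists p : nat -> R, [/\ p 0%N = 0, p 1%N = 1,
    forall k, p k.+2 = 2 * cos (dihedral_angle R m) * p k.+1 - p k &
    forall k, (if m is Some l then k <= l else true)%N -> 0 <= p k].
Proof.
case: m => [m|] m2; last first.
  exists (fun k => k%:R); split=> //= k; rewrite cos0 -(natr1 k.+1) -(natr1 k); ring.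
have {m2} m2 : (2 <= m)%N by exact: m2.
have m0 : 0 < m%:R :> R by rewrite ltr0n (leq_trans _ m2).
pose th : R := pi / m%:R.
have th0 : 0 < th by rewrite divr_gt0 ?pi_gt0.
have thpi : th < pi.
  by rewrite ltr_pdivrMr // ltr_pMr ?pi_gt0 // ltr1n.
have s0 : 0 < sin th by rewrite sin_gt0_pi // th0.
exists (fun k => sin (k%:R * th) / sin th); split.
- by rewrite mul0r sin0 mul0r.
- by rewrite mul1r divff // gt_eqF.
- move=> k /=; rewrite -/th.
  have -> : k.+2%:R * th = k.+1%:R * th + th by rewrite -(natr1 k.+1); ring.
  have -> : k%:R * th = k.+1%:R * th - th by rewrite -(natr1 k); ring.
  by rewrite sinB sinD; field; rewrite gt_eqF.
- move=> k km; rewrite divr_ge0 ?(ltW s0) // sin_ge0_pi //.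
  rewrite mulr_ge0 ?(ltW th0) //= /th mulrC -mulrA ler_piMr ?pi_ge0 //.
  by rewrite mulrC ler_pdivrMr // mul1r ler_nat.
Qed.

End DihedralSequence.

Section Tits.
Variables (R : realType) (n : nat) (J : coxeter_diagram n).
Variables (v : 'I_n.+1 -> 'cV[R]_n.+1).
Variable act : coxeter_group J -> 'cV[R]_n.+1 -> 'cV[R]_n.+1.
Local Notation W := (coxeter_group J).
Local Notation word := (coxeter_word J).
Local Notation gen := (coxeter_gen J).
Local Notation len := (@coxeter_len n J).
Implicit Types (g h : W) (w : seq 'I_n.+1) (x y : 'cV[R]_n.+1).

Hypothesis v_unit : forall i, lorentz (v i) (v i) = 1.
Hypothesis v_angle : forall i j, i != j ->
  lorentz (v i) (v j) = - cos (dihedral_angle R (J i j)).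
Hypothesis act1 : forall x, hyperbolic_space x -> act 1%g x = x.
Hypothesis actS : forall i g x, hyperbolic_space x ->
  act (gen i * g)%g x = lorentz_reflection (v i) (act g x).

Definition chamber : set 'cV[R]_n.+1 :=
  [set x | hyperbolic_space x /\ forall i, lorentz x (v i) <= 0].

Lemma act_word_cat w g x : hyperbolic_space x ->
  act (word w * g)%g x = word_isometry v w (act g x).
Proof.
move=> Hx; elim: w => [|i w IH]; first by rewrite coxeter_word_nil mul1g.
by rewrite coxeter_word_cons -mulgA actS //= IH.
Qed.

Lemma act_hyperbolic g x : hyperbolic_space x -> hyperbolic_space (act g x).
Proof.
move=> Hx; elim/coxeter_ind: g => [|i g IH]; first by rewrite act1.
by rewrite actS //; exact: lorentz_reflection_hyperbolic.
Qed.

Lemma act_lorentz g x y : hyperbolic_space x -> hyperbolic_space y ->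
  lorentz (act g x) (act g y) = lorentz x y.
Proof.
move=> Hx Hy; elim/coxeter_ind: g => [|i g IH]; first by rewrite !act1.
by rewrite !actS // lorentz_reflectionE.
Qed.

(** Reflections are self-adjoint, so the letters can be moved one by one onto the vector. Each of
    them raises both indices by one and exchanges s and t; at the end y is paired with a combination
    of [v s] and [v t] whose coefficients are the two values of [p] assumed nonnegative. *)
Lemma altword_root_le0 s t (p : nat -> R) y : s != t ->
  (forall k, p k.+2 = 2 * cos (dihedral_angle R (J s t)) * p k.+1 - p k) ->
  lorentz y (v s) <= 0 -> lorentz y (v t) <= 0 ->
  forall k j, 0 <= p (j + k)%N -> 0 <= p (j + k).+1 ->
  lorentz (word_isometry v (altword t s k) y) (p j.+1 *: v s + p j *: v t) <= 0.
Proof.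
move=> st pS ys yt k; elim: k s t st pS ys yt => [|k IH] s t st pS ys yt j pj pj1.
  move: pj pj1; rewrite addn0 /= lorentzDr !lorentzZr => pj pj1.
  nra.
rewrite /= lorentz_reflectionC.
have -> : lorentz_reflection (v t) (p j.+1 *: v s + p j *: v t)
          = p j.+2 *: v t + p j.+1 *: v s.
  rewrite /lorentz_reflection lorentzDl !lorentzZl v_unit v_angle // pS.
  rewrite -addrA -scalerBl addrC; congr (_ *: _ + _); ring.
apply: IH => //; first by rewrite eq_sym.
- by move=> i; rewrite weight_sym.
- by rewrite addSnnS.
- by rewrite addSnnS.
Qed.

(* A reduced decomposition [g = w h], with [w] a word in [s] and [t] and [h] of
   minimal length, leaves [h] shorter than [g] and on the inner side of both
   walls; there remains a computation in the dihedral group of [s] and [t]. *)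
Lemma tits_inner g s x : chamber x ->
  (len g <= len (gen s * g)%g)%N -> lorentz (act g x) (v s) <= 0.
Proof.
move=> Cx; have [Hx _] := Cx.
elim/ltn_ind: {g}(len g) {-2}g (erefl (len g)) s => l IHl g Eg s sg; subst l.
have [->|g1] := eqVneq g 1%g; first by rewrite act1 //; have [_] := Cx.
have [t tg] := coxeter_len_descent g1.
have st : s != t by apply: contraTneq sg => ->; rewrite -ltnNge.
pose dec k := `[< exists w h, [/\ g = (word w * h)%g, all (fun i => (i == s) || (i == t)) w,
  (size w + len h)%N = len g & len h = k] >].
have len_tg : (1 + len (gen t * g)%g)%N = len g.
  apply/eqP; rewrite eqn_leq tg /=.
  have := coxeter_lenM (gen t) (gen t * g)%g; rewrite coxeter_genK => /leq_trans; apply.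
  by rewrite leq_add2r (coxeter_len_word J [:: t]).
have dec_tg : dec (len (gen t * g)%g).
  apply/asboolP; exists [:: t], (gen t * g)%g; split=> //=.
    by rewrite coxeter_genK.
  by rewrite eqxx orbT.
have [k /asboolP[w [h [Egwh wst Elen Ek]]] kmin] := ex_minnP (ex_intro dec _ dec_tg).
have hg : (len h < len g)%N by rewrite Ek; exact: leq_ltn_trans (kmin _ dec_tg) tg.
have inner i : (i == s) || (i == t) -> lorentz (act h x) (v i) <= 0.
  move=> ist; apply: (IHl _ hg h (erefl _)); rewrite leqNgt; apply/negP => ih.
  suff /kmin : dec (len (gen i * h)%g) by rewrite -Ek leqNgt ih.
  apply/asboolP; exists (rcons w i), (gen i * h)%g.
  have Eg' : g = (word (rcons w i) * (gen i * h))%g.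
    by rewrite -cats1 coxeter_word_cat -mulgA coxeter_genK.
  split=> //; first by rewrite all_rcons ist.
  apply/eqP; rewrite eqn_leq {2}Eg' (leq_trans (coxeter_lenM _ _)) ?leq_add2r ?coxeter_len_word //.
  by rewrite size_rcons addSnnS -Elen leq_add2l ih.
have short w' : g = (word w' * h)%g -> (size w <= size w')%N.
  move=> Eg'; rewrite -(leq_add2r (len h)) Elen {1}Eg'.
  by rewrite (leq_trans (coxeter_lenM _ _)) // leq_add2r coxeter_len_word.
have red a b i : w <> a ++ [:: i; i] ++ b.
  move=> Ew; have : g = (word (a ++ b) * h)%g.
    by rewrite Egwh; congr (_ * _)%g; apply/coxeter_wordP; rewrite Ew; exact: CoxInvol.
  by move=> /short; rewrite Ew !size_cat /= leq_add2l ltnNge leqnSn.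
(* As s does not shorten g, a factorisation that begins with s has at least one letter more than
   [w]. *)
have nos w' : g = (word (s :: w') * h)%g -> (size w <= size w')%N.
  move=> Eg'; rewrite -(leq_add2r (len h)) Elen (leq_trans sg) // {1}Eg'.
  rewrite coxeter_word_cons -mulgA coxeter_genK.
  by rewrite (leq_trans (coxeter_lenM _ _)) // leq_add2r coxeter_len_word.
have Ew : w = altword t s (size w).
  have [Ew|//] := altwordP wst red.
  case: w Ew nos {Elen Egwh wst red short} (Egwh) => [//|i w] /= [-> _] nos E.
  by have := nos w E; rewrite ltnn.
rewrite Egwh act_word_cat // Ew.
have [p [p0 p1 pS pge0]] := @dihedral_sequence R (J s t) (fun m => @weight_ge2 _ J s t m st).
have -> : v s = p 1%N *: v s + p 0%N *: v t by rewrite p0 p1 scale1r scale0r addr0.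
(* With m or more letters, [w] could be rewritten by the braid relation so as to begin with s,
   against [nos]. Being below m keeps the two final coefficients in the range where [p] is
   nonnegative. *)
have size_lt : (if J s t is Some l then (size w).+1 <= l else true)%N.
  case Jst: (J s t) => [m|//]; rewrite ltnNge; apply/negP => mw.
  have [w' Ew'] := altword_cat t s mw.
  have m0 : (0 < m)%N by rewrite (leq_trans _ (weight_ge2 st Jst)).
  have Ealt : word (altword t s m) = word (s :: altword t s m.-1).
    by rewrite -(word_altword_braid st Jst) -[in LHS](prednK m0).
  have := nos (altword t s m.-1 ++ w').
  rewrite -cat_cons coxeter_word_cat -Ealt -coxeter_word_cat -Ew' -Ew => /(_ Egwh).
  rewrite size_cat size_altword.
  have : size w = size (altword t s m ++ w') by rewrite -Ew' -Ew.
  rewrite size_cat size_altword => ->; rewrite leq_add2r.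
  by case: m m0 {Jst mw Ew' Ealt} => // m _; rewrite ltnn.
apply: altword_root_le0 => //; rewrite ?add0n ?inner ?eqxx ?orbT //; apply: pge0.
- by move: size_lt; case: (J s t) => // m /ltnW.
- by move: size_lt; case: (J s t).
Qed.

Lemma tits_outer g s x : chamber x ->
  (len (gen s * g)%g < len g)%N -> 0 <= lorentz (act g x) (v s).
Proof.
move=> Cx sg; have [Hx _] := Cx.
have := @tits_inner (gen s * g)%g s x Cx; rewrite coxeter_genK => /(_ (ltnW sg)).
rewrite actS // lorentz_reflectionC /lorentz_reflection v_unit lorentzBr lorentzZr.
by lra.
Qed.

End Tits.

(** * Finiteness of the parabolic subgroups *)

(** Pigeonhole: with boxes of side sqrt (eta / (n+1)), two points of the same box are at squared
    distance less than eta. *)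
Lemma separated_finite (R : realType) (n : nat) (T : choiceType) (A : set T)
    (F : T -> 'cV[R]_n.+1) (C eta : R) : 0 < eta ->
  (forall a j, A a -> `|F a j 0| <= C) ->
  (forall a b, A a -> A b -> a != b -> eta <= \sum_j (F a j 0 - F b j 0) ^+ 2) ->
  finite_set A.
Proof.
move=> eta0 bnd sep.
pose d := Num.sqrt (eta / n.+1%:R); have d0 : 0 < d by rewrite sqrtr_gt0 divr_gt0.
pose N := Num.truncn ((C + C) / d).
pose G a : {ffun 'I_n.+1 -> 'I_N.+1} := [ffun j => inord (Num.truncn ((F a j 0 + C) / d))].
suff inj : {in A &, injective G}.
  by rewrite -(eq_finite_set (inj_card_eq inj)); exact: (@finite_finset {ffun 'I_n.+1 -> 'I_N.+1}).
move=> a b /set_mem Aa /set_mem Ab Eab; apply/eqP/negPn/negP => ab.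
have := sep _ _ Aa Ab ab; apply/negP; rewrite -ltNge.
have pos c j : A c -> 0 <= (F c j 0 + C) / d.
  by move=> Ac; have := bnd c j Ac; rewrite ler_norml => /andP[? _]; rewrite divr_ge0 ?(ltW d0) //; lra.
have small c j : A c -> (Num.truncn ((F c j 0 + C) / d)%R < N.+1)%N.
  move=> Ac; rewrite ltnS /N Num.Theory.truncn_le_nat.
  apply: le_lt_trans (proj2 (andP (Num.Theory.truncn_itv _))); last first.
    by have := bnd c j Ac => /(le_trans (normr_ge0 _)) C0; rewrite divr_ge0 ?(ltW d0) ?addr_ge0.
  rewrite ler_pM2r ?invr_gt0 // lerD2r.
  by have := bnd c j Ac; rewrite ler_norml => /andP[].
have close j : (F a j 0 - F b j 0) ^+ 2 < eta / n.+1%:R.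
  have dd : d ^+ 2 = eta / n.+1%:R by rewrite sqr_sqrtr // divr_ge0 // ltW.
  have := congr1 (fun g : {ffun 'I_n.+1 -> 'I_N.+1} => nat_of_ord (g j)) Eab.
  rewrite !ffunE !inordK ?small // => Et.
  have := Num.Theory.truncn_itv (pos a j Aa); have := Num.Theory.truncn_itv (pos b j Ab).
  rewrite Et; set k := Num.truncn _ => /andP[b1 b2] /andP[a1 a2].
  have : `|(F a j 0 + C) / d - (F b j 0 + C) / d| < 1.
    rewrite ltr_norml; move: b2 a2; rewrite -natr1 => b2 a2; apply/andP; split; lra.
  rewrite -mulrBl normrM normfV (gtr0_norm d0) ltr_pdivrMr // mul1r.
  have -> : F a j 0 + C - (F b j 0 + C) = F a j 0 - F b j 0 by ring.
  by rewrite -dd -[X in X < _ ^+ 2](real_normK (num_real _)) => h; rewrite ltrXn2r ?nnegrE // ltW.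
have -> : eta = \sum_(j < n.+1) (eta / n.+1%:R).
  by rewrite sumr_const card_ord -[RHS]mulr_natr divfK.
by apply: ltr_sum => [|j _ //]; apply/hasP; exists 0 => //; exact: mem_index_enum.
Qed.

Section Parabolic.
Variables (R : realType) (n : nat) (J : coxeter_diagram n).
Variables (u v : 'I_n.+1 -> 'cV[R]_n.+1).
Variable act : coxeter_group J -> 'cV[R]_n.+1 -> 'cV[R]_n.+1.
Local Notation W := (coxeter_group J).
Local Notation word := (coxeter_word J).
Local Notation gen := (coxeter_gen J).
Implicit Types (g h : W) (w : seq 'I_n.+1) (x y : 'cV[R]_n.+1).

Hypothesis uv : coxeter_simplex J u v.
Hypothesis act1 : forall x, hyperbolic_space x -> act 1%g x = x.
Hypothesis actS : forall i g x, hyperbolic_space x ->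
  act (gen i * g)%g x = lorentz_reflection (v i) (act g x).

Let v_unit := normal_unit uv.
Let v_angle := face_angle uv.
Let actH := act_hyperbolic v_unit act1 actS.
Let actL := act_lorentz v_unit act1 actS.

Definition parabolic i : set W := [set g | exists2 w, word w = g & i \notin w].

Lemma parabolic1 i : parabolic i 1%g.
Proof. by exists [::]. Qed.

Lemma parabolic_genM i j g : i != j -> parabolic i g -> parabolic i (gen j * g)%g.
Proof.
move=> ij [w <- iw]; exists (j :: w); first by rewrite coxeter_word_cons.
by rewrite inE negb_or ij.
Qed.

Lemma parabolicM i g h : parabolic i g -> parabolic i h -> parabolic i (g * h)%g.
Proof.
move=> [w <- iw] [w' <- iw']; exists (w ++ w'); first by rewrite coxeter_word_cat.
by rewrite mem_cat negb_or iw.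
Qed.

Lemma parabolicV i g : parabolic i g -> parabolic i g^-1%g.
Proof.
move=> [w <- iw]; exists (rev w); last by rewrite mem_rev.
apply: (mulIg (word w)); rewrite mulVg -coxeter_word_cat -coxeter_word_nil.
by apply/coxeter_wordP; exact: coxeter_eq_rev.
Qed.

Lemma act_mul g h x : hyperbolic_space x -> act (g * h)%g x = act g (act h x).
Proof.
move=> Hx; elim/coxeter_ind: g => [|i g IH]; first by rewrite mul1g act1 //; exact: actH.
by rewrite -mulgA !actS ?IH //; exact: actH.
Qed.

Lemma parabolic_act i g : parabolic i g -> act g (u i) = u i.
Proof.
have Hu := vertex_hyperbolic uv i.
move=> [w <-]; elim: w => [|j w IH]; first by rewrite act1.
rewrite inE negb_or => /andP[ij /IH E]; rewrite coxeter_word_cons actS // E.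
by rewrite /lorentz_reflection (vertex_in_face uv) 1?eq_sym // mulr0 scale0r subr0.
Qed.

Let E x := \sum_j x j 0 ^+ 2.

Lemma lorentz_sqr_le x y : lorentz x y ^+ 2 <= E x * E y.
Proof.
have := cauchy_schwarz xpredT (fun j => x j 0) (fun j => if j == 0 then - y j 0 else y j 0).
rewrite /lorentz /E; congr (_ ^+ 2 <= _ * _).
- by apply: eq_bigr => j _; case: ifP => _; ring.
- by apply: eq_bigr => j _; case: ifP => _; ring.
Qed.

Lemma lorentz_diag_le x : lorentz x x <= E x.
Proof.
apply: ler_sum => j _; have := sqr_ge0 (x j 0); rewrite expr2; case: ifP => _ //.
by move=> ?; lra.
Qed.

(** The form is positive definite on the orthogonal complement of a timelike vector. With a = x_0^2,
    b = u_0^2 and Z the sum of the other squares of x, Cauchy-Schwarz gives a b <= Z (b - 1), hence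
    a <= Z <= b (Z - a). *)
Lemma lorentz_orth_ge i x : lorentz x (u i) = 0 ->
  E x <= 2 * (u i 0 0) ^+ 2 * lorentz x x.
Proof.
have [uu u0] := vertex_hyperbolic uv i; rewrite lorentzE => xu.
have := cauchy_schwarz (fun j : 'I_n.+1 => j != 0) (fun j => x j 0) (fun j => u i j 0) => /=.
move: uu; rewrite !lorentzE /E [\sum_j x j 0 ^+ 2](bigD1 0) //=.
have -> : \sum_(j < n.+1 | j != 0) x j 0 ^+ 2 = \sum_(j < n.+1 | j != 0) x j 0 * x j 0.
  by apply: eq_bigr => j _; rewrite expr2.
have Z0 : 0 <= \sum_(j < n.+1 | j != 0) x j 0 * x j 0.
  by apply: sumr_ge0 => j _; rewrite -expr2 sqr_ge0.
have -> : \sum_(j < n.+1 | j != 0) x j 0 * u i j 0 = x 0 0 * u i 0 0 by lra.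
move: Z0; set Z := \sum_(j | _) _; set U := \sum_(j | _) _ => Z0 uu.
have -> : U = u i 0 0 ^+ 2 - 1 by rewrite expr2; lra.
rewrite exprMn -expr2; set a := x 0 0 ^+ 2; set b := u i 0 0 ^+ 2 => cs.
have b0 : 0 < b by rewrite exprn_gt0.
have a0 : 0 <= a by rewrite sqr_ge0.
have aZ : a <= Z by rewrite -(ler_pM2r b0); nra.
nra.
Qed.

(** An interior point of the simplex: the sum of the vertices, rescaled into the hyperboloid. *)
Definition center : 'cV[R]_n.+1 :=
  (Num.sqrt (- lorentz (\sum_i u i) (\sum_i u i)))^-1 *: \sum_i u i.

Let q := center.

Lemma center_chamber : hyperbolic_space q /\ forall i, lorentz q (v i) < 0.
Proof.
have sum_lt0 (F : 'I_n.+1 -> R) : (forall j, F j < 0) -> \sum_j F j < 0.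
  by move=> F0; rewrite big_ord_recl ltr_nwDl // sumr_le0 // => j _; exact: ltW.
have S_lt0 : lorentz (\sum_i u i) (\sum_i u i) < 0.
  rewrite lorentz_suml; apply: (sum_lt0 _) => i; rewrite lorentzC lorentz_suml; apply: sum_lt0 => j.
  have [uu u0] := vertex_hyperbolic uv i.
  by apply: hyperbolic_lorentz_lt0 => //; [exact: (vertex_hyperbolic uv)|rewrite uu].
have c0 : 0 < (Num.sqrt (- lorentz (\sum_i u i) (\sum_i u i)))^-1.
  by rewrite invr_gt0 sqrtr_gt0 oppr_gt0.
split; first split.
- rewrite lorentzZl lorentzZr mulrA -expr2 exprVn sqr_sqrtr ?oppr_ge0 ?(ltW S_lt0) //.
  by rewrite invrN mulNr mulVf // lt_eqF.
- rewrite mxE mulr_gt0 // summxE -oppr_lt0 -sumrN; apply: sum_lt0 => j.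
  by rewrite oppr_lt0; have [] := vertex_hyperbolic uv j.
- move=> i; rewrite lorentzZl pmulr_rlt0 // lorentz_suml (bigD1 i) //=.
  rewrite big1 ?addr0; first exact: (vertex_inner_side uv).
  by move=> j ji; rewrite (vertex_in_face uv) // eq_sym.
Qed.

(** The orbit of [q] under the subgroup fixing [u i] lies in a slice of the hyperboloid where the
    product with [u i] is constant, and this slice is bounded. The orbit is uniformly separated: by
    Tits' theorem a nontrivial element carries [q] across some wall, and [q] has positive distance
    to all walls. *)
Lemma finite_parabolic i : finite_set (parabolic i).
Proof.
have [Hq qv] := center_chamber; have [qq q0] := Hq.
have [uu u0] := vertex_hyperbolic uv i.
have Cq : chamber v q by split=> // j; exact: ltW.
pose b := u i 0 0 ^+ 2; have b0 : 0 < b by rewrite exprn_gt0.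
pose V := \sum_s E (v s).
have E0 x : 0 <= E x by apply: sumr_ge0 => j _; exact: sqr_ge0.
have Ev s : 0 < E (v s) by apply: lt_le_trans (lorentz_diag_le _); rewrite v_unit.
have EV s : E (v s) <= V by rewrite /V (bigD1 s) //= lerDl sumr_ge0.
have V0 : 0 < V by apply: lt_le_trans (EV 0).
pose c := \big[Order.min/1]_s (lorentz q (v s) ^+ 2).
have c0 : 0 < c.
  by apply/bigmin_gtP; split=> // s _; rewrite exprn_even_gt0 //= lt_eqF.
pose k := lorentz q (u i).
have orth g : parabolic i g -> lorentz (act g q) (u i) = k.
  by move=> gi; rewrite -{1}(parabolic_act gi) actL.
apply: (@separated_finite R n W _ (fun g => act g q)
  (Num.sqrt (2 * b * (k ^+ 2 - 1)) + `|k| * \sum_j `|u i j 0|) (c / (2 * b * V))).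
- by rewrite divr_gt0 ?mulr_gt0.
- move=> g j gi; set y := act g q.
  have yy : lorentz y y = -1 by rewrite actL.
  (* The component of y orthogonal to [u i]; its Lorentz square does not depend on g, so
     [lorentz_orth_ge] bounds its coordinates. *)
  pose z := y + k *: u i.
  have zu : lorentz z (u i) = 0 by rewrite lorentzDl lorentzZl uu orth //; ring.
  have zz : lorentz z z = k ^+ 2 - 1.
    by rewrite lorentzDr lorentzZr zu mulr0 addr0 lorentzDl lorentzZl yy (lorentzC (u i)) orth //; ring.
  have -> : y j 0 = z j 0 - k * u i j 0 by rewrite !mxE; ring.
  apply: le_trans (ler_normB _ _) _; apply: lerD; last first.
    rewrite normrM ler_wpM2l // (bigD1 j) //= lerDl sumr_ge0 // => s _; exact: normr_ge0.
  rewrite -(@sqrtr_sqr _ (z j 0)) ler_sqrt; last first.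
    by rewrite -zz; apply: le_trans (lorentz_orth_ge zu).
  rewrite -zz; apply: le_trans (lorentz_orth_ge zu).
  by rewrite /E (bigD1 j) //= lerDl sumr_ge0 // => s _; exact: sqr_ge0.
- move=> g h gi hi gh; pose m := (h^-1 * g)%g.
  have m1 : m != 1%g by rewrite -(inj_eq (mulgI h)) mulVKg mulg1.
  have [s sm] := coxeter_len_descent m1.
  have mi : parabolic i m by apply: parabolicM => //; exact: parabolicV.
  (* Crossing the wall s bounds [lorentz d (v s)] from below, but separation is wanted for [D]. Both
     have the same Lorentz square, and [d] is orthogonal to [u i], whence c <= E(d) V <= 2 b E(D)
     V. *)
  pose d := act m q - q; pose D := act g q - act h q.
  have DE : E D = \sum_j (act g q j 0 - act h q j 0) ^+ 2.
    by apply: eq_bigr => j _; rewrite !mxE.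
  have dD : lorentz d d = lorentz D D.
    have -> : D = act h (act m q) - act h q by rewrite -act_mul // mulVKg.
    rewrite !(lorentzBl, lorentzBr) !actL //; exact: actH.
  have du : lorentz d (u i) = 0 by rewrite lorentzBl orth // subrr.
  have ds : - lorentz q (v s) <= lorentz d (v s).
    by rewrite lorentzBl; have := tits_outer v_unit v_angle act1 actS Cq sm; lra.
  have cd : c <= lorentz d (v s) ^+ 2.
    apply: le_trans (_ : lorentz q (v s) ^+ 2 <= _); first exact: bigmin_le.
    have := qv s => ?; rewrite -sqrrN lerXn2r ?nnegrE //; lra.
  rewrite -DE ler_pdivrMr ?mulr_gt0 //.
  apply: le_trans cd _; apply: le_trans (lorentz_sqr_le _ _) _.
  have := lorentz_orth_ge du; rewrite dD => h1; have := lorentz_diag_le D => h2.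
  have h3 : E d <= 2 * b * E D by apply: le_trans h1 _; rewrite ler_pM2l // mulr_gt0.
  apply: le_trans (ler_pM _ _ h3 (EV s)) _ => //.
  by rewrite mulrC mulrA mulrC (mulrC V) mulrA.
Qed.

End Parabolic.

(** * Homogeneous coordinates *)

Section Points.
Variables (R : realType) (n : nat).
Local Open Scope quotient_scope.
Implicit Types (V X Y : 'cV[R]_n.+1) (x : pspace R n) (phi : 'rV[R]_n.+1) (A : GL R n).

Lemma const1_neq0 : const_mx 1 != 0 :> 'cV[R]_n.+1.
Proof. by apply/eqP => /matrixP/(_ 0 0)/eqP; rewrite !mxE oner_eq0. Qed.

(* Junk when [V = 0]. *)
Definition pt V : pspace R n :=
  if pselect (V != 0) is left V0 then \pi_(pspace R n) (NzVec V0)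
  else \pi_(pspace R n) (NzVec const1_neq0).

Lemma ptE V (V0 : V != 0) : pt V = \pi_(pspace R n) (NzVec V0).
Proof.
rewrite /pt; case: pselect => [V0'|//].
by congr (\pi_(pspace R n) _); apply: val_inj.
Qed.

Lemma pt_pi (v : nzvec R n) : \pi_(pspace R n) v = pt (nzval v).
Proof. by rewrite (ptE (nzval_neq0 v)); congr (\pi_(pspace R n) _); apply: val_inj. Qed.

Lemma hcoord_neq0 x : hcoord x != 0.
Proof. exact: nzval_neq0. Qed.

Lemma pt_hcoord x : pt (hcoord x) = x.
Proof. by rewrite /hcoord -pt_pi reprK. Qed.

Lemma pt_eqP X Y : X != 0 -> Y != 0 ->
  pt X = pt Y <-> exists2 c : R, c != 0 & Y = c *: X.
Proof.
move=> X0 Y0; rewrite (ptE X0) (ptE Y0); split.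
  by move=> /(@eqmodP _ (collinear_equiv R n))/asboolP.
by move=> h; apply/(@eqmodP _ (collinear_equiv R n))/asboolP.
Qed.

Lemma ptZ c V : c != 0 -> pt (c *: V) = pt V.
Proof.
move=> c0; have [->|V0] := eqVneq V 0; first by rewrite scaler0.
apply/esym/pt_eqP => //; last by exists c.
by rewrite scaler_eq0 negb_or c0.
Qed.

Lemma ptN V : pt (- V) = pt V.
Proof. by rewrite -scaleN1r ptZ // oppr_eq0 oner_eq0. Qed.

Lemma hcoord_pt V : V != 0 -> exists2 c : R, c != 0 & hcoord (pt V) = c *: V.
Proof. by move=> V0; apply/pt_eqP; rewrite ?hcoord_neq0 ?pt_hcoord. Qed.

Lemma representsP V x : represents V x <-> V != 0 /\ x = pt V.
Proof.
split=> [[c c0 e]|[V0 ->]]; last by apply/hcoord_pt.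
have V0 : V != 0 by move: (hcoord_neq0 x); rewrite e scaler_eq0 negb_or => /andP[].
by split=> //; rewrite -(pt_hcoord x) e ptZ.
Qed.

Lemma glval_mul_neq0 A V : V != 0 -> glval A *m V != 0.
Proof.
by apply: contraNneq => e; rewrite -(mulKmx (glval_unit A) V) e mulmx0.
Qed.

Lemma pgl_act_pt A V : V != 0 -> pgl_act (pgl_class A) (pt V) = pt (glval A *m V).
Proof. by move=> V0; rewrite (ptE V0) pgl_act_class pt_pi. Qed.

Lemma pgl_actM (g h : PGL R n) x : pgl_act (g * h)%g x = pgl_act g (pgl_act h x).
Proof.
rewrite -(pgl_reprK g) -(pgl_reprK h) -(pt_hcoord x) (_ : (_ * _)%g = pgl_class (repr g * repr h)%g).
  by rewrite !pgl_act_pt ?glval_mul_neq0 ?hcoord_neq0 //= mulmxA.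
exact: pgl_mulE.
Qed.

Lemma pgl_act1 x : pgl_act 1%g x = x.
Proof.
by rewrite -{1}(pt_hcoord x) (pgl_act_pt (gl_one R n)) ?hcoord_neq0 //= mul1mx pt_hcoord.
Qed.

Lemma entry_le_norm V i : `|V i 0| <= `|V|.
Proof.
by rewrite [leRHS]/Num.Def.normr /= mx_normrE; exact: (le_bigmax _ (fun ij : 'I_n.+1 * 'I_1 => `|V ij.1 ij.2|) (i, 0)).
Qed.

Lemma norm_le_entry V (c : R) : 0 <= c -> (forall i, `|V i 0| <= c) -> `|V| <= c.
Proof.
move=> c0 h; rewrite [leLHS]/Num.Def.normr /= mx_normrE; apply/bigmax_leP; split=> // -[i j] _ /=.
by rewrite (ord1 j).
Qed.

Definition form phi V : R := (phi *m V) 0 0.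

Lemma formD phi X Y : form phi (X + Y) = form phi X + form phi Y.
Proof. by rewrite /form mulmxDr mxE. Qed.

Lemma formZ phi c X : form phi (c *: X) = c * form phi X.
Proof. by rewrite /form -scalemxAr mxE. Qed.

Lemma formN phi X : form phi (- X) = - form phi X.
Proof. by rewrite -scaleN1r formZ mulN1r. Qed.

Lemma formB phi X Y : form phi (X - Y) = form phi X - form phi Y.
Proof. by rewrite formD formN. Qed.

Lemma form_bound phi : exists2 k : R, 0 < k & forall V, `|form phi V| <= k * `|V|.
Proof.
exists (1 + \sum_j `|phi 0 j|).
  by rewrite ltr_wpDr // sumr_ge0.
move=> V; rewrite /form mxE; apply: le_trans (ler_norm_sum _ _ _) _.
rewrite mulrDl mul1r mulr_suml ler_wpDl //; apply: ler_sum => j _.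
by rewrite normrM ler_wpM2l // entry_le_norm.
Qed.

Lemma chart_pt phi V : V != 0 -> chart phi (pt V) = (form phi V)^-1 *: V.
Proof.
move=> V0; have [c c0 e] := hcoord_pt V0.
rewrite /chart -/(form phi _) e formZ scalerA invfM -mulrA (mulrC _ c) mulrA mulVf //.
by rewrite mul1r.
Qed.

Lemma in_chart_pt phi V : V != 0 -> in_chart phi (pt V) <-> form phi V != 0.
Proof.
move=> V0; have [c c0 e] := hcoord_pt V0.
rewrite /in_chart /= -/(form phi _) e formZ mulf_eq0 (negPf c0) //.
Qed.

Lemma open_pspaceP (U : set (pspace R n)) :
  open U <-> forall V, V != 0 -> U (pt V) ->
    exists2 e : R, 0 < e & forall W, `|V - W| < e -> W != 0 -> U (pt W).
Proof.
split.
  case=> O oO OU V V0; rewrite (ptE V0).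
  move=> UV; have OV : O V by move: UV; rewrite -[U _]/((\pi_(pspace R n) @^-1` U) _) -OU.
  have /nbhs_ballP[e e0 eO] : nbhs V O by exact: open_nbhs_nbhs.
  exists e => // W VW W0; rewrite (ptE W0) -[U _]/((\pi_(pspace R n) @^-1` U) _) -OU /=.
  by apply: eO; rewrite mx_norm_ball.
move=> h; exists [set W | W != 0 /\ U (pt W)].
  rewrite openE => V [V0 /(h V V0)[e e0 eU]].
  apply/nbhs_ballP; exists (Num.min e `|V|); first by rewrite /= lt_min e0 normr_gt0.
  move=> W; rewrite mx_norm_ball /ball_ /= lt_min => /andP[We WV].
  have W0 : W != 0 by apply: contraTneq WV => ->; rewrite subr0 ltxx.
  by split=> //; exact: eU.
apply/seteqP; split=> v /=; rewrite pt_pi; first by move=> [].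
by split=> //; exact: nzval_neq0.
Qed.

Lemma closure_pspaceP (Om : set (pspace R n)) V : V != 0 ->
  closure Om (pt V) <-> forall e : R, 0 < e ->
    exists W, [/\ W != 0, Om (pt W) & `|V - W| < e].
Proof.
move=> V0; split=> [cl e e0|h U].
  (* The lines passing at distance less than e from V form a neighbourhood of [pt V]. *)
  pose U : set (pspace R n) := [set x | exists c : R, c != 0 /\ `|V - c *: hcoord x| < e].
  have [] := cl U.
    apply: open_nbhs_nbhs; split; last first.
      rewrite /U /=; have [c c0 ->] := hcoord_pt V0; exists c^-1; rewrite invr_eq0; split=> //.
      by rewrite scalerA mulVf // scale1r subrr normr0.
    apply/open_pspaceP => X X0 [c' [c'0]]; have [d d0 ->] := hcoord_pt X0.
    rewrite scalerA; set c := c' * d => hc; have c0 : c != 0 by rewrite mulf_neq0.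
    have pos : 0 < e - `|V - c *: X| by rewrite subr_gt0.
    exists ((e - `|V - c *: X|) / `|c|); first by rewrite divr_gt0 // normr_gt0.
    move=> W hW W0; have [k k0 Ek] := hcoord_pt W0; exists (c / k).
    split; first by rewrite mulf_neq0 // invr_eq0.
    rewrite Ek scalerA mulfVK //.
    have -> : V - c *: W = (V - c *: X) + c *: (X - W) by rewrite scalerBr addrA subrK.
    apply: le_lt_trans (ler_normD _ _) _; rewrite normrZ -ltrBrDl.
    by rewrite mulrC -ltr_pdivlMr // normr_gt0.
  move=> x [xOm [c [c0 hc]]]; exists (c *: hcoord x); split=> //.
    by rewrite scaler_eq0 negb_or c0 hcoord_neq0.
  by rewrite ptZ // pt_hcoord.
rewrite nbhsE => -[U0 [oO OV] OU]; have [e e0 he] := (open_pspaceP U0).1 oO V V0 OV.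
have [W [W0 OW VW]] := h e e0.
by exists (pt W); split=> //; apply: OU; exact: he.
Qed.

End Points.

(** * Cones and the Hilbert metric *)

Section Cone.
Variables (R : realType) (n : nat).
Implicit Types (V X Y Z : 'cV[R]_n.+1) (x : pspace R n) (phi : 'rV[R]_n.+1).

Lemma formNl phi V : form (- phi) V = - form phi V.
Proof. by rewrite /form mulNmx mxE. Qed.

Lemma form0 phi : form phi 0 = 0.
Proof. by rewrite /form mulmx0 mxE. Qed.

Lemma formZl c phi V : form (c *: phi) V = c * form phi V.
Proof. by rewrite /form -scalemxAl mxE. Qed.

(* [K] is one of the two opposite open convex cones over the properly convex
   open set [Om]. *)
Record is_cone (Om : set (pspace R n)) (K : set 'cV[R]_n.+1) : Prop := {
  cone_scale : forall (c : R) V, 0 < c -> K V -> K (c *: V);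
  cone_add : forall X Y, K X -> K Y -> K (X + Y);
  cone_open : forall V, K V -> exists2 e : R, 0 < e & forall W, `|V - W| < e -> K W;
  cone_lift : forall V, V != 0 -> Om (pt V) -> K V \/ K (- V);
  cone_pt : forall V, K V -> Om (pt V);
  cone_bound : exists phi, forall V, K V -> `|V| <= form phi V;
  cone_neq0 : forall V, K V -> V != 0
}.

Lemma is_cone_opp Om K : is_cone Om K -> is_cone Om [set V | K (- V)].
Proof.
move=> HK; split=> /=.
- by move=> c V c0 KV; rewrite -scalerN; exact: cone_scale HK _ _ _ _.
- by move=> X Y KX KY; rewrite opprD; exact: cone_add HK _ _ _ _.
- move=> V /(cone_open HK)[e e0 he]; exists e => // W VW.
  by apply: he; rewrite -opprD normrN.
- by move=> V V0 /(cone_lift HK V0); rewrite opprK => -[]; [right|left].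
- by move=> V /(cone_pt HK); rewrite ptN.
- have [phi hphi] := cone_bound HK; exists (- phi) => V /hphi.
  by rewrite normrN formN formNl.
- by move=> V /(cone_neq0 HK); rewrite oppr_eq0.
Qed.

Lemma cone_antipodal Om K V : is_cone Om K -> K V -> ~ K (- V).
Proof.
move=> HK KV KNV; have [phi hphi] := cone_bound HK.
have := hphi _ KV; have := hphi _ KNV; rewrite normrN formN => h1 h2.
have : 0 < `|V| by rewrite normr_gt0; exact: cone_neq0 HK _ KV.
by lra.
Qed.

(** Take the lifts on which phi is positive. With a = phi X and b = phi Y, the sum X + Y is a
    multiple of the convex combination of the chart points of X and Y with weights a / (a+b) and b /
    (a+b). Boundedness in the chart gives the bound of the norm by a multiple of phi. *)
Lemma properly_convex_cone Om : open Om -> properly_convex Om -> exists K, is_cone Om K.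
Proof.
move=> /open_pspaceP oOm [phi phi0 [Oc Oconv Obnd]].
have Of V : V != 0 -> Om (pt V) -> form phi V != 0.
  by move=> V0 OV; apply/in_chart_pt => //; exact: Oc.
have [M Mb] : exists M : R, forall V, V != 0 -> Om (pt V) -> `|V| <= M * `|form phi V|.
  have [M [_ /(_ (M + 1))]] := Obnd; rewrite ltrDl ltr01 => /(_ isT) hM.
  exists (M + 1) => V V0 OV; have f0 := Of V V0 OV.
  have /= := hM (chart phi (pt V)); rewrite chart_pt // normrZ normfV ler_pdivrMl ?normr_gt0 //.
  by rewrite mulrC; apply; exists (pt V); rewrite // chart_pt.
exists [set V | [/\ V != 0, Om (pt V) & 0 < form phi V]]; split=> /=.
- move=> c V c0 [V0 OV fV]; rewrite ptZ ?gt_eqF // formZ mulr_gt0 //; split=> //.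
  by rewrite scaler_eq0 negb_or gt_eqF.
- move=> X Y [X0 OX fX] [Y0 OY fY].
  set a := form phi X; set b := form phi Y; have ab0 : 0 < a + b by rewrite addr_gt0.
  have l01 : 0 <= a / (a + b) <= 1.
    by rewrite divr_ge0 ?(ltW ab0) ?(ltW fX) //= ler_pdivrMr // mul1r lerDl (ltW fY).
  have [l0 l1] := andP l01.
  have /= := Oconv (chart phi (pt X)) (chart phi (pt Y)) (Itv01 l0 l1).
  rewrite !inE => /(_ _ _)[]; [by exists (pt X)|by exists (pt Y)|].
  move=> x Ox; rewrite -{1}(pt_hcoord x) chart_pt ?hcoord_neq0 // => E.
  have {E} E : X + Y = ((a + b) / form phi (hcoord x)) *: hcoord x.
    rewrite -scalerA E /conv /= !chart_pt // !scalerA -/a -/b /unstable.onem.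
    have a0 : a != 0 by rewrite gt_eqF.
    have b0 : b != 0 by rewrite gt_eqF.
    rewrite scalerDr !scalerA.
    have -> : (a + b) * (a / (a + b) / a) = 1 by field; rewrite a0 gt_eqF.
    have -> : (a + b) * ((1 - a / (a + b)) / b) = 1 by field; rewrite b0 gt_eqF.
    by rewrite !scale1r.
  have f0 : form phi (hcoord x) != 0 by exact: Oc.
  have c0 : (a + b) / form phi (hcoord x) != 0.
    by rewrite mulf_neq0 ?invr_eq0 // gt_eqF.
  split; last by rewrite formD addr_gt0.
    by rewrite E scaler_eq0 negb_or c0 hcoord_neq0.
  by rewrite E ptZ // pt_hcoord.
- move=> V [V0 OV fV]; have [e e0 he] := oOm V V0 OV; have [k k0 hk] := form_bound phi.
  exists (Num.min e (form phi V / k)); first by rewrite lt_min e0 divr_gt0.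
  move=> W; rewrite lt_min ltr_pdivlMr // => /andP[We Wk].
  have fW : 0 < form phi W.
    have := le_lt_trans (hk (V - W)) _; rewrite mulrC => /(_ _ Wk).
    by rewrite formB ltr_norml => /andP[_]; lra.
  have W0 : W != 0.
    by apply: contraTneq fW => ->; rewrite form0 ltxx.
  by split=> //; exact: he.
- move=> V V0 OV; have := Of V V0 OV; rewrite neq_lt => /orP[fV|fV]; [right|left]=> //.
  by rewrite oppr_eq0 ptN formN oppr_gt0.
- by move=> V [].
- exists (M *: phi) => V [V0 OV fV]; apply: le_trans (Mb V V0 OV) _.
  by rewrite gtr0_norm // formZl.
- by move=> V [].
Qed.

End Cone.

(** * Birkhoff's ratio of two vectors of a cone *)

Section ConeRatio.
Variables (R : realType) (n : nat) (Om : set (pspace R n)) (K : set 'cV[R]_n.+1).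
Hypothesis HK : is_cone Om K.
Implicit Types (V X Y Z : 'cV[R]_n.+1).

Definition cone_ratio X Y : R := sup [set l | K (X - l *: Y)].

(** The inequality is strict because the cone is open: the supremum is not attained. Every smaller l
    is admissible because positive multiples of Y can be added. *)
Lemma cone_ratioP X Y l : K X -> K Y -> K (X - l *: Y) <-> l < cone_ratio X Y.
Proof.
move=> KX KY; have [phi hphi] := cone_bound HK.
have pos V : K V -> 0 < form phi V.
  by move=> KV; apply: lt_le_trans (hphi V KV); rewrite normr_gt0; exact: cone_neq0 HK _ KV.
have S0 : [set l | K (X - l *: Y)] !=set0 by exists 0; rewrite /= scale0r subr0.
have Sub : has_ubound [set l | K (X - l *: Y)].
  exists (form phi X / form phi Y) => k /= /pos; rewrite formB formZ.
  by rewrite ler_pdivlMr ?pos //; lra.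
split=> [/[dup] Kl /(cone_open HK)[e e0 he]|].
  have Y0 : 0 < `|Y| by rewrite normr_gt0; exact: cone_neq0 HK _ KY.
  pose d := e / (2 * `|Y|); have d0 : 0 < d by rewrite divr_gt0 ?mulr_gt0.
  apply: lt_le_trans (_ : l + d <= _); first by rewrite ltrDl.
  apply: ub_le_sup => //=; apply: he.
  have -> : X - l *: Y - (X - (l + d) *: Y) = d *: Y.
    by apply/matrixP => i j; rewrite !mxE; ring.
  rewrite normrZ gtr0_norm // (_ : d * `|Y| = e / 2); first by lra.
  by rewrite /d; field; by rewrite gt_eqF.
move=> /(sup_gt S0)[k /= Kk lk].
have -> : X - l *: Y = (X - k *: Y) + (k - l) *: Y by rewrite scalerBl addrA subrK.
by apply: cone_add HK _ _ Kk _; apply: cone_scale HK _ _ _ KY; rewrite subr_gt0.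
Qed.

Lemma cone_ratio_eq X Y m : K X -> K Y ->
  (forall l, K (X - l *: Y) <-> l < m) -> cone_ratio X Y = m.
Proof.
move=> KX KY h; have e l : l < cone_ratio X Y <-> l < m.
  by rewrite -(h l); split=> /(cone_ratioP l KX KY).
by case: (ltgtP (cone_ratio X Y) m) => // /e; rewrite ltxx.
Qed.

Lemma le_cone_ratio X Y m : K X -> K Y ->
  (forall l, l < m -> K (X - l *: Y)) -> m <= cone_ratio X Y.
Proof.
move=> KX KY h; rewrite leNgt; apply/negP => lt.
by have /(cone_ratioP _ KX KY) := h _ lt; rewrite ltxx.
Qed.

Lemma cone_ratio_gt0 X Y : K X -> K Y -> 0 < cone_ratio X Y.
Proof. by move=> KX KY; apply/cone_ratioP => //; rewrite scale0r subr0. Qed.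

Lemma cone_scaleE (c : R) V : 0 < c -> K (c *: V) <-> K V.
Proof.
move=> c0; split=> [KcV|]; last exact: cone_scale HK _ _ _.
by rewrite -(scale1r V) -(mulVf (lt0r_neq0 c0)) -scalerA; apply: cone_scale HK _ _ _ KcV; rewrite invr_gt0.
Qed.

Lemma cone_ratioZ (a b : R) X Y : 0 < a -> 0 < b -> K X -> K Y ->
  cone_ratio (a *: X) (b *: Y) = a / b * cone_ratio X Y.
Proof.
move=> a0 b0 KX KY; apply: cone_ratio_eq.
- exact: cone_scale HK _ _ _ KX.
- exact: cone_scale HK _ _ _ KY.
move=> l; have -> : a *: X - l *: (b *: Y) = a *: (X - (l * b / a) *: Y).
  rewrite scalerBr !scalerA; congr (_ - _ *: _); field; by rewrite gt_eqF.
rewrite cone_scaleE // cone_ratioP // ltr_pdivrMr // -ltr_pdivlMr //.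
by rewrite (_ : a / b * _ = cone_ratio X Y * a / b) //; ring.
Qed.

Lemma cone_ratio_self X : K X -> cone_ratio X X = 1.
Proof.
move=> KX; apply: cone_ratio_eq => // l; rewrite -{1}(scale1r X) -scalerBl.
have [l1|l1] := ltP l 1; first by rewrite cone_scaleE // subr_gt0.
split=> // Kl; case: (cone_antipodal HK Kl).
move: l1; rewrite le_eqVlt => /orP[/eqP e|l1].
  by move: (cone_neq0 HK Kl); rewrite e subrr scale0r eqxx.
by rewrite -scaleNr opprB; apply/cone_scaleE => //; rewrite subr_gt0.
Qed.

(** Evaluate psi on X - l Y for l below the ratio. Lower bounds for the Hilbert distance come from
    two such forms, one for each of the two ratios. *)
Lemma cone_ratio_le psi X Y : K X -> K Y -> (forall V, K V -> 0 <= form psi V) ->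
  0 < form psi Y -> cone_ratio X Y <= form psi X / form psi Y.
Proof.
move=> KX KY psi0 Y0; rewrite leNgt; apply/negP => lt.
have := midf_lt lt; set l := _ / 2 => -[l1 /(cone_ratioP _ KX KY)/psi0].
by rewrite formB formZ subr_ge0 -ler_pdivlMr // leNgt l1.
Qed.

(** The reverse of the triangle inequality, valid for Z = a X + b Y on the segment. With m the ratio
    of X to Y, that of Z to Y is at least b + a m and that of X to Z at least m / (b + a m). *)
Lemma cone_ratio_chain (a b : R) X Y : 0 < a -> 0 <= b -> K X -> K Y ->
  cone_ratio X Y <= cone_ratio X (a *: X + b *: Y) * cone_ratio (a *: X + b *: Y) Y.
Proof.
move=> a0 b0 KX KY; set Z := a *: X + b *: Y; have m0 := cone_ratio_gt0 KX KY; set m := cone_ratio X Y in m0 *.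
have KaX : K (a *: X) by exact: cone_scale HK _ _ _ KX.
have KZ : K Z.
  move: b0; rewrite le_eqVlt /Z => /orP[/eqP <-|b0]; first by rewrite scale0r addr0.
  by apply: cone_add HK _ _ KaX _; exact: cone_scale HK _ _ _ KY.
have am0 : 0 < a * m by rewrite mulr_gt0.
have s0 : 0 < b + a * m by rewrite ltr_wpDl.
have h1 : b + a * m <= cone_ratio Z Y.
  apply: le_cone_ratio => // l lm.
  have -> : Z - l *: Y = a *: (X - ((l - b) / a) *: Y).
    by apply/matrixP => i j; rewrite !mxE; field; rewrite gt_eqF.
  by apply/cone_scaleE => //; apply/cone_ratioP => //; rewrite ltr_pdivrMr // -/m; lra.
have h2 : m / (b + a * m) <= cone_ratio X Z.
  apply: le_cone_ratio => // l lm.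
  have la : 0 < 1 - l * a.
    have [l0|l0] := ltP 0 l; last by have := mulr_ge0 (ltW a0) (_ : 0 <= - l); lra.
    move: lm; rewrite ltr_pdivlMr // => lm.
    rewrite subr_gt0 -(ltr_pM2r m0) mul1r; have := mulr_ge0 (ltW l0) b0; lra.
  have -> : X - l *: Z = (1 - l * a) *: (X - (l * b / (1 - l * a)) *: Y).
    by apply/matrixP => i j; rewrite !mxE; field; rewrite gt_eqF.
  apply/cone_scaleE => //; apply/cone_ratioP => //; rewrite ltr_pdivrMr // -/m.
  by move: lm; rewrite ltr_pdivlMr //; lra.
apply: le_trans (ler_pM _ _ h2 h1); [|by rewrite divr_ge0 ?ltW|exact: ltW].
by rewrite divfK ?gt_eqF.
Qed.

Lemma cone_ratio_mulmx (A : 'M[R]_n.+1) X Y : (forall V, K (A *m V) <-> K V) ->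
  cone_ratio (A *m X) (A *m Y) = cone_ratio X Y.
Proof.
move=> AK; congr sup; apply/seteqP; split=> l /=.
  by rewrite scalemxAr -mulmxBr => /AK.
by rewrite scalemxAr -mulmxBr => ?; apply/AK.
Qed.

End ConeRatio.

(** * The Hilbert distance in terms of ratios *)

Section HilbertCone.
Variables (R : realType) (n : nat) (Om : set (pspace R n)) (K : set 'cV[R]_n.+1).
Hypotheses (oOm : open Om) (HK : is_cone Om K).
Implicit Types (V X Y Z : 'cV[R]_n.+1).
Local Notation ratio := (cone_ratio K).

Lemma closure_in_chart phi : (forall V, K V -> `|V| <= form phi V) ->
  closure Om `<=` in_chart phi.
Proof.
move=> hphi x; rewrite -(pt_hcoord x); set V := hcoord x; have V0 : V != 0 by exact: hcoord_neq0.
move=> /(closure_pspaceP _ V0) h; apply/in_chart_pt => //; apply/eqP => fV.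
have [k k0 hk] := form_bound phi; have V0' : 0 < `|V| by rewrite normr_gt0.
have e0 : 0 < `|V| / (1 + k) by rewrite divr_gt0 // addr_gt0.
have [W [W0 /(cone_lift HK W0) KW VW]] := h _ e0.
have hW : `|W| <= `|form phi W|.
  case: KW => /hphi; first by move=> /le_trans; apply; exact: ler_norm.
  by rewrite normrN formN => /le_trans; apply; rewrite ler_normr lexx orbT.
have := hk (V - W); rewrite formB fV sub0r normrN => hfW.
have : `|V| <= (1 + k) * `|V - W|.
  rewrite mulrDl mul1r -{1}(subrK W V); apply: le_trans (ler_normD _ _) _.
  by rewrite lerD2l; exact: le_trans hW hfW.
by rewrite leNgt mulrC -ltr_pdivlMr ?VW // addr_gt0.
Qed.

(** If phi took both signs on the convex cone, a positive combination of two of its vectors would be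
    in the kernel of phi. *)
Lemma in_chart_cone_sign phi X Y : Om `<=` in_chart phi -> K X -> K Y ->
  0 < form phi X * form phi Y.
Proof.
move=> Oc KX KY.
have f0 V : K V -> form phi V != 0.
  by move=> KV; apply/in_chart_pt; [exact: cone_neq0 HK _ KV | exact/Oc/(cone_pt HK)].
have key X1 Y1 : K X1 -> K Y1 -> 0 < form phi X1 -> form phi Y1 < 0 -> False.
  move=> KX1 KY1 X10 Y10; have := f0 (- form phi Y1 *: X1 + form phi X1 *: Y1).
  rewrite formD !formZ mulNr (mulrC (form phi Y1)) addNr eqxx => h; suff: false by [].
  by apply: h; apply: (cone_add HK); apply: (cone_scale HK); rewrite ?oppr_gt0.
have := f0 X KX; have := f0 Y KY; rewrite !neq_lt => /orP[Y0|Y0] /orP[X0|X0].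
- by rewrite nmulr_rgt0.
- by case: (key X Y).
- by case: (key Y X).
- by rewrite mulr_gt0.
Qed.

(** The lift of a boundary point is a limit of vectors of [K] or of [- K], and the sign condition
    excludes the latter. A limit of vectors of [K] enters [K] as soon as a positive multiple of Y is
    added. *)
Lemma boundary_cone_ratio phi X Y m : K X -> K Y -> closure Om `<=` in_chart phi ->
  X - m *: Y != 0 -> boundary Om (pt (X - m *: Y)) ->
  0 < form phi X * form phi (X - m *: Y) -> cone_ratio K X Y = m.
Proof.
move=> KX KY clphi; set W := X - m *: Y => W0 [clW nW] sgn.
have subOm : Om `<=` in_chart phi by apply: subset_trans clphi; exact: subset_closure.
have mle : cone_ratio K X Y <= m.
  rewrite leNgt; apply/negP => /(cone_ratioP HK _ KX KY) KW; apply: nW.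
  by rewrite (proj1 (interior_id _) oOm); exact: (cone_pt HK).
apply/eqP; rewrite eq_le mle /=; apply: (le_cone_ratio HK) => // l lm.
have [e e0 he] := cone_open HK KY; have [k k0 hk] := form_bound phi.
have ml0 : 0 < m - l by rewrite subr_gt0.
have fW0 : 0 < `|form phi W|.
  by rewrite normr_gt0; apply: contraTneq sgn => ->; rewrite mulr0 ltxx.
have d0 : 0 < Num.min ((m - l) * e) (`|form phi W| / k) by rewrite lt_min mulr_gt0 // divr_gt0.
have [W' [W'0 /(cone_lift HK W'0) KW' WW']] := (closure_pspaceP Om W0).1 clW _ d0.
move: WW'; rewrite lt_min => /andP[We Wk]; case: KW' => KW'.
  have -> : X - l *: Y = W' + (m - l) *: (Y + (m - l)^-1 *: (W - W')).
    by apply/matrixP => i j; rewrite /W !mxE; field; rewrite gt_eqF.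
  apply: (cone_add HK) => //; apply: (cone_scale HK) => //; apply: he.
  rewrite opprD addrA subrr add0r normrN normrZ normfV gtr0_norm //.
  by rewrite ltr_pdivrMl.
have := in_chart_cone_sign subOm KX KW'; rewrite formN mulrN oppr_gt0 => sgn'.
suff : `|form phi W| <= `|form phi (W - W')|.
  by move=> /le_trans/(_ (hk _)); rewrite leNgt mulrC -ltr_pdivlMr // Wk.
rewrite formB; move: sgn sgn'; have [X0|X0|<-] := ltgtP 0 (form phi X).
- rewrite pmulr_rgt0 // pmulr_rlt0 // => a b.
  by rewrite gtr0_norm //; apply: le_trans (ler_norm _); lra.
- rewrite nmulr_rgt0 // nmulr_rlt0 // => a b.
  by rewrite ltr0_norm // -[leRHS]normrN; apply: le_trans (ler_norm _); lra.
- by rewrite mul0r ltxx.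
Qed.

Lemma cone_ratio_boundary X Y : K X -> K Y -> X - ratio X Y *: Y != 0 ->
  boundary Om (pt (X - ratio X Y *: Y)) /\
  (forall phi, (forall V, K V -> `|V| <= form phi V) ->
     `|X - ratio X Y *: Y| <= form phi (X - ratio X Y *: Y)).
Proof.
move=> KX KY; set m := ratio X Y; set V := X - m *: Y => V0.
have Y0 : 0 < `|Y| by rewrite normr_gt0; exact: cone_neq0 HK _ KY.
have Km d : 0 < d -> K (V + d *: Y).
  move=> d0; have -> : V + d *: Y = X - (m - d) *: Y.
    by apply/matrixP => i j; rewrite /V !mxE; ring.
  by apply/(cone_ratioP HK) => //; rewrite -/m; lra.
have le_form phi : (forall V, K V -> `|V| <= form phi V) -> `|V| <= form phi V.
  move=> hphi; apply/ler_addgt0Pr => e e0.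
  have s0 : 0 < `|Y| + `|form phi Y| by rewrite ltr_pwDl.
  pose d := e / (`|Y| + `|form phi Y|); have d0 : 0 < d by rewrite divr_gt0.
  have := hphi _ (Km d d0); rewrite formD formZ.
  have := ler_normB (V + d *: Y) (d *: Y); rewrite addrK normrZ (gtr0_norm d0).
  have : d * `|Y| + d * form phi Y <= e.
    rewrite -mulrDr /d mulrAC ler_pdivrMr // ler_pM2l //.
    by rewrite lerD2l ler_norm.
  by lra.
split=> //; split.
  apply/closure_pspaceP => // e e0; pose d := e / (2 * `|Y|).
  have d0 : 0 < d by rewrite divr_gt0 ?mulr_gt0.
  exists (V + d *: Y); split; [exact: cone_neq0 HK _ (Km d d0)|exact: cone_pt HK _ (Km d d0)|].
  rewrite opprD addrA subrr add0r normrN normrZ gtr0_norm // (_ : d * _ = e / 2); first by lra.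
  by rewrite /d; field; rewrite gt_eqF.
move=> /interior_subset/(cone_lift HK V0)[KV|KV].
  by have /(cone_ratioP HK _ KX KY) := KV; rewrite ltxx.
have [phi hphi] := cone_bound HK.
have := hphi _ KV; have := le_form _ hphi; rewrite normrN formN.
by have : 0 < `|V| by [rewrite normr_gt0]; lra.
Qed.

(** The chord through the two points ends at X - m Y and Y - m' X, where m and m' are the two
    ratios. As the distance is selected by [get], this chord is exhibited and all admissible data
    are shown to give the same value. *)
Lemma hilbert_dist_cone X Y : K X -> K Y ->
  hilbert_dist Om (pt X) (pt Y) = - (2^-1 * ln (ratio X Y * ratio Y X)).
Proof.
move=> KX KY; have X0 := cone_neq0 HK KX; have Y0 := cone_neq0 HK KY.
rewrite /hilbert_dist; case: ifPn => [/eqP/(pt_eqP X0 Y0)[c c0 EY]|/eqP XY].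
  have c_gt0 : 0 < c.
    rewrite lt_neqAle eq_sym c0 leNgt; apply/negP => c_lt0.
    apply: (cone_antipodal HK KY); rewrite EY -scaleNr; apply: (cone_scale HK) => //.
    by rewrite oppr_gt0.
  have -> : ratio X Y * ratio Y X = 1.
    rewrite EY -{1}(scale1r X) (cone_ratioZ HK) // -{4}(scale1r X) (cone_ratioZ HK) //.
    by rewrite (cone_ratio_self HK) //; field.
  by rewrite ln1 mulr0 oppr0.
set S := [set d : R | _].
have XYl l : X - l *: Y != 0.
  apply/eqP => /subr0_eq E; apply: XY; rewrite E ptZ //.
  by apply: contraNneq X0 => l0; rewrite E l0 scale0r.
have YXl l : Y - l *: X != 0.
  apply/eqP => /subr0_eq E; apply: XY; rewrite E ptZ //.
  by apply: contraNneq Y0 => l0; rewrite E l0 scale0r.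
have m0 := cone_ratio_gt0 HK KX KY; have m'0 := cone_ratio_gt0 HK KY KX.
suff [] : S !=set0 /\ forall d, S d -> d = - (2^-1 * ln (ratio X Y * ratio Y X)).
  by move=> S0; apply; exact: getPex.
split.
  have [phi hphi] := cone_bound HK.
  have fpos V : K V -> 0 < form phi V.
    by move=> KV; apply: lt_le_trans (hphi V KV); rewrite normr_gt0; exact: cone_neq0 HK _ KV.
  have a0 := fpos X KX; have b0 := fpos Y KY.
  have [bdX /(_ _ hphi)] := cone_ratio_boundary KX KY (XYl _).
  have [bdY /(_ _ hphi)] := cone_ratio_boundary KY KX (YXl _).
  move: bdX bdY m0 m'0; set m := ratio X Y; set m' := ratio Y X => bdX bdY m0 m'0.
  move=> /(lt_le_trans (_ : 0 < _)) => /(_ (etrans (normr_gt0 _) (YXl _))) fY1.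
  move=> /(lt_le_trans (_ : 0 < _)) => /(_ (etrans (normr_gt0 _) (XYl _))) fX1.
  set a := form phi X in a0 fX1 fY1 *; set b := form phi Y in b0 fX1 fY1 *.
  have P0 : 0 < a - m * b by move: fX1; rewrite formB formZ.
  have Q0 : 0 < b - m' * a by move: fY1; rewrite formB formZ.
  have mm : 0 < 1 - m * m'.
    rewrite -(pmulr_rgt0 _ (mulr_gt0 a0 b0)).
    have h1 : 0 < (a - m * b) * b by rewrite mulr_gt0.
    have h2 : 0 < m * b * (b - m' * a) by rewrite !mulr_gt0.
    lra.
  (* The weights of the second endpoint, found by solving for X and Y in terms of X - m Y and Y - m'
     X and normalising by phi. *)
  pose s := m * (b - m' * a) / (a * (1 - m * m')); pose r := (b - m' * a) / (b * (1 - m * m')).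
  eexists; exists phi, (pt (X - m *: Y)), (pt (Y - m' *: X)); split=> //.
    exact: closure_in_chart.
  exists s, r; rewrite !chart_pt // !formB !formZ -/a -/b; split.
  - by rewrite divr_ge0 // ltW // mulr_gt0.
  - rewrite /s /r ler_pdivrMr ?mulr_gt0 // mulrAC ler_pdivlMr ?mulr_gt0 //.
    have h : 0 < (b - m' * a) * (1 - m * m') * (a - m * b) by rewrite !mulr_gt0.
    lra.
  - rewrite ler_pdivrMr ?mulr_gt0 // mul1r; have := mulr_gt0 m'0 P0; lra.
  - apply/matrixP => i j; rewrite !mxE /s; field.
    by rewrite !gt_eqF.
  - apply/matrixP => i j; rewrite !mxE /r; field.
    by rewrite !gt_eqF.
move=> d [phi [x' [y' [clphi bx' by' [s [r [s0 sr r1]]]]]]].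
have subOm : Om `<=` in_chart phi by apply: subset_trans clphi; exact: subset_closure.
have ab0 := in_chart_cone_sign subOm KX KY.
rewrite !chart_pt //; set a := form phi X in ab0 *; set b := form phi Y in ab0 *.
have a0 : a != 0 by apply: contraTneq ab0 => ->; rewrite mul0r ltxx.
have b0 : b != 0 by apply: contraTneq ab0 => ->; rewrite mulr0 ltxx.
have chartP z : boundary Om z -> [/\ chart phi z != 0, pt (chart phi z) = z & form phi (chart phi z) = 1].
  move=> [/clphi cz _]; have fz : form phi (hcoord z) != 0 by exact: cz.
  have -> : chart phi z = (form phi (hcoord z))^-1 *: hcoord z.
    by rewrite -{1}(pt_hcoord z) chart_pt ?hcoord_neq0.
  rewrite ptZ ?invr_eq0 // pt_hcoord formZ mulVf //; split=> //.
  by rewrite scaler_eq0 negb_or invr_eq0 fz hcoord_neq0.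
have nbd V : K V -> ~ boundary Om (pt V).
  move=> KV [_]; apply; rewrite (proj1 (interior_id _) oOm); exact: (cone_pt HK).
have [x10 ptx fx] := chartP _ bx'; have [y10 pty fy] := chartP _ by'.
move: x10 ptx fx y10 pty fy; move: (chart phi x') (chart phi y') => x1 y1.
move=> x10 ptx fx y10 pty fy EX EY -> {d}.
have D0 : y1 - x1 != 0.
  apply/eqP => D0; apply: XY; rewrite -(@ptZ _ _ a^-1) ?invr_eq0 // EX -(@ptZ _ _ b^-1 Y) ?invr_eq0 // EY.
  by rewrite D0 !scaler0.
have {}sr : s < r.
  rewrite lt_neqAle sr andbT; apply/eqP => rs; apply: XY.
  by rewrite -(@ptZ _ _ a^-1) ?invr_eq0 // EX -(@ptZ _ _ b^-1 Y) ?invr_eq0 // EY rs.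
have {}s0 : 0 < s.
  rewrite lt_neqAle s0 andbT; apply/eqP => se; apply: (nbd X KX).
  by rewrite -(@ptZ _ _ a^-1) ?invr_eq0 // EX -se scale0r addr0 ptx.
have {}r1 : r < 1.
  rewrite lt_neqAle r1 andbT; apply/eqP => re; apply: (nbd Y KY).
  by rewrite -(@ptZ _ _ b^-1) ?invr_eq0 // EY re scale1r addrC subrK pty.
have r0 : 0 < r := lt_trans s0 sr.
have s1 : s < 1 := lt_trans sr r1.
have EX' : X = a *: (x1 + s *: (y1 - x1)) by rewrite -EX scalerA divff // scale1r.
have EY' : Y = b *: (x1 + r *: (y1 - x1)) by rewrite -EY scalerA divff // scale1r.
(* The coefficient is chosen to cancel [y1], which leaves the endpoint [x1]; symmetrically for
   [EW]. *)
have EV : X - (s * a / (r * b)) *: Y = (a * (r - s) / r) *: x1.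
  by rewrite EX' EY'; apply/matrixP => i j; rewrite !mxE; field; rewrite b0 gt_eqF.
have EW : Y - ((1 - r) * b / ((1 - s) * a)) *: X = (b * (r - s) / (1 - s)) *: y1.
  by rewrite EX' EY'; apply/matrixP => i j; rewrite !mxE; field; rewrite a0 gt_eqF ?subr_gt0.
have cX : a * (r - s) / r != 0 by rewrite -mulrA mulf_neq0 // lt0r_neq0 // divr_gt0 // subr_gt0.
have cY : b * (r - s) / (1 - s) != 0.
  by rewrite -mulrA mulf_neq0 // lt0r_neq0 // divr_gt0 // subr_gt0.
have -> : ratio X Y = s * a / (r * b).
  apply: (boundary_cone_ratio KX KY clphi); rewrite EV ?ptZ ?ptx //.
    by rewrite scaler_eq0 negb_or x10 cX.
  rewrite formZ fx mulr1 -/a !mulrA -expr2 divr_gt0 // mulr_gt0 ?subr_gt0 //.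
  by rewrite exprn_even_gt0.
have -> : ratio Y X = (1 - r) * b / ((1 - s) * a).
  apply: (boundary_cone_ratio KY KX clphi); rewrite EW ?ptZ ?pty //.
    by rewrite scaler_eq0 negb_or y10 cY.
  rewrite formZ fy mulr1 -/b !mulrA -expr2 divr_gt0 ?subr_gt0 // mulr_gt0 ?subr_gt0 //.
  by rewrite exprn_even_gt0.
rewrite EX EY -mulrN -lnV; last first.
  rewrite posrE (_ : _ * _ = (s * (1 - r)) / (r * (1 - s))).
    by rewrite divr_gt0 // mulr_gt0 ?subr_gt0.
  by field; rewrite a0 b0 !gt_eqF ?subr_gt0.
congr (_ * ln _).
have -> : x1 - (x1 + r *: (y1 - x1)) = (- r) *: (y1 - x1).
  by apply/matrixP => i j; rewrite !mxE; ring.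
have -> : y1 - (x1 + s *: (y1 - x1)) = (1 - s) *: (y1 - x1).
  by apply/matrixP => i j; rewrite !mxE; ring.
have -> : x1 - (x1 + s *: (y1 - x1)) = (- s) *: (y1 - x1).
  by apply/matrixP => i j; rewrite !mxE; ring.
have -> : y1 - (x1 + r *: (y1 - x1)) = (1 - r) *: (y1 - x1).
  by apply/matrixP => i j; rewrite !mxE; ring.
rewrite !normrZ !normrN !gtr0_norm ?subr_gt0 //.
have : `|y1 - x1| != 0 by rewrite normr_eq0.
set D := `|y1 - x1| => Dn0; field.
by rewrite a0 b0 Dn0 !gt_eqF ?subr_gt0.
Qed.

End HilbertCone.

(** * Simplices and reflections *)

Section SimplexCoordinates.
Variables (R : realType) (n : nat) (B : GL R n).
Implicit Types (V X Y Z : 'cV[R]_n.+1) (i j s : 'I_n.+1).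

Definition vertex j : 'cV[R]_n.+1 := glval B *m delta_mx j 0.

(** Homogeneous barycentric coordinate; the normalised one is obtained on dividing by the sum of all
    of them. *)
Definition bary s : 'rV[R]_n.+1 := row s (invmx (glval B)).

Lemma form_bary s V : form (bary s) V = (invmx (glval B) *m V) s 0.
Proof. by rewrite /form -row_mul mxE. Qed.

Lemma form_bary_mul s V : form (bary s) (glval B *m V) = V s 0.
Proof. by rewrite form_bary mulKmx // glval_unit. Qed.

Lemma bary_vertex s j : form (bary s) (vertex j) = (s == j)%:R.
Proof. by rewrite form_bary_mul mxE eqxx andbT. Qed.

Lemma bary_decomp V : V = \sum_j form (bary j) V *: vertex j.
Proof.
rewrite -{1}(mulKVmx (glval_unit B) V) [in LHS](matrix_sum_delta (invmx _ *m V)).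
rewrite mulmx_sumr; apply: eq_bigr => j _; rewrite big_ord1 -scalemxAr.
by rewrite form_bary.
Qed.

Lemma vertex_neq0 j : vertex j != 0.
Proof.
apply/eqP => /(congr1 (form (bary j))); rewrite bary_vertex eqxx form0 => /eqP.
by rewrite oner_eq0.
Qed.

Lemma psimplexP V : V != 0 ->
  psimplex B (pt V) <-> (forall j, 0 <= form (bary j) V) \/ (forall j, form (bary j) V <= 0).
Proof.
move=> V0; split.
  case=> a a0 /representsP[Ba0 /esym/(pt_eqP Ba0 V0)[c c0 ->]].
  have [c_ge0|c_lt0] := leP 0 c; [left|right] => j; rewrite formZ form_bary_mul.
    by rewrite mulr_ge0.
  by rewrite mulr_le0_ge0 // ltW.
case=> h; [exists (invmx (glval B) *m V)|exists (invmx (glval B) *m - V)].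
- by move=> j; rewrite -form_bary.
- by apply/representsP; rewrite mulKVmx ?glval_unit.
- by move=> j; rewrite -form_bary formN oppr_ge0.
- by apply/representsP; rewrite mulKVmx ?glval_unit // oppr_eq0 ptN.
Qed.

Lemma pface_pt s V : V != 0 -> (forall j, 0 <= form (bary j) V) -> form (bary s) V = 0 ->
  pface B s (pt V).
Proof.
move=> V0 h hs; exists (invmx (glval B) *m V).
  by split=> [j|]; rewrite -form_bary.
by apply/representsP; rewrite mulKVmx ?glval_unit.
Qed.

(** Any lift of g is a scalar l on the span of the face, so it has the form l V + a_s(V) F. That its
    square is scalar determines a_s(F), and division by l yields a linear reflection. *)
Lemma reflection_lift (g : PGL R n) s : (2 <= n)%N -> projective_reflection_wrt g (pface B s) ->
  exists A : GL R n, exists E : 'cV[R]_n.+1, [/\ g = pgl_class A, form (bary s) E = 1 &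
    forall V, glval A *m V = V - (2 * form (bary s) V) *: E].
Proof.
move=> n2 [[h gE] fixF]; pose A0 := repr g.
have gA0 : pgl_class A0 = g by exact: pgl_reprK.
have std2 : (std_reflection R n * std_reflection R n = 1)%g.
  rewrite /std_reflection [LHS]pgl_mulE; apply/pgl_classP/asboolP; exists 1; first exact: oner_neq0.
  rewrite scale1r /= mulmx_diag -diag_const_mx; congr diag_mx; apply/matrixP => i j.
  by rewrite !mxE; case: ifP => _; rewrite ?mulrNN ?mulr1.
have std1 : std_reflection R n <> 1%g.
  move=> /esym/pgl_classP/asboolP[c c0 /= /matrixP e].
  have m : (1 < n.+1)%N by rewrite ltnS (leq_trans _ n2).
  have m0 : (Ordinal m == 0 :> 'I_n.+1) = false by [].
  have := e 0 0; have := e (Ordinal m) (Ordinal m).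
  by rewrite !mxE m0 !eqxx !mulr1n !mulr1; lra.
have [c c0 A2] : exists2 c : R, c != 0 & glval A0 *m glval A0 = c *: 1%:M.
  have : pgl_class (gl_one R n) = pgl_class (gl_mul A0 A0).
    transitivity (g * g)%g; last by rewrite -gA0; exact: pgl_mulE.
    by rewrite gE !mulgA mulgVK -(mulgA h) std2 mulg1 mulgV.
  by move=> /pgl_classP/asboolP.
have scalar V : V != 0 -> (forall j, 0 <= form (bary j) V) -> form (bary s) V = 0 ->
    exists l : R, glval A0 *m V = l *: V.
  move=> V0 Vge Vs; have := fixF _ (pface_pt V0 Vge Vs); rewrite -gA0 pgl_act_pt //.
  by move=> /esym/(pt_eqP V0 (glval_mul_neq0 _ V0))[l _ ->]; exists l.
have [j0 j0s] : exists j0, j0 != s.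
  have m : (1 < n.+1)%N by rewrite ltnS (leq_trans _ n2).
  by have [->|s0] := eqVneq s 0; [exists (Ordinal m)|exists 0; rewrite eq_sym].
have eig j : j != s -> exists l : R, glval A0 *m vertex j = l *: vertex j.
  move=> js; apply: scalar; first exact: vertex_neq0.
    by move=> k; rewrite bary_vertex.
  by rewrite bary_vertex eq_sym (negPf js).
have [l lE] := eig _ j0s.
(* The sum of two vertices of the face also represents a fixed point, so their eigenvalues agree. *)
have eigl j : j != s -> glval A0 *m vertex j = l *: vertex j.
  move=> js; have [->//|jj0] := eqVneq j j0; have [l' l'E] := eig _ js.
  have [m mE] : exists m : R, glval A0 *m (vertex j + vertex j0) = m *: (vertex j + vertex j0).
    apply: scalar.
    - apply/eqP => /(congr1 (form (bary j))); rewrite formD !bary_vertex eqxx (negPf jj0) addr0 form0.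
      by move/eqP; rewrite oner_eq0.
    - by move=> k; rewrite formD !bary_vertex addr_ge0.
    - by rewrite formD !bary_vertex !(eq_sym s) (negPf js) (negPf j0s) addr0.
  move: mE; rewrite mulmxDr l'E lE => mE.
  have := congr1 (form (bary j)) mE; have := congr1 (form (bary j0)) mE.
  rewrite !(formD, formZ) !bary_vertex !eqxx (negPf jj0) (eq_sym j0) (negPf jj0).
  by rewrite !(mulr0, mulr1, add0r, addr0) => -> ->.
pose F := glval A0 *m vertex s - l *: vertex s.
have A0E V : glval A0 *m V = l *: V + form (bary s) V *: F.
  rewrite {1}(bary_decomp V) mulmx_sumr {2}(bary_decomp V) scaler_sumr.
  rewrite (bigD1 s) //= [in RHS](bigD1 s) //= -addrA [in RHS](addrC (\sum_(j | _) _)) addrA.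
  congr (_ + _); last first.
    by apply: eq_bigr => j js; rewrite -scalemxAr eigl // !scalerA mulrC.
  by rewrite -scalemxAr /F scalerBr !scalerA (mulrC l) addrC subrK.
have l0 : l != 0.
  apply: contraNneq (glval_mul_neq0 A0 (vertex_neq0 j0)) => l0.
  by rewrite lE l0 scale0r.
have c_l : c = l ^+ 2.
  have := congr1 (fun M => M *m vertex j0) A2; rewrite /= -mulmxA lE -scalemxAr lE scalerA.
  rewrite -scalemxAl mul1mx => /(congr1 (form (bary j0))).
  by rewrite !formZ bary_vertex eqxx !mulr1 expr2.
have F0 : F != 0.
  apply/eqP => F0; apply: std1.
  have g1 : g = 1%g.
    rewrite -gA0; apply/esym/pgl_classP/asboolP; exists l => //.
    apply/matrixP => i j; have := A0E (delta_mx j 0); rewrite F0 scaler0 addr0.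
    by rewrite -colE => /matrixP/(_ i 0); rewrite !mxE eqxx andbT => ->.
  by apply: (mulgI h); apply: (mulIg h^-1%g); rewrite -gE g1 mulg1 mulgV.
(* The square of [A0] is l^2; applied to vertex s this gives (2 l + a_s(F)) F = 0, and F is nonzero
   because g is not the identity. *)
have aF : form (bary s) F = - (2 * l).
  have := congr1 (fun M => M *m vertex s) A2; rewrite /= -mulmxA (A0E (vertex s)) bary_vertex eqxx scale1r.
  rewrite A0E formD formZ bary_vertex eqxx mulr1 -scalemxAl mul1mx c_l => e.
  have : (2 * l + form (bary s) F) *: F = 0.
    have <- : l *: (l *: vertex s + F) + (l + form (bary s) F) *: F - l ^+ 2 *: vertex s
      = (2 * l + form (bary s) F) *: F.
      by apply/matrixP => i j; rewrite [LHS]mxE !mxE -!/(form _ _); ring.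
    by rewrite e subrr.
  by move=> /eqP; rewrite scaler_eq0 (negPf F0) orbF addrC addr_eq0 => /eqP.
have l'0 : l^-1 != 0 by rewrite invr_eq0.
have Aunit : l^-1 *: glval A0 \in unitmx by rewrite unitmxZ ?unitfE // glval_unit.
exists (MkGL Aunit), ((- (2 * l)^-1) *: F); split.
- by rewrite -gA0; apply/pgl_classP/asboolP; exists l^-1.
- by rewrite formZ aF; field.
- move=> V; rewrite /= -scalemxAl A0E; set a := form _ V.
  by apply/matrixP => i j; rewrite !mxE; field.
Qed.

End SimplexCoordinates.

(** * The cone over a domain that contains the simplex *)

Section SimplexCone.
Variables (R : realType) (n : nat) (B : GL R n) (Om : set (pspace R n)).
Implicit Types (V X Y Z : 'cV[R]_n.+1) (K : set 'cV[R]_n.+1).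
Local Notation a := (bary B).

Lemma form_sum (I : finType) phi (F : I -> 'cV[R]_n.+1) :
  form phi (\sum_i F i) = \sum_i form phi (F i).
Proof. by rewrite /form mulmx_sumr summxE. Qed.

Lemma cone_form_gt0 K phi V : is_cone Om K -> (forall W, K W -> `|W| <= form phi W) ->
  K V -> 0 < form phi V.
Proof.
move=> HK hphi KV; apply: lt_le_trans (hphi V KV).
by rewrite normr_gt0; exact: cone_neq0 HK _ KV.
Qed.

(** If lifted vertices lay in opposite cones, the edge between them would contain a point where the
    form positive on the cone vanishes, although the edge is in the domain. *)
Lemma simplex_cone : is_cone Om !=set0 -> psimplex B `<=` Om ->
  exists K, is_cone Om K /\ forall j, K (vertex B j).
Proof.
move=> [K0 HK0] PO.
have simplex_pt V : V != 0 -> (forall j, 0 <= form (a j) V) -> Om (pt V).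
  by move=> V0 h; apply: PO; apply/psimplexP => //; left.
have vpt j : Om (pt (vertex B j)).
  by apply: simplex_pt; [exact: vertex_neq0|move=> k; rewrite bary_vertex].
have [K [HK Kv0]] : exists K, is_cone Om K /\ K (vertex B 0).
  have [Kv|Kv] := cone_lift HK0 (vertex_neq0 B 0) (vpt 0); first by exists K0.
  by exists [set V | K0 (- V)]; split=> //; exact: is_cone_opp.
exists K; split=> // j; have [//|KNv] := cone_lift HK (vertex_neq0 B j) (vpt j).
have [phi hphi] := cone_bound HK.
have f0 := cone_form_gt0 HK hphi Kv0; have := cone_form_gt0 HK hphi KNv; rewrite formN oppr_gt0 => fj.
pose V := - form phi (vertex B j) *: vertex B 0 + form phi (vertex B 0) *: vertex B j.
have fV : form phi V = 0 by rewrite formD !formZ mulNr mulrC addNr.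
have Vge k : 0 <= form (a k) V.
  by rewrite formD !formZ !bary_vertex addr_ge0 // mulr_ge0 // ltW // oppr_gt0.
have j0 : 0 != j by apply: contraTneq f0 => ->; rewrite -leNgt ltW.
have V0 : V != 0.
  apply/eqP => /(congr1 (form (a j))); rewrite formD !formZ !bary_vertex eqxx eq_sym (negPf j0) form0.
  by rewrite mulr0 add0r mulr1 => f00; move: f0; rewrite f00 ltxx.
have [KV|KV] := cone_lift HK V0 (simplex_pt V V0 Vge); have := cone_form_gt0 HK hphi KV.
  by rewrite fV ltxx.
by rewrite formN fV oppr0 ltxx.
Qed.

Variable K : set 'cV[R]_n.+1.
Hypotheses (HK : is_cone Om K) (Kv : forall j, K (vertex B j)).

Lemma cone_psimplexP V : K V -> psimplex B (pt V) <-> forall j, 0 <= form (a j) V.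
Proof.
move=> KV; have V0 := cone_neq0 HK KV; rewrite psimplexP //; split=> [[//|h]|]; last by left.
have [phi hphi] := cone_bound HK; have := cone_form_gt0 HK hphi KV.
suff : form phi V <= 0 by move=> ? ?; lra.
rewrite (bary_decomp B V) form_sum; apply: sumr_le0 => j _; rewrite formZ mulr_le0_ge0 //.
by rewrite ltW // (cone_form_gt0 HK hphi).
Qed.

Lemma cone_lift_psimplex x : psimplex B x -> psimplex B `<=` Om ->
  exists V, [/\ K V, x = pt V & forall j, 0 <= form (a j) V].
Proof.
move=> Px PO; have Ox := PO _ Px; have h0 := hcoord_neq0 x.
move: Ox Px; rewrite -(pt_hcoord x) => /(cone_lift HK h0)[KV|KV].
  by exists (hcoord x); split=> //; apply/cone_psimplexP.
by rewrite -ptN; exists (- hcoord x); split=> //; apply/cone_psimplexP.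
Qed.

(* A lifted reflection fixes a vertex of the cone, hence does not exchange the
   cone with its opposite; its centre is sent to its opposite. *)
Lemma reflection_cone (A : GL R n) E s : (1 <= n)%N ->
  (forall x, Om x -> Om (pgl_act (pgl_class A) x)) -> form (a s) E = 1 ->
  (forall V, glval A *m V = V - (2 * form (a s) V) *: E) ->
  [/\ forall V, K V -> K (glval A *m V),
      forall V, glval A *m (glval A *m V) = V,
      forall V, form (a s) (glval A *m V) = - form (a s) V & ~ Om (pt E)].
Proof.
move=> n1 AO aE AE.
have AA V : glval A *m (glval A *m V) = V.
  rewrite !AE formB formZ aE -addrA -opprD -scalerDl -[RHS]subr0; congr (_ - _).
  by apply/eqP; rewrite scaler_eq0; apply/orP; left; apply/eqP; ring.
have aA V : form (a s) (glval A *m V) = - form (a s) V.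
  by rewrite AE formB formZ aE; ring.
have E0 : E != 0 by apply/eqP => E0; move: aE; rewrite E0 form0 => /eqP; rewrite eq_sym oner_eq0.
have [j js] : exists j : 'I_n.+1, j != s.
  have m : (1 < n.+1)%N by rewrite ltnS.
  by have [->|s0] := eqVneq s 0; [exists (Ordinal m)|exists 0; rewrite eq_sym].
have Avj : glval A *m vertex B j = vertex B j.
  by rewrite AE bary_vertex eq_sym (negPf js) mulr0 scale0r subr0.
have [phi hphi] := cone_bound HK.
have KA V : K V -> K (glval A *m V).
  move=> KV; have AV0 := glval_mul_neq0 A (cone_neq0 HK KV).
  have OAV W : K W -> Om (pt (glval A *m W)).
    by move=> KW; rewrite -pgl_act_pt ?(cone_neq0 HK) //; exact/AO/(cone_pt HK).
  have [//|KNAV] := cone_lift HK AV0 (OAV V KV).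
  (* The form phi o A vanishes nowhere on the domain, so it has on all of [K] the sign that it has
     at the fixed vertex j. *)
  have fA : Om `<=` in_chart (phi *m glval A).
    have fA W : K W -> form (phi *m glval A) W != 0.
      move=> KW; rewrite /form -mulmxA -/(form _ _).
      have [KAW|KAW] := cone_lift HK (glval_mul_neq0 A (cone_neq0 HK KW)) (OAV W KW).
        by rewrite gt_eqF // (cone_form_gt0 HK hphi).
      by rewrite lt_eqF // -oppr_gt0 -formN (cone_form_gt0 HK hphi).
    move=> x Ox; rewrite -(pt_hcoord x); have h0 := hcoord_neq0 x; apply/in_chart_pt => //.
    move: Ox; rewrite -{1}(pt_hcoord x) => /(cone_lift HK h0)[|] /fA //.
    by rewrite formN oppr_eq0.
  have := in_chart_cone_sign HK fA KV (Kv j).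
  rewrite /form -!mulmxA Avj -!/(form _ _) => h.
  have := cone_form_gt0 HK hphi KNAV; rewrite formN oppr_gt0.
  have := cone_form_gt0 HK hphi (Kv j) => fj.
  by move: h; rewrite pmulr_lgt0 // => ? ?; lra.
have AEE : glval A *m E = - E.
  by rewrite AE aE mulr1 scaler_nat mulr2n opprD addrA subrr sub0r.
split=> // /(cone_lift HK E0)[|] KE; have := KA _ KE.
  by rewrite AEE => /(cone_antipodal HK KE).
by rewrite mulmxN AEE opprK => KE'; exact: cone_antipodal HK KE' KE.
Qed.

Lemma side_open psi : open [set x | exists V, [/\ K V, x = pt V & 0 < form psi V]].
Proof.
apply/open_pspaceP => V V0 [V' [KV' eV aV']].
have V'0 := cone_neq0 HK KV'; move: eV => /esym/(pt_eqP V'0 V0)[c c0 EV].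
have [e e0 he] := cone_open HK KV'; have [k k0 hk] := form_bound psi.
exists (`|c| * Num.min e (form psi V' / k)).
  by rewrite mulr_gt0 ?normr_gt0 // lt_min e0 divr_gt0.
move=> W hW W0; exists (c^-1 *: W); rewrite ptZ ?invr_eq0 //.
have hd : `|V' - c^-1 *: W| < Num.min e (form psi V' / k).
  rewrite -(ltr_pM2l (_ : 0 < `|c|)) ?normr_gt0 // -normrZ scalerBr scalerA divff // scale1r.
  by rewrite -EV.
move: hd; rewrite lt_min ltr_pdivlMr // => /andP[hd1 hd2].
split=> //; first exact: he.
have := le_lt_trans (hk (V' - c^-1 *: W)) _; rewrite mulrC => /(_ _ hd2).
by rewrite formB ltr_norml => /andP[_]; lra.
Qed.

End SimplexCone.

(** The affine segment projected radially to the hyperboloid. The positive factor [c] is recorded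
    because it lets the sign of a linear functional along the path be read off the segment. *)
Lemma hyperbolic_path (R : realType) (n : nat) (x u : 'cV[R]_n.+1) :
  hyperbolic_space x -> hyperbolic_space u ->
  exists (g : R -> 'cV[R]_n.+1) (c : R -> R), [/\ g 0 = x, g 1 = u &
    forall t, 0 <= t <= 1 -> [/\ hyperbolic_space (g t), {for t, continuous g}, 0 < c t &
      g t = c t *: ((1 - t) *: x + t *: u)]].
Proof.
move=> Hx Hu; have [xx x0] := Hx; have [uu u0] := Hu.
have xu : lorentz x u < 0 by apply: hyperbolic_lorentz_lt0; rewrite ?uu.
pose w t : 'cV[R]_n.+1 := (1 - t) *: x + t *: u.
pose q t : R := (1 - t) ^+ 2 + t ^+ 2 - 2 * t * (1 - t) * lorentz x u.
have qE t : lorentz (w t) (w t) = - q t.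
  rewrite /w !(lorentzDl, lorentzDr, lorentzZl, lorentzZr) xx uu (lorentzC u x) /q; ring.
have q0 t : 0 <= t <= 1 -> 0 < q t.
  move=> /andP[t0 t1]; have h : 0 <= t * (1 - t) by rewrite mulr_ge0 // subr_ge0.
  have : 0 <= - (t * (1 - t) * lorentz x u) by rewrite -mulrN mulr_ge0 // oppr_ge0 ltW.
  have := sqr_ge0 (1 - 2 * t); rewrite /q; nra.
exists (fun t => (Num.sqrt (q t))^-1 *: w t), (fun t => (Num.sqrt (q t))^-1); split.
- by rewrite /q /w subr0 expr1n !expr2 !(mulr0, mul0r) addr0 subr0 sqrtr1 invr1 !scale1r scale0r addr0.
- by rewrite /q /w subrr !expr2 !(mulr0, mul0r) mulr1 add0r subr0 sqrtr1 invr1 !scale1r scale0r add0r.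
move=> t t01; have qt := q0 t t01; have s0 : 0 < Num.sqrt (q t) by rewrite sqrtr_gt0.
have [t0 t1] := andP t01.
split; [split| |by rewrite invr_gt0|by []].
- by rewrite lorentzZl lorentzZr qE mulrA -expr2 exprVn sqr_sqrtr ?ltW // mulrN mulVf ?gt_eqF.
- rewrite mxE mulr_gt0 ?invr_gt0 // !mxE; have [->|t_gt0] := eqVneq t 0.
    by rewrite subr0 mul1r mul0r addr0.
  apply: ltr_wpDl; first by rewrite mulr_ge0 ?subr_ge0 // ltW.
  by rewrite mulr_gt0 // lt_neqAle eq_sym t_gt0.
- have c1 : (1 - r : R) @[r --> t] --> 1 - t by apply: cvgB; [exact: cvg_cst|exact: cvg_id].
  have cq : q r @[r --> t] --> q t.
    apply: cvgB; first by apply: cvgD; rewrite expr2; apply: cvgM => //; exact: cvg_id.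
    apply: cvgM; last exact: cvg_cst.
    by apply: cvgM => //; apply: cvgM; [exact: cvg_cst|exact: cvg_id].
  apply: cvgZ; last by apply: cvgD; [apply: cvgZ => //; exact: cvg_cst|apply: cvgZ; [exact: cvg_id|exact: cvg_cst]].
  apply: cvgV; first by rewrite gt_eqF.
  by apply: (@continuous_cvg _ _ _ _ _ q Num.sqrt) => //; exact: sqrt_continuous.
Qed.

(** * Transfer from hyperbolic space *)

Lemma representation1 (R : realType) (n : nat) (J : coxeter_diagram n) (rho : representation R J) :
  rho 1%g = 1%g.
Proof. by apply: (mulIg (rho 1%g)); rewrite -gmulfM !mul1g. Qed.

Section Transfer.
Variables (R : realType) (n : nat) (J : coxeter_diagram n).
Variables (u v : 'I_n.+1 -> 'cV[R]_n.+1) (B : GL R n).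
Variables (rho : representation R J) (Om : set (pspace R n)) (K : set 'cV[R]_n.+1).
Variables (f : 'cV[R]_n.+1 -> pspace R n) (f' : pspace R n -> 'cV[R]_n.+1).
Variables (A : 'I_n.+1 -> GL R n) (E : 'I_n.+1 -> 'cV[R]_n.+1).
Local Notation a := (bary B).
Local Notation gen := (coxeter_gen J).
Local Notation H := (@hyperbolic_space R n).
Implicit Types (V X Y Z : 'cV[R]_n.+1) (g h : coxeter_group J) (s : 'I_n.+1).

Hypothesis uv : coxeter_simplex J u v.
Hypotheses (HK : is_cone Om K) (Kv : forall j, K (vertex B j)).
Hypothesis f_bij : set_bij H Om f.
Hypothesis fK : {in H, cancel f f'}.
Hypothesis f_cont : {within H, continuous f}.
Hypothesis f_equiv : forall w x, H x ->
  f (word_isometry v w x) = pgl_act (rho (coxeter_word J w)) (f x).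
Hypothesis rhoA : forall s, rho (gen s) = pgl_class (A s).
Hypothesis aE : forall s, form (a s) (E s) = 1.
Hypothesis AE : forall s V, glval (A s) *m V = V - (2 * form (a s) V) *: E s.
Hypothesis KA : forall s V, K V -> K (glval (A s) *m V).
Hypothesis nE : forall s, ~ Om (pt (E s)).

Let vv := normal_unit uv.

Let f_Om x : H x -> Om (f x).
Proof. by move=> Hx; have [fun_f _ _] := f_bij; exact: fun_f. Qed.

Let f_inj x y : H x -> H y -> f x = f y -> x = y.
Proof. by move=> /mem_set Hx /mem_set Hy e; rewrite -(fK Hx) e fK. Qed.

Let fgen s x : H x -> f (lorentz_reflection (v s) x) = pgl_act (rho (gen s)) (f x).
Proof. exact: (f_equiv [:: s]). Qed.

Lemma cone_lift_model x : H x -> exists V, K V /\ f x = pt V.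
Proof.
move=> /f_Om; rewrite -(pt_hcoord (f x)) => /(cone_lift HK (hcoord_neq0 _))[KV|KV].
  by exists (hcoord (f x)).
by exists (- hcoord (f x)); split=> //; rewrite ptN.
Qed.

(** Both conditions say that the point is fixed by the s-th reflection: on the projective side the
    fixed points are the hyperplane a_s = 0 and the centre, and the centre is outside the domain. *)
Lemma wall_model s x V : H x -> K V -> f x = pt V -> lorentz x (v s) = 0 <-> form (a s) V = 0.
Proof.
move=> Hx KV fx; have V0 := cone_neq0 HK KV; split=> h.
  have := fgen s Hx; rewrite {1}/lorentz_reflection h mulr0 scale0r subr0 fx rhoA pgl_act_pt //.
  move=> /(pt_eqP V0 (glval_mul_neq0 _ V0))[c c0]; rewrite AE => e.
  apply/eqP/negPn/negP => aV; case: (nE (s := s)).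
  have eE : E s = ((1 - c) / (2 * form (a s) V)) *: V.
    rewrite mulrC -scalerA scalerBl scale1r -e opprB addrC subrK scalerA mulVf ?scale1r //.
    by rewrite mulf_neq0 // pnatr_eq0.
  have c1 : (1 - c) / (2 * form (a s) V) != 0.
    apply/eqP => c1; have := aE s; rewrite eE c1 scale0r form0 => /eqP.
    by rewrite eq_sym oner_eq0.
  by rewrite eE ptZ // -fx; exact: f_Om.
have : f (lorentz_reflection (v s) x) = f x.
  by rewrite fgen // rhoA fx pgl_act_pt // AE h mulr0 scale0r subr0.
move=> /(f_inj (lorentz_reflection_hyperbolic (vv s) Hx) Hx).
rewrite /lorentz_reflection -[X in _ = X]subr0 => /addrI/oppr_inj e.
have : lorentz ((2 * lorentz x (v s)) *: v s) (v s) = 0.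
  by rewrite e -(scale0r (v s)) lorentzZl mul0r.
by rewrite lorentzZl vv mulr1; lra.
Qed.

Lemma vertex_model s : f (u s) = pt (vertex B s).
Proof.
have Hu := vertex_hyperbolic uv s; have [V [KV fu]] := cone_lift_model Hu.
have aV j : j != s -> form (a j) V = 0.
  by move=> js; apply/(wall_model j Hu KV fu)/(vertex_in_face uv).
have EV : V = form (a s) V *: vertex B s.
  rewrite {1}(bary_decomp B V) (bigD1 s) //= big1 ?addr0 // => j /aV ->.
  by rewrite scale0r.
rewrite fu EV ptZ //; apply: contraNneq (cone_neq0 HK KV) => e.
by rewrite EV e scale0r.
Qed.

(** The path from x to [u s] avoids the wall s, so its image is connected and covered by the two
    disjoint open sides of a_s = 0; it ends at the s-th vertex, where a_s is positive. *)
Lemma inner_model s x V : H x -> lorentz x (v s) < 0 -> K V -> f x = pt V -> 0 < form (a s) V.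
Proof.
move=> Hx xs KV fx; have Hu := vertex_hyperbolic uv s.
have [g [c [g0 g1 hg]]] := hyperbolic_path Hx Hu.
pose pos : set (pspace R n) := [set z | exists V, [/\ K V, z = pt V & 0 < form (a s) V]].
pose neg : set (pspace R n) := [set z | exists V, [/\ K V, z = pt V & 0 < form (- a s) V]].
have opos : open pos := side_open HK (a s).
have oneg : open neg := side_open HK (- a s).
have disj z : pos z -> neg z -> False.
  move=> [X [KX -> aX]] [Y [KY /(pt_eqP (cone_neq0 HK KX) (cone_neq0 HK KY))[k k0 EY]]].
  rewrite formNl EY formZ oppr_gt0 pmulr_llt0 // => k_lt0.
  apply: (cone_antipodal HK KY); rewrite EY -scaleNr; apply: (cone_scale HK) => //.
  by rewrite oppr_gt0.
have t01P (t : R) : `[0, 1]%classic t -> 0 <= t <= 1 by rewrite /= in_itv.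
have cover t : `[0, 1]%classic t -> pos (f (g t)) \/ neg (f (g t)).
  move=> /t01P t01; have [Hg _ c0 gE] := hg t t01; have [X [KX fX]] := cone_lift_model Hg.
  have lt0 : lorentz (g t) (v s) < 0.
    rewrite gE lorentzZl pmulr_rlt0 // lorentzDl !lorentzZl.
    have us := vertex_inner_side uv s; have [t0 t1] := andP t01.
    have [->|tn0] := eqVneq t 0; first by rewrite subr0 mul1r mul0r addr0.
    have : t * lorentz (u s) (v s) < 0 by rewrite pmulr_rlt0 // lt_neqAle eq_sym tn0.
    have : (1 - t) * lorentz x (v s) <= 0 by rewrite mulr_ge0_le0 ?subr_ge0 // ltW.
    by lra.
  have : form (a s) X != 0.
    by apply/eqP => /(wall_model s Hg KX fX) e; move: lt0; rewrite e ltxx.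
  rewrite neq_lt => /orP[aX|aX]; [right|left]; exists X; split=> //.
  by rewrite formNl oppr_gt0.
have cont : {within `[0, 1]%classic, continuous (f \o g)}.
  apply/subspace_continuousP => t /t01P t01 U /= Uft.
  have [Hg gc _ _] := hg t t01.
  have := (subspace_continuousP _ _).1 f_cont (g t) Hg U Uft.
  rewrite /within /= => /gc hgc; have {}hgc : nbhs t (fun r => H (g r) -> U (f (g r))) := hgc.
  have : nbhs t (fun r => `[0, 1]%classic r -> U (f (g r))); last by [].
  by apply: filterS hgc => r hr /t01P/hg[Hr _ _ _]; exact: hr.
have conn : connected ((f \o g) @` `[0, 1]%classic).
  by apply: connected_continuous_connected cont; exact: segment_connected.
have e : ((f \o g) @` `[0, 1]%classic) `&` pos = (f \o g) @` `[0, 1]%classic.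
  apply: conn.
  - exists (pt (vertex B s)); split.
      by exists 1; rewrite /= ?g1 ?vertex_model // in_itv /= ler01 lexx.
    by exists (vertex B s); split=> //; rewrite bary_vertex eqxx.
  - by exists pos.
  - exists (~` neg); first by rewrite closedC.
    apply/seteqP; split=> z [fz hz]; split=> //; first by move=> hz'; exact: disj hz hz'.
    by have [t tI ft] := fz; have := cover t tI; rewrite -ft in hz *; case.
have : ((f \o g) @` `[0, 1]%classic) (f x).
  by exists 0; rewrite /= ?g0 // in_itv /= ler01 lexx.
rewrite -e => -[_ posx].
have aV : form (a s) V != 0.
  by apply/eqP => /(wall_model s Hx KV fx) e'; move: xs; rewrite e' ltxx.
move: aV; rewrite neq_lt => /orP[aV|//]; case: (disj _ posx).
by exists V; split=> //; rewrite formNl oppr_gt0.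
Qed.

Lemma sign_model s x V : H x -> K V -> f x = pt V ->
  (lorentz x (v s) <= 0 <-> 0 <= form (a s) V) /\ (0 <= lorentz x (v s) <-> form (a s) V <= 0).
Proof.
move=> Hx KV fx.
have wall := wall_model s Hx KV fx; have inner := @inner_model s x V Hx.
have outer : 0 < lorentz x (v s) -> form (a s) V < 0.
  move=> xs; have Hr := lorentz_reflection_hyperbolic (vv s) Hx.
  have := @inner_model s _ (glval (A s) *m V) Hr; rewrite lorentz_reflectionC.
  rewrite {1}/lorentz_reflection vv lorentzBr lorentzZr => h.
  have : 0 < form (a s) (glval (A s) *m V).
    apply: h; [by lra|exact: KA|].
    by rewrite fgen // rhoA fx pgl_act_pt // (cone_neq0 HK).
  by rewrite AE formB formZ aE; lra.
have [xs|xs|xs] := ltgtP (lorentz x (v s)) 0.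
- have aV := inner xs KV fx; split; split=> //; first by rewrite ltW.
  by rewrite leNgt aV.
- have aV := outer xs; split; split=> //; first by rewrite leNgt aV.
  by rewrite ltW.
- by have /wall -> := xs; split; split.
Qed.

Lemma chamber_model x : H x -> psimplex B (f x) -> chamber v x.
Proof.
move=> Hx; have [V [KV fx]] := cone_lift_model Hx; rewrite fx => /(cone_psimplexP HK Kv KV) h.
by split=> // s; apply/(sign_model s Hx KV fx).1.
Qed.

(** [word_isometry] is defined on words only. Conjugating the projective action by the homeomorphism
    makes it an action of group elements, without a verification of the braid relations in the
    Lorentz group. *)
Definition model_act g x := f' (pgl_act (rho g) (f x)).

Lemma model_act1 x : H x -> model_act 1%g x = x.
Proof. by move=> Hx; rewrite /model_act representation1 pgl_act1 fK ?inE. Qed.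

Lemma word_isometry_hyperbolic w x : H x -> H (word_isometry v w x).
Proof. by move=> Hx; elim: w => //= i w IH; exact: lorentz_reflection_hyperbolic. Qed.

Lemma model_act_hyperbolic g x : H x -> H (model_act g x).
Proof.
move=> Hx; have Hw := word_isometry_hyperbolic (repr g) Hx.
by rewrite -(coxeter_reprK g) /model_act -f_equiv // fK ?inE.
Qed.

Lemma f_model_act g x : H x -> f (model_act g x) = pgl_act (rho g) (f x).
Proof.
move=> Hx; rewrite -{1 2}(coxeter_reprK g) /model_act -f_equiv // fK // inE.
exact: word_isometry_hyperbolic.
Qed.

Lemma model_actS i g x : H x -> model_act (gen i * g)%g x = lorentz_reflection (v i) (model_act g x).
Proof.
move=> Hx; have Ha := model_act_hyperbolic g Hx.
have Hr := lorentz_reflection_hyperbolic (vv i) Ha.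
by rewrite {1}/model_act gmulfM pgl_actM -f_model_act // -fgen // fK // inE; exact: Hr.
Qed.

Lemma tile_side g s x V : psimplex B x -> psimplex B `<=` Om -> K V -> pgl_act (rho g) x = pt V ->
  ((coxeter_len g <= coxeter_len (gen s * g)%g)%N -> 0 <= form (a s) V) /\
  ((coxeter_len (gen s * g)%g < coxeter_len g)%N -> form (a s) V <= 0).
Proof.
move=> Px PO KV gx; have [_ _ surj] := f_bij; have [y Hy fy] := surj _ (PO _ Px).
have Cy : chamber v y by apply: chamber_model => //; rewrite fy.
have Hg := model_act_hyperbolic g Hy.
have fg : f (model_act g y) = pt V by rewrite f_model_act // fy.
have angle := face_angle uv.
split=> h.
  by apply/(sign_model s Hg KV fg).1/(tits_inner vv angle model_act1 model_actS Cy h).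
by apply/(sign_model s Hg KV fg).2/(tits_outer vv angle model_act1 model_actS Cy h).
Qed.

Lemma finite_parabolic_model i : finite_set (@parabolic n J i).
Proof. exact: finite_parabolic uv model_act1 model_actS i. Qed.

End Transfer.

(** * Folding a segment *)

Section Walk.
Variables (R : realType) (n : nat) (J : coxeter_diagram n) (B : GL R n).
Variables (rho : representation R J) (Om : set (pspace R n)) (K : set 'cV[R]_n.+1).
Variables (A : 'I_n.+1 -> GL R n) (E : 'I_n.+1 -> 'cV[R]_n.+1) (eps : R).
Local Notation a := (bary B).
Local Notation gen := (coxeter_gen J).
Local Notation len := (@coxeter_len n J).
Local Notation d := (hilbert_dist Om).
Local Notation P := (psimplex B).
Implicit Types (V X Y Z : 'cV[R]_n.+1) (g h : coxeter_group J) (i j s : 'I_n.+1).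

Hypotheses (oOm : open Om) (HK : is_cone Om K) (Kv : forall j, K (vertex B j)) (PO : P `<=` Om).
Hypothesis rhoA : forall s, rho (gen s) = pgl_class (A s).
Hypothesis AE : forall s V, glval (A s) *m V = V - (2 * form (a s) V) *: E s.
Hypothesis AA : forall s V, glval (A s) *m (glval (A s) *m V) = V.
Hypothesis KA : forall s V, K V -> K (glval (A s) *m V).
Hypothesis side : forall g s x V, P x -> K V -> pgl_act (rho g) x = pt V ->
  ((len g <= len (gen s * g)%g)%N -> 0 <= form (a s) V) /\
  ((len (gen s * g)%g < len g)%N -> form (a s) V <= 0).

Variable total : 'rV[R]_n.+1.
Hypothesis totalE : forall V, form total V = \sum_j form (a j) V.

Hypothesis eps0 : 0 < eps.
Hypothesis K_total : forall V, K V -> 0 < form total V.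
Hypothesis K_eps : forall i V, K V -> 0 <= form (a i) V + eps * form total V.

Lemma rho_act_cone g V : K V -> exists X, K X /\ pgl_act (rho g) (pt V) = pt X.
Proof.
move=> KV; elim/coxeter_ind: g => [|s g [X [KX gX]]].
  by exists V; rewrite representation1 pgl_act1.
exists (glval (A s) *m X); split; first exact: KA.
by rewrite gmulfM pgl_actM gX rhoA pgl_act_pt // (cone_neq0 HK).
Qed.

Lemma omega_lift x : Om x -> exists V, K V /\ x = pt V.
Proof.
rewrite -(pt_hcoord x) => /(cone_lift HK (hcoord_neq0 x))[KV|KV]; first by exists (hcoord x).
by exists (- hcoord x); rewrite ptN.
Qed.

Lemma hilbert_dist_rho g x y : Om x -> Om y -> d (pgl_act (rho g) x) (pgl_act (rho g) y) = d x y.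
Proof.
move=> /omega_lift[X [KX ->]] /omega_lift[Y [KY ->]].
elim/coxeter_ind: g => [|s g IH]; first by rewrite representation1 !pgl_act1.
rewrite -IH gmulfM !pgl_actM.
have [X' [KX' ->]] := rho_act_cone g KX; have [Y' [KY' ->]] := rho_act_cone g KY.
rewrite rhoA (pgl_act_pt _ (cone_neq0 HK KX')) (pgl_act_pt _ (cone_neq0 HK KY')).
rewrite (hilbert_dist_cone oOm HK KX' KY') (hilbert_dist_cone oOm HK (KA _ KX') (KA _ KY')).
have AK V : K (glval (A s) *m V) <-> K V.
  by split=> [/(KA s)|]; [rewrite AA|exact: KA].
by rewrite !cone_ratio_mulmx.
Qed.

Lemma hilbert_dist_chain (b : R) X Y : 0 <= b -> K X -> K Y -> K (X + b *: Y) ->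
  d (pt X) (pt (X + b *: Y)) + d (pt (X + b *: Y)) (pt Y) <= d (pt X) (pt Y).
Proof.
move=> b0 KX KY; set Z := X + b *: Y => KZ.
rewrite !(hilbert_dist_cone oOm HK) // -opprD lerN2 -mulrDr ler_pM2l ?invr_gt0 //.
have pos := cone_ratio_gt0 HK.
rewrite -lnM ?posrE ?mulr_gt0 ?pos // ler_ln ?posrE ?mulr_gt0 ?pos //.
have h1 : cone_ratio K X Y <= cone_ratio K X Z * cone_ratio K Z Y.
  by have := cone_ratio_chain HK ltr01 b0 KX KY; rewrite scale1r.
have h2 : cone_ratio K Y X <= cone_ratio K Y Z * cone_ratio K Z X.
  (* With the roles of X and Y exchanged, [b] becomes the coefficient that [cone_ratio_chain]
     requires to be positive. *)
  have [b_eq0|b_neq0] := eqVneq b 0.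
    by rewrite /Z b_eq0 scale0r addr0 (cone_ratio_self HK KX) mulr1.
  have b_gt0 : 0 < b by rewrite lt_neqAle eq_sym b_neq0.
  by have := cone_ratio_chain HK b_gt0 ler01 KY KX; rewrite scale1r addrC.
apply: le_trans (ler_pM (ltW (pos _ _ KX KY)) (ltW (pos _ _ KY KX)) h1 h2) _.
by rewrite le_eqVlt; apply/orP; left; apply/eqP; ring.
Qed.

Definition height i V : R := 2^-1 * ln ((form (a i) V / form total V + eps) / eps).

Lemma height_ge0 i V : K V -> 0 <= form (a i) V -> 0 <= height i V.
Proof.
move=> KV aV; rewrite mulr_ge0 ?invr_ge0 // ln_ge0 // ler_pdivlMr // mul1r.
by rewrite lerDr divr_ge0 // ltW // K_total.
Qed.

Lemma height_wall i V : form (a i) V = 0 -> height i V = 0.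
Proof. by move=> aV; rewrite /height aV mul0r add0r divff ?gt_eqF // ln1 mulr0. Qed.

(** Bound the ratio of X to Z by the form [total] and that of Z to X by a_i + eps [total]. The
    product is at most the quotient of the values at Z and X of the normalised a_i + eps. *)
Lemma height_le_dist i X Z : K X -> K Z -> 0 <= form (a i) X -> 0 <= form (a i) Z ->
  height i X - height i Z <= d (pt X) (pt Z).
Proof.
move=> KX KZ aX aZ; rewrite (hilbert_dist_cone oOm HK) // /height -mulrBr -mulrN.
rewrite ler_pM2l ?invr_gt0 //.
have SX := K_total KX; have SZ := K_total KZ.
have FX : 0 < form (a i) X / form total X + eps by rewrite ltr_wpDl // divr_ge0 // ltW.
have FZ : 0 < form (a i) Z / form total Z + eps by rewrite ltr_wpDl // divr_ge0 // ltW.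
have pos := cone_ratio_gt0 HK.
rewrite -ln_div ?posrE ?divr_gt0 // -lnV ?posrE ?mulr_gt0 ?pos //.
rewrite ler_ln ?posrE ?divr_gt0 ?invr_gt0 ?mulr_gt0 ?pos //.
have h1 := cone_ratio_le HK KX KZ (fun V KV => ltW (K_total KV)) SZ.
pose psi := a i + eps *: total.
have psiE V : form psi V = form (a i) V + eps * form total V.
  by rewrite /form mulmxDl mxE -scalemxAl [X in _ + X]mxE.
have h2 := @cone_ratio_le _ _ _ _ HK psi Z X KZ KX.
have psi0 V : K V -> 0 <= form psi V by move=> KV; rewrite psiE K_eps.
have psiX : 0 < form psi X by rewrite psiE ltr_wpDl // mulr_gt0.
have {}h2 := h2 psi0 psiX.
rewrite -[leLHS]invrK lef_pV2 ?posrE ?invr_gt0 ?divr_gt0 ?mulr_gt0 ?pos //.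
apply: le_trans (ler_pM (ltW (pos _ _ KX KZ)) (ltW (pos _ _ KZ KX)) h1 h2) _; rewrite !psiE.
rewrite le_eqVlt; apply/orP; left; apply/eqP; field.
rewrite !gt_eqF //; first by rewrite -psiE.
by rewrite ltr_wpDl // mulr_gt0.
Qed.

Lemma hilbert_dist_ge0 X Y : K X -> K Y -> 0 <= d (pt X) (pt Y).
Proof.
move=> KX KY; rewrite (hilbert_dist_cone oOm HK) // -mulrN mulr_ge0 ?invr_ge0 // oppr_ge0 ln_le0 //.
have SX := K_total KX; have SY := K_total KY; have pos := cone_ratio_gt0 HK.
have h1 := cone_ratio_le HK KX KY (fun V KV => ltW (K_total KV)) SY.
have h2 := cone_ratio_le HK KY KX (fun V KV => ltW (K_total KV)) SX.
apply: le_trans (ler_pM (ltW (pos _ _ KX KY)) (ltW (pos _ _ KY KX)) h1 h2) _.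
by rewrite mulrA divfK ?divff // gt_eqF.
Qed.

Lemma simplex_exit X Y : (forall j, 0 <= form (a j) X) -> ~ (forall j, 0 <= form (a j) Y) ->
  exists s b, [/\ 0 <= b, forall j, 0 <= form (a j) (X + b *: Y), form (a s) (X + b *: Y) = 0 &
    form (a s) Y < 0].
Proof.
move=> aX /existsNP[j0] /negP; rewrite -ltNge => aYj0.
(* The time b at which a_j vanishes on X + b Y; the smallest one, over the j with a_j(Y) < 0, is the
   exit time. *)
pose r j := form (a j) X / - form (a j) Y.
have [s /= aYs smin] := @arg_minP _ _ _ j0 (fun j => form (a j) Y < 0) r aYj0.
exists s, (r s); have b0 : 0 <= r s by rewrite /r divr_ge0 // oppr_ge0 ltW.
split=> // [j|]; rewrite formD formZ; last by rewrite /r invrN mulrN mulNr divfK ?subrr ?lt_eqF.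
have [aYj|aYj] := ltP (form (a j) Y) 0; last by rewrite addr_ge0 ?(mulr_ge0 b0 aYj).
have := smin j aYj; rewrite {2}/r ler_pdivlMr ?oppr_gt0 //.
by rewrite mulrN; lra.
Qed.

(** Descent on the length: if s shortens g, then [side] puts g x on the wall s, so s g sends x to
    the same point. *)
Lemma tile_fixed g x : P x -> P (pgl_act (rho g) x) -> pgl_act (rho g) x = x.
Proof.
move=> Px; elim/ltn_ind: {g}(len g) {-2}g (erefl (len g)) => l IH g lg Pgx; subst l.
have [->|g1] := eqVneq g 1%g; first by rewrite representation1 pgl_act1.
have [s sg] := coxeter_len_descent g1.
have [V [KV gx aV]] := cone_lift_psimplex HK Kv Pgx PO.
have V0 := cone_neq0 HK KV.
have aVs : form (a s) V = 0.
  by apply/eqP; rewrite eq_le aV andbT; exact: (side s Px KV gx).2.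
have sgx : pgl_act (rho (gen s * g)%g) x = pgl_act (rho g) x.
  by rewrite gmulfM pgl_actM gx rhoA pgl_act_pt // AE aVs mulr0 scale0r subr0.
by rewrite -sgx; apply: (IH _ sg) => //; rewrite sgx.
Qed.

Definition step_length : R := 2^-1 * ln ((n.+1%:R^-1 + eps) / eps).

Let prodg (l : seq (coxeter_group J)) := foldr *%g 1%g l.

(* Follow the segment from [x] to [g y]. Whenever it leaves the current copy of
   the simplex through a face other than the [i]-th one, multiply the current
   element of the [i]-th parabolic subgroup by a generator; when it leaves
   through the [i]-th face, the height [h_i] has dropped to [0], and one starts
   again with an index whose height is at least [step_length]. *)
Lemma walk g X y i : K X -> (forall j, 0 <= form (a j) X) -> P y ->
  exists g0 (l : seq (coxeter_group J)), [/\ parabolic i g0, forall h, h \in l -> exists j, parabolic j h,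
    pgl_act (rho g) y = pgl_act (rho (g0 * prodg l)%g) y &
    if l is _ :: l' then height i X + (size l')%:R * step_length <= d (pt X) (pgl_act (rho g) y)
    else True].
Proof.
move=> KX aX Py; elim/ltn_ind: {g}(len g) {-2}g (erefl (len g)) X i KX aX => m IH g lg X i KX aX; subst m.
have [Pgy|nPgy] := pselect (P (pgl_act (rho g) y)).
  exists 1%g, [::]; split; [exact: parabolic1|by []| |by []].
  by rewrite mulg1 representation1 pgl_act1 tile_fixed.
have [y0 [Ky0 Ey]] := omega_lift (PO Py).
have [Y [KY gy]] := rho_act_cone g Ky0; rewrite -Ey in gy.
have nY : ~ (forall j, 0 <= form (a j) Y).
  by move=> h; apply: nPgy; rewrite gy; apply/(cone_psimplexP HK Kv KY).
have [s [b [b0]]] := simplex_exit aX nY; set Z := X + b *: Y => aZ aZs aYs.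
have KZ : K Z.
  move: b0; rewrite le_eqVlt /Z => /orP[/eqP <-|b0]; first by rewrite scale0r addr0.
  by apply: (cone_add HK) => //; exact: (cone_scale HK).
(* The point g y is strictly beyond the wall s, so s shortens g and the induction applies to s g. *)
have sg : (len (gen s * g)%g < len g)%N.
  rewrite ltnNge; apply/negP => /((side s Py KY gy).1); rewrite leNgt.
  by rewrite aYs.
have := hilbert_dist_chain b0 KX KY KZ; rewrite -/Z -gy => chain.
(* The s-th reflection is an isometry fixing Z, so folding the rest of the segment preserves its
   length. *)
have dZ : d (pt Z) (pgl_act (rho (gen s * g)%g) y) = d (pt Z) (pgl_act (rho g) y).
  have Zfix : pgl_act (rho (gen s)) (pt Z) = pt Z.
    by rewrite rhoA pgl_act_pt ?(cone_neq0 HK) // AE aZs mulr0 scale0r subr0.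
  rewrite gmulfM pgl_actM -{1}Zfix hilbert_dist_rho //; first exact: (cone_pt HK).
  by rewrite gy; exact: (cone_pt HK).
have gE g' : pgl_act (rho (gen s * g)%g) y = pgl_act (rho g') y ->
    pgl_act (rho g) y = pgl_act (rho (gen s * g')%g) y.
  by move=> e; rewrite gmulfM pgl_actM -e -pgl_actM -gmulfM coxeter_genK.
have [si|si] := eqVneq i s; last first.
  have [g0 [l [g0i lU gl dl]]] := IH _ sg _ (erefl _) Z i KZ aZ.
  exists (gen s * g0)%g, l; split; [exact: parabolic_genM|exact: lU| |].
    by rewrite -(mulgA (gen s)); exact: (gE _ gl).
  case: l dl {gl lU} => [_|h l dl]; first exact: I.
  rewrite dZ in dl; apply: le_trans chain; have hXZ := height_le_dist KX KZ (aX i) (aZ i).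
  by apply: le_trans (lerD hXZ dl); rewrite addrA subrK.
subst s; have [j aZj] : exists j, form total Z / n.+1%:R <= form (a j) Z.
  apply: contrapT => /forallNP nj.
  have : form total Z < \sum_(j < n.+1) form total Z / n.+1%:R.
    rewrite {1}totalE; apply: ltr_sum => [|j _].
      by apply/hasP; exists 0 => //; exact: mem_index_enum.
    rewrite ltNge; apply/negP; exact: nj.
  by rewrite sumr_const card_ord -[X in _ < X]mulr_natr divfK ?ltxx // pnatr_eq0.
have SZ := K_total KZ.
have ji : j != i.
  apply: contraTneq aZj => ->; rewrite aZs -ltNge divr_gt0 // ltr0n.
have hj : step_length <= height j Z.
  have e1 : 0 < n.+1%:R^-1 + eps by rewrite addr_gt0 // invr_gt0 ltr0n.
  have e2 : n.+1%:R^-1 <= form (a j) Z / form total Z.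
    by rewrite (ler_pdivlMr _ _ SZ) mulrC; exact: aZj.
  have e3 : n.+1%:R^-1 + eps <= form (a j) Z / form total Z + eps by rewrite lerD2r.
  rewrite /step_length /height ler_pM2l ?invr_gt0 ?ltr0n //.
  rewrite ler_ln ?posrE; [|exact: divr_gt0|exact: divr_gt0 (lt_le_trans e1 e3) eps0].
  by rewrite ler_pM2r ?invr_gt0.
have [g0 [l [g0j lU gl dl]]] := IH _ sg _ (erefl _) Z j KZ aZ.
(* The current factor is closed. As i differs from j, the generator of the wall just crossed can
   join the next one, which avoids j. *)
exists 1%g, ((gen i * g0)%g :: l); split.
- exact: parabolic1.
- move=> h; rewrite inE => /orP[/eqP ->|/lU //]; exists j; exact: parabolic_genM.
- by rewrite mul1g /= -(mulgA (gen i)); exact: (gE _ gl).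
have hi := height_le_dist KX KZ (aX i) (aZ i); rewrite (height_wall aZs) subr0 in hi.
apply: le_trans chain; apply: lerD hi _.
case: l dl {gl lU} => [_|h l dl].
  by rewrite mul0r gy; exact: hilbert_dist_ge0.
rewrite dZ in dl; apply: le_trans dl.
by rewrite /= -natr1 mulrDl mul1r addrC lerD2r.
Qed.

(** Two factors come for free: the first stretch starts at a point whose height is only known to be
    nonnegative, and the last one need not reach its wall. *)
Lemma walk_word g x y : 0 <= step_length -> P x -> P y ->
  exists l : seq (coxeter_group J), [/\ forall h, h \in l -> exists j, parabolic j h,
    pgl_act (rho g) y = pgl_act (rho (prodg l)) y &
    (size l).-2%:R * step_length <= d x (pgl_act (rho g) y)].
Proof.
move=> L0 Px Py; have [X [KX -> aX]] := cone_lift_psimplex HK Kv Px PO.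
have [g0 [l [g00 lU gl dl]]] := walk g 0 KX aX Py; exists (g0 :: l); split=> [h| |].
- by rewrite inE => /orP[/eqP ->|]; [exists 0|exact: lU].
- exact: gl.
case: l dl {lU gl} => [_|h l dl] /=.
  have [y0 [Ky0 Ey]] := omega_lift (PO Py); have [Y [KY gy]] := rho_act_cone g Ky0.
  by rewrite mul0r Ey gy; exact: hilbert_dist_ge0.
by apply: le_trans dl; rewrite lerDr; exact: height_ge0.
Qed.

End Walk.

(** * Entropy *)

Section Entropy.
Variables (R : realType) (W : groupType) (T : choiceType).
Variables (act : W -> T -> T) (d : T -> T -> R) (Om P : set T) (U : seq W) (L : R).

Let prodg (l : seq W) := foldr *%g 1%g l.

Hypothesis act1 : forall x, act 1%g x = x.
Hypothesis actM : forall g h x, act (g * h)%g x = act g (act h x).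
Hypothesis PO : P `<=` Om.
Hypothesis Om_act : forall g x, Om x -> Om (act g x).
Hypothesis d_act : forall g x y, Om x -> Om y -> d (act g x) (act g y) = d x y.
Hypothesis dxx : forall x, d x x = 0.
Hypothesis U1 : 1%g \in U.
Hypothesis L0 : 0 < L.
Hypothesis U_word : forall g x y, P x -> P y -> exists l : seq W, [/\ {subset l <= U},
  act g y = act (prodg l) y & (size l).-2%:R * L <= d x (act g y)].

Fixpoint products k : seq W :=
  if k is k'.+1 then [seq (g * h)%g | g <- U, h <- products k'] else [:: 1%g].

Lemma size_products k : size (products k) = (size U ^ k)%N.
Proof. by elim: k => //= k IH; rewrite size_allpairs IH expnS. Qed.

Lemma mem_products k l : {subset l <= U} -> (size l <= k)%N -> prodg l \in products k.
Proof.
elim: k l => [|k IH] [|g l] lU lk; first by rewrite inE.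
- by [].
- apply/allpairsP; exists (1%g, prodg [::]); split; [exact: U1| |by rewrite /= mulg1].
  exact: IH.
apply/allpairsP; exists (g, prodg l); split; [by apply: lU; rewrite mem_head| |by []].
by apply: IH => // h hl; apply: lU; rewrite inE hl orbT.
Qed.

Definition orbit_ball x (r : R) : set T :=
  [set act g x | g in [set: W]] `&` [set y | d x y < r].

Lemma orbit_ball_sub g1 p r : P p -> 0 < r ->
  orbit_ball (act g1 p) r `<=`
  [set y | y \in [seq act (g1 * h)%g p | h <- products (Num.truncn (r / L)).+2]].
Proof.
move=> Pp r0 _ [[g _ <-] /= dr].
have [l [lU gl dl]] := U_word (g1^-1 * (g * g1))%g Pp Pp.
apply/mapP; exists (prodg l); last first.
  by rewrite [RHS]actM -gl -[RHS]actM mulVKg actM.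
apply: (@mem_products (Num.truncn (r / L)).+2) => //.
have Op := PO Pp; move: dl; rewrite -(d_act g1) //; last exact: Om_act.
rewrite -[act g1 (act _ p)]actM mulVKg actM => /le_lt_trans/(_ dr).
rewrite -ltr_pdivlMr // => lr.
have : ((size l).-2 <= Num.truncn (r / L))%N.
  have := Num.Theory.truncn_itv (ltW (divr_gt0 r0 L0)) => /andP[_ h].
  by have := lt_trans lr h; rewrite ltr_nat ltnS.
by case: (size l) => [|[|k]].
Qed.

Lemma counting_orbit_ball g1 p r : P p -> 0 < r ->
  ((1 : \bar R) <= counting (orbit_ball (act g1 p) r) <= ((size U ^ (Num.truncn (r / L)).+2)%:R : R)%:E)%E.
Proof.
move=> Pp r0; have sub := orbit_ball_sub (g1 := g1) Pp r0.
set s := [seq _ | h <- _] in sub.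
have fin : finite_set (orbit_ball (act g1 p) r).
  by apply: sub_finite_set sub _; exact: finite_seq.
rewrite /counting asboolT // -[1%E]/((1%:R : R)%:E) !lee_fin !ler_nat.
have memE z : (z \in finmap.enum_fset (fset_set (orbit_ball (act g1 p) r))) = (z \in orbit_ball (act g1 p) r).
  exact: (in_fset_set fin z).
have x_in : act g1 p \in finmap.enum_fset (fset_set (orbit_ball (act g1 p) r)).
  by rewrite memE inE; split; [exists 1%g; rewrite ?act1|rewrite /= dxx].
apply/andP; split; first by case: (finmap.enum_fset _) x_in.
have <- : size s = (size U ^ (Num.truncn (r / L)).+2)%N by rewrite size_map size_products.
apply: uniq_leq_size; first exact: finmap.fset_uniq.
by move=> y; rewrite memE inE => /sub.
Qed.

Lemma entropy_bound g1 p : P p ->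
  (0 <= entropy d act (act g1 p) <= (3 * ln (size U)%:R / L)%:E)%E.
Proof.
move=> Pp; set F := fun r : R => ((r^-1)%:E * lne (counting (orbit_ball (act g1 p) r)))%E.
have U0 : (0 < size U)%N by case: U U1.
have lnU : 0 <= ln (size U)%:R :> R by rewrite ln_ge0 // ler1n.
have F0 r : 0 < r -> (0 <= F r)%E.
  move=> r0; have /andP[h _] := counting_orbit_ball g1 Pp r0.
  by apply: mule_ge0; [rewrite lee_fin invr_ge0 ltW|rewrite lne_ge0].
have FL r : L <= r -> (F r <= (3 * ln (size U)%:R / L)%:E)%E.
  move=> Lr; have r0 := lt_le_trans L0 Lr.
  have /andP[h1 h2] := counting_orbit_ball g1 Pp r0.
  have r'0 : (0 <= (r^-1)%:E)%E by rewrite lee_fin invr_ge0 ltW.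
  have M0 : 0 < ((size U ^ (Num.truncn (r / L)).+2)%:R : R) by rewrite ltr0n expn_gt0 U0.
  have : (lne (counting (orbit_ball (act g1 p) r)) <= lne ((size U ^ (Num.truncn (r / L)).+2)%:R : R)%:E)%E.
    rewrite lee_lne // in_itv /= leey andbT; last by rewrite lee_fin ltW.
    exact: le_trans h1.
  move=> /(lee_wpmul2l r'0)/le_trans; apply.
  rewrite lne_EFin // -EFinM lee_fin natrX lnXn ?ltr0n // -(mulr_natr (ln _)).
  (* The origin of the 3: for r >= L the additional 2 is at most 2 r / L. *)
  have kr : ((Num.truncn (r / L)).+2%:R : R) <= 3 * r / L.
    have rL0 : 0 <= r / L by rewrite divr_ge0 // ltW.
    have rL1 : 1 <= r / L by rewrite ler_pdivlMr // mul1r.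
    have /andP[h _] := Num.Theory.truncn_itv rL0.
    by rewrite -2!natr1 -mulrA; lra.
  apply: le_trans (_ : r^-1 * (ln (size U)%:R * (3 * r / L)) <= _).
    by apply: ler_wpM2l; [rewrite invr_ge0 ltW|exact: ler_wpM2l].
  rewrite le_eqVlt; apply/orP; left; apply/eqP; field.
  by rewrite !gt_eqF.
rewrite /entropy /limf_esup; apply/andP; split.
  (* The upper limit is an infimum of suprema over neighbourhoods of +oo. Each contains a positive
     radius, which gives the lower bound; the half-line r >= L gives the upper one. *)
  apply: le_ereal_inf_tmp => _ [V [A0 [A0r hA0]] <-].
  have hV : V (Num.max A0 0 + 1) by apply: hA0; rewrite ltr_pwDr // le_max lexx.
  apply: le_trans (F0 (Num.max A0 0 + 1) _) _; first by rewrite ltr_wpDl // le_max lexx orbT.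
  by apply: ereal_sup_ubound; exists (Num.max A0 0 + 1).
apply: ge_ereal_inf; exists (ereal_sup [set F r | r in [set r | L <= r]]).
  by exists [set r | L <= r] => //; exists L; split; [exact: num_real|move=> r /ltW].
by apply: ge_ereal_sup => _ [r Lr <-]; exact: FL.
Qed.

End Entropy.

(** * Hausdorff convergence to the simplex *)

Section HausdorffCone.
Variables (R : realType) (n : nat) (B : GL R n).
Implicit Types (V X Y : 'cV[R]_n.+1).
Local Notation a := (bary B).

Definition dot V X : R := (V^T *m X) 0 0.

Lemma dotE V X : dot V X = \sum_j V j 0 * X j 0.
Proof. by rewrite /dot mxE; apply: eq_bigr => j _; rewrite mxE. Qed.

Lemma dotZl (c : R) V X : dot (c *: V) X = c * dot V X.
Proof. by rewrite !dotE mulr_sumr; apply: eq_bigr => j _; rewrite mxE mulrA. Qed.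

Lemma dotZr (c : R) V X : dot V (c *: X) = c * dot V X.
Proof. by rewrite !dotE mulr_sumr; apply: eq_bigr => j _; rewrite mxE mulrCA. Qed.

Lemma dotB V X : dot (V - X) (V - X) = dot V V + dot X X - 2 * dot V X.
Proof.
rewrite !dotE -big_split mulr_sumr -sumrB; apply: eq_bigr => j _ /=.
by rewrite !mxE; ring.
Qed.

Lemma dot_gt0 V : V != 0 -> 0 < dot V V.
Proof.
move=> V0; rewrite lt_neqAle dotE; apply/andP; split; last first.
  by apply: sumr_ge0 => j _; rewrite -expr2 sqr_ge0.
rewrite eq_sym; apply: contraNneq V0 => /eqP.
rewrite psumr_eq0 => [/allP h|j _]; last by rewrite -expr2 sqr_ge0.
apply/eqP/matrixP => j k; rewrite (ord1 k) mxE; apply/eqP.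
by have := h j (mem_index_enum _); rewrite mulf_eq0 orbb.
Qed.

Lemma entry_sqr_le_dot V j : V j 0 ^+ 2 <= dot V V.
Proof.
rewrite dotE (bigD1 j) //= expr2 lerDl; apply: sumr_ge0 => k _.
by rewrite -expr2 sqr_ge0.
Qed.

Definition bary_total : 'rV[R]_n.+1 := \sum_j a j.

Lemma bary_totalE V : form bary_total V = \sum_j form (a j) V.
Proof. by rewrite /form mulmx_suml summxE. Qed.

Definition almost_inside (eps : R) V : Prop :=
  0 < form bary_total V /\ forall j, 0 <= form (a j) V + eps * form bary_total V.

Lemma almost_insideZ eps (c : R) V : 0 < c -> almost_inside eps V -> almost_inside eps (c *: V).
Proof.
move=> c0 [h1 h2]; split=> [|j]; first by rewrite formZ mulr_gt0.
by rewrite !formZ mulrCA -mulrDr mulr_ge0 // ltW.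
Qed.

Lemma acos_small (eta : R) : 0 < eta -> eta <= 1 ->
  exists2 e : R, 0 < e & forall k, 0 <= k -> acos k < e -> 1 - eta < k.
Proof.
move=> eta0 eta1; have e1 : -1 <= 1 - eta <= 1 by apply/andP; split; lra.
exists (acos (1 - eta)); first by apply: acos_gt0; apply/andP; split; lra.
(* For k > 1 the value of [acos] carries no information, but the conclusion is immediate. *)
move=> k k0 hk; have [k1|k1] := leP k 1; last by lra.
have kB : -1 <= k <= 1 by apply/andP; split; lra.
have [/andP[p1 p2] ck] := acos_def kB; have [/andP[q1 q2] ce] := acos_def e1.
by rewrite -ck -ce ltr_cos // in_itv /= ?p1 ?q1.
Qed.

(* If [X] and [Y] have the same Euclidean norm and [dot X Y > (1 - eta) dot Y Y],
   then [|X - Y|^2 < 2 eta |Y|^2], and [|Y|] is controlled by [bary_total Y]. *)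
Lemma pdist_almost_inside (eps : R) : 0 < eps -> exists2 e : R, 0 < e &
  forall x y : pspace R n, psimplex B y -> pdist x y < e ->
  exists V, [/\ V != 0, x = pt V & almost_inside eps V].
Proof.
move=> eps0.
have [k k0 hk] : exists2 k : R, 0 < k & forall j V, `|form (a j) V| <= k * `|V|.
  have /choice[f hf] : forall j, exists k : R, 0 < k /\ forall V, `|form (a j) V| <= k * `|V|.
    by move=> j; have [k k0 hk] := form_bound (a j); exists k.
  exists (\sum_j f j) => [|j V].
    rewrite big_ord_recl ltr_pwDl ?(hf _).1 // sumr_ge0 // => j _.
    exact: ltW (hf _).1.
  apply: le_trans ((hf j).2 V) _; rewrite ler_wpM2r // (bigD1 j) //= lerDl.
  by apply: sumr_ge0 => i _; exact: ltW (hf _).1.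
pose M := \sum_j `|vertex B j|.
have M0 : 0 < M.
  by rewrite /M big_ord_recl ltr_pwDl ?normr_gt0 ?vertex_neq0 // sumr_ge0.
(* Write T for the total of Y. The first bound keeps the total of X above T / 2; the second then
   gives a_j(X) >= - mu T >= - eps times that total. *)
pose mu := Num.min (1 / (2 * n.+1%:R)) (eps / 2).
have mu0 : 0 < mu by rewrite lt_min; apply/andP; split; apply: divr_gt0; rewrite // mulr_gt0 // ltr0n.
pose N := k ^+ 2 * (2 * (n.+1%:R * M ^+ 2)).
have N0 : 0 < N by rewrite /N mulr_gt0 ?exprn_gt0 // mulr_gt0 // mulr_gt0 ?exprn_gt0 ?ltr0n.
(* Chosen so that k^2 |X - Y|^2 <= eta N T^2 <= (mu T)^2. *)
pose eta := Num.min 1 (mu ^+ 2 / N).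
have eta0 : 0 < eta by rewrite lt_min ltr01 divr_gt0 // exprn_gt0.
have eta1 : eta <= 1 by rewrite ge_min lexx.
have [e e0 he] := acos_small eta0 eta1.
exists e => // x y Py; rewrite /pdist -!/(dot _ _).
set hx := hcoord x; set hy := hcoord y => dxy.
have hx0 : hx != 0 := hcoord_neq0 x; have hy0 : hy != 0 := hcoord_neq0 y.
have [Y [Y0 aY [Yxy Yyy]]] : exists Y, [/\ Y != 0, forall j, 0 <= form (a j) Y &
    `|dot hx hy| = `|dot hx Y| /\ dot hy hy = dot Y Y].
  move: Py; rewrite -(pt_hcoord y) => /(psimplexP _ hy0)[h|h]; first by exists hy.
  exists (- hy); split; first by rewrite oppr_eq0.
    by move=> j; rewrite formN oppr_ge0.
  by rewrite -scaleN1r dotZl !dotZr !mulN1r normrN opprK.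
rewrite Yxy Yyy in dxy; set p := Num.sqrt (dot hx hx) in dxy; set q := Num.sqrt (dot Y Y) in dxy.
have p0 : 0 < p by rewrite sqrtr_gt0 dot_gt0.
have q0 : 0 < q by rewrite sqrtr_gt0 dot_gt0.
have pp : p ^+ 2 = dot hx hx by rewrite sqr_sqrtr // ltW // dot_gt0.
have qq : q ^+ 2 = dot Y Y by rewrite sqr_sqrtr // ltW // dot_gt0.
have kap := he _ _ dxy; have {}kap := kap (divr_ge0 (normr_ge0 _) (ltW (mulr_gt0 p0 q0))).
(* The sign that makes the product with Y nonnegative; the factor q / p then gives the lift of x the
   Euclidean norm of Y. *)
have [dl [dl2 dlE]] : exists dl : R, dl ^+ 2 = 1 /\ dl * dot hx Y = `|dot hx Y|.
  have [h|h] := leP 0 (dot hx Y); first by exists 1; rewrite expr1n mul1r ger0_norm.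
  by exists (- 1); rewrite sqrrN expr1n mulN1r ltr0_norm.
have dl0 : dl != 0 by apply: contra_eq_neq dl2 => ->; rewrite expr0n eq_sym oner_eq0.
have c0 : dl * q / p != 0 by rewrite !mulf_neq0 ?invr_eq0 // gt_eqF.
pose X := (dl * q / p) *: hx; exists X; split.
- by rewrite scaler_eq0 negb_or c0.
- by rewrite ptZ // pt_hcoord.
pose T := form bary_total Y.
have TE : T = \sum_j form (a j) Y := bary_totalE Y.
have T0 : 0 < T.
  rewrite lt_neqAle TE sumr_ge0 ?andbT // eq_sym; apply: contraNneq Y0 => /eqP.
  rewrite psumr_eq0 // => /allP h; rewrite (bary_decomp B Y) big1 // => j _.
  by have /eqP -> := h j (mem_index_enum _); rewrite scale0r.
have aT j : form (a j) Y <= T by rewrite TE (bigD1 j) //= lerDl sumr_ge0.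
have YM : `|Y| <= T * M.
  rewrite {1}(bary_decomp B Y) mulr_sumr; apply: le_trans (ler_norm_sum _ _ _) _.
  by apply: ler_sum => j _; rewrite normrZ ger0_norm // ler_wpM2r.
have q2 : q ^+ 2 <= n.+1%:R * (T * M) ^+ 2.
  rewrite qq dotE mulr_natl -[X in _ *+ X](card_ord n.+1) -sumr_const.
  apply: ler_sum => j _; rewrite -expr2 -(real_normK (num_real (Y j 0))).
  have Yj : `|Y j 0| <= T * M := le_trans (entry_le_norm _ _) YM.
  by rewrite lerXn2r ?nnegrE // (le_trans (normr_ge0 _) Yj).
have dXX : dot X X = q ^+ 2.
  rewrite dotZl dotZr -pp (_ : _ * _ = dl ^+ 2 * q ^+ 2); first by rewrite dl2 mul1r.
  by field; rewrite gt_eqF.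
have dXY : dot X Y = q ^+ 2 * (`|dot hx Y| / (p * q)).
  by rewrite dotZl -dlE; field; rewrite !gt_eqF.
have dD : dot (X - Y) (X - Y) <= 2 * eta * q ^+ 2.
  rewrite dotB dXX -qq dXY; have : 0 < q ^+ 2 by rewrite exprn_gt0.
  set kk := `|dot hx Y| / (p * q) in kap *; nra.
have close j : `|form (a j) X - form (a j) Y| <= mu * T.
  rewrite -formB; apply: le_trans (hk j _) _.
  have D2 : `|X - Y| ^+ 2 <= dot (X - Y) (X - Y).
    rewrite -(@sqr_sqrtr _ (dot (X - Y) (X - Y))); last first.
      by apply: le_trans (entry_sqr_le_dot _ 0); exact: sqr_ge0.
    rewrite lerXn2r ?nnegrE // ?sqrtr_ge0 //; apply: norm_le_entry; first exact: sqrtr_ge0.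
    by move=> i; rewrite -sqrtr_sqr ler_sqrt; [exact: entry_sqr_le_dot|
      apply: le_trans (entry_sqr_le_dot _ i); exact: sqr_ge0].
  rewrite -(@ler_pXn2r _ 2) ?nnegrE ?mulr_ge0 ?(ltW k0) ?(ltW mu0) ?(ltW T0) // !exprMn.
  have h1 : `|X - Y| ^+ 2 <= 2 * (mu ^+ 2 / N) * (n.+1%:R * (T * M) ^+ 2).
    apply: le_trans D2 _; apply: le_trans dD _; apply: ler_pM => //.
    - by rewrite mulr_ge0 // ltW.
    - by rewrite sqr_ge0.
    - by rewrite ler_pM2l // ge_min lexx orbT.
  apply: le_trans (ler_wpM2l (sqr_ge0 k) h1) _.
  rewrite le_eqVlt; apply/orP; left; apply/eqP; rewrite /N; field.
  by rewrite !gt_eqF // ltr0n.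
have n0 : 0 < n.+1%:R :> R by rewrite ltr0n.
have mu1 : mu * n.+1%:R <= 2^-1.
  have : mu <= 1 / (2 * n.+1%:R) by rewrite ge_min lexx.
  by rewrite ler_pdivlMr ?mulr_gt0 //; lra.
have mu2 : mu <= eps / 2 by rewrite ge_min lexx orbT.
have tot : T / 2 <= form bary_total X.
  have : T - n.+1%:R * (mu * T) <= form bary_total X.
    rewrite bary_totalE {1}TE mulr_natl -[X in _ *+ X](card_ord n.+1) -sumr_const -sumrB.
    by apply: ler_sum => j _; have := close j; rewrite ler_norml => /andP[? _]; lra.
  nra.
split=> [|j]; first by apply: lt_le_trans tot; rewrite divr_gt0.
have := close j; rewrite ler_norml => /andP[h _]; have := aY j.
nra.
Qed.

End HausdorffCone.

(** * The deformation family *)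

Section Family.
Variables (R : realType) (n : nat) (J : coxeter_diagram n).
Variables (u v : 'I_n.+1 -> 'cV[R]_n.+1) (B : GL R n) (rho : R -> representation R J).
Hypothesis n2 : (2 <= n)%N.
Hypothesis uv : coxeter_simplex J u v.
Hypothesis fam : simplicial_deformation_family v B rho.
Local Notation Om t := (tiled_set (rho t) B).
Local Notation P := (psimplex B).
Local Notation gen := (coxeter_gen J).

Implicit Types (V : 'cV[R]_n.+1) (t : R).

Lemma psimplex_tiled t : P `<=` Om t.
Proof. by move=> x Px; exists 1%g => //; exists x; rewrite ?representation1 ?pgl_act1. Qed.

Lemma tiled_act t g x : 0 < t -> Om t x -> Om t (pgl_act (rho t g) x).
Proof.
move=> t0 Ox; have [_ _ /(_ g) actOm _] := sdf_domain fam t0.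
have : (pgl_act (rho t g) @` Om t) (pgl_act (rho t g) x) by exists x.
by rewrite actOm.
Qed.

Lemma family_lift t : 0 < t -> exists K A E, [/\ is_cone (Om t) K, forall j, K (vertex B j) &
  forall s, [/\ rho t (gen s) = pgl_class (A s),
    form (bary B s) (E s) = 1 /\ ~ Om t (pt (E s)),
    forall V, glval (A s) *m V = V - (2 * form (bary B s) V) *: E s,
    forall V, glval (A s) *m (glval (A s) *m V) = V &
    forall V, K V -> K (glval (A s) *m V)]].
Proof.
move=> t0; have [oOm pc actOm _] := sdf_domain fam t0.
have [K [HK Kv]] := simplex_cone (properly_convex_cone oOm pc) (@psimplex_tiled t).
have /choice[A] : forall s, exists A : GL R n, exists E, [/\ rho t (gen s) = pgl_class A,
    form (bary B s) E = 1 & forall V, glval A *m V = V - (2 * form (bary B s) V) *: E].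
  by move=> s; apply: reflection_lift n2 _; exact: (sdf_reflection fam).
move=> /choice[E AE]; exists K, A, E; split=> // s; have [rhoA aE AEs] := AE s.
have AO x : Om t x -> Om t (pgl_act (pgl_class (A s)) x).
  by rewrite -rhoA; exact: tiled_act.
by have [KA AA _ nE] := reflection_cone HK Kv (ltnW n2) AO aE AEs.
Qed.

Lemma family_side t K A E : 0 < t -> is_cone (Om t) K -> (forall j, K (vertex B j)) ->
  (forall s, [/\ rho t (gen s) = pgl_class (A s),
    form (bary B s) (E s) = 1 /\ ~ Om t (pt (E s)),
    forall V, glval (A s) *m V = V - (2 * form (bary B s) V) *: E s,
    forall V, glval (A s) *m (glval (A s) *m V) = V &
    forall V, K V -> K (glval (A s) *m V)]) ->
  (forall g s x V, P x -> K V -> pgl_act (rho t g) x = pt V ->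
    ((coxeter_len g <= coxeter_len (gen s * g)%g)%N -> 0 <= form (bary B s) V) /\
    ((coxeter_len (gen s * g)%g < coxeter_len g)%N -> form (bary B s) V <= 0)) /\
  (forall i, finite_set (@parabolic n J i)).
Proof.
move=> t0 HK Kv hA; have [_ _ _ [f [f' [f_bij fK f_cont _ f_equiv]]]] := sdf_domain fam t0.
have rhoA s : rho t (gen s) = pgl_class (A s) by have [] := hA s.
have aE s : form (bary B s) (E s) = 1 by have [_ [] ] := hA s.
have nE s : ~ Om t (pt (E s)) by have [_ [] ] := hA s.
have AE s V : glval (A s) *m V = V - (2 * form (bary B s) V) *: E s by have [] := hA s.
have KA s V : K V -> K (glval (A s) *m V) by have [_ _ _ _] := hA s; exact.
split; last by move=> i; exact: (finite_parabolic_model uv fK f_equiv).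
move=> g s x V Px KV gx.
have PO : P `<=` Om t := @psimplex_tiled t.
have h := tile_side uv HK Kv f_bij fK f_cont f_equiv rhoA aE AE KA nE; exact: (h g s x V Px PO KV gx).
Qed.

(** The parabolic subgroups are subsets of the Coxeter group, so the model at t = 1 provides one
    list for all t. *)
Lemma finite_parabolics : exists U : seq (coxeter_group J), forall i h, parabolic i h -> h \in U.
Proof.
have [K [A [E [HK Kv hA]]]] := family_lift ltr01.
have [_ fin] := family_side ltr01 HK Kv hA.
have /choice[U hU] : forall i, exists s : seq (coxeter_group J), @parabolic n J i = [set` s].
  by move=> i; apply/finite_seqP.
exists (flatten [seq U i | i <- enum 'I_n.+1]) => i h hi.
apply/flattenP; exists (U i); first by apply: map_f; rewrite mem_enum.
by move: hi; rewrite hU.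
Qed.

Lemma family_entropy_bound (U : seq (coxeter_group J)) t eps x :
  (forall i h, parabolic i h -> h \in U) -> 0 < t -> 0 < eps -> 0 < step_length n eps ->
  (forall y, Om t y -> exists V, [/\ V != 0, y = pt V & almost_inside B eps V]) ->
  Om t x ->
  (0 <= entropy (hilbert_dist (Om t)) (fun g => pgl_act (rho t g)) x <=
     (3 * ln (size U)%:R / step_length n eps)%:E)%E.
Proof.
move=> hU t0 eps0 L0 near_P [g1 _ [p Pp <-]].
have [oOm _ _ _] := sdf_domain fam t0.
have [K [A [E [HK Kv hA]]]] := family_lift t0; have [side _] := family_side t0 HK Kv hA.
have rhoA s : rho t (gen s) = pgl_class (A s) by have [] := hA s.
have AE s V : glval (A s) *m V = V - (2 * form (bary B s) V) *: E s by have [] := hA s.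
have AA s V : glval (A s) *m (glval (A s) *m V) = V by have [] := hA s.
have KA s V : K V -> K (glval (A s) *m V) by have [_ _ _ _] := hA s; exact.
have tot_chart : Om t `<=` in_chart (bary_total B).
  by move=> y /near_P[V [V0 -> [h _]]]; apply/in_chart_pt; rewrite // gt_eqF.
have Ktot V : K V -> 0 < form (bary_total B) V.
  move=> KV; have := in_chart_cone_sign HK tot_chart KV (Kv 0).
  have -> : form (bary_total B) (vertex B 0) = 1; last by rewrite mulr1.
  rewrite bary_totalE (bigD1 0) //= bary_vertex eqxx big1 ?addr0 // => j j0.
  by rewrite bary_vertex (negPf j0).
have Keps i V : K V -> 0 <= form (bary B i) V + eps * form (bary_total B) V.
  move=> KV; have V0 := cone_neq0 HK KV; have tV := Ktot V KV.
  (* The lift given by [near_P] may differ from V by a scalar, which is positive since the total is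
     positive on both. *)
  have [X [X0 /(pt_eqP V0 X0)[c c0 XE] insX]] := near_P _ (cone_pt HK KV).
  have c_gt0 : 0 < c.
    by have [] := insX; rewrite XE formZ pmulr_lgt0.
  have [_ /(_ i)] := almost_insideZ (c := c^-1) (etrans (invr_gt0 c) c_gt0) insX.
  by rewrite XE scalerA mulVf // scale1r.
have tiles_fixed y : hilbert_dist (Om t) y y = 0 by rewrite /hilbert_dist eqxx.
have U1 : 1%g \in U by apply: (hU 0); exact: parabolic1.
have walkU g y z : P y -> P z -> exists l : seq (coxeter_group J), [/\ {subset l <= U},
    pgl_act (rho t g) z = pgl_act (rho t (foldr *%g 1%g l)) z &
    (size l).-2%:R * step_length n eps <= hilbert_dist (Om t) y (pgl_act (rho t g) z)].
  move=> Py Pz; have [l [lU gl dl]] := walk_word oOm HK Kv (@psimplex_tiled t) rhoA AE AA KA side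
    (@bary_totalE _ _ B) eps0 Ktot Keps g (ltW L0) Py Pz.
  by exists l; split; [move=> h /lU[j]; exact: hU|exact: gl|exact: dl].
apply: (@entropy_bound R (coxeter_group J) _ (fun g => pgl_act (rho t g)) _ (Om t) P U
  (step_length n eps)).
- by move=> y; rewrite representation1 pgl_act1.
- by move=> g h y; rewrite gmulfM pgl_actM.
- exact: psimplex_tiled.
- by move=> g y; exact: tiled_act.
- by move=> g y z; exact: (hilbert_dist_rho oOm HK rhoA AA KA).
- exact: tiles_fixed.
- exact: U1.
- exact: L0.
- exact: walkU.
- exact: Pp.
Qed.

End Family.

Lemma step_length_large (R : realType) (n : nat) (Q : R) :
  exists2 eps : R, 0 < eps & Q <= step_length n eps.
Proof.
have n0 : 0 < n.+1%:R :> R by rewrite ltr0n.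
(* For this eps the argument of the logarithm is exp (2 Q) + 1. *)
exists (expR (- (2 * Q)) / n.+1%:R); first by rewrite divr_gt0 // expR_gt0.
rewrite /step_length; set eps := expR _ / _.
have eps0 : 0 < eps by apply: divr_gt0; rewrite // expR_gt0.
have : ln (expR (2 * Q)) <= ln ((n.+1%:R^-1 + eps) / eps).
  have pos : 0 < (n.+1%:R^-1 + eps) / eps by apply: divr_gt0; rewrite // addr_gt0 ?invr_gt0.
  rewrite ler_ln ?posrE ?expR_gt0 //.
  rewrite ler_pdivlMr // (_ : expR (2 * Q) * eps = n.+1%:R^-1).
    by rewrite lerDl ltW.
  by rewrite /eps mulrA -expRD subrr expR0 mul1r.
by rewrite expRK; lra.
Qed.

(** The filter is left abstract so that both ends of the family are treated at once. *)
Lemma cvg_entropy (R : realType) (n : nat) (J : coxeter_diagram n)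
  (u v : 'I_n.+1 -> 'cV[R]_n.+1) (B : GL R n) (rho : R -> representation R J)
  (x : R -> pspace R n) (F : set_system R) : (2 <= n)%N -> coxeter_simplex J u v ->
  simplicial_deformation_family v B rho ->
  (forall t : R, 0 < t -> tiled_set (rho t) B (x t)) ->
  Filter F -> F [set t | 0 < t] ->
  hausdorff_cvg (fun t => tiled_set (rho t) B) F (psimplex B) ->
  entropy (hilbert_dist (tiled_set (rho t) B)) (fun g => pgl_act (rho t g)) (x t)
    @[t --> F] --> 0%E.
Proof.
move=> n2 uv fam x_in FF Fpos cvgF A [c /= c0 cA].
have [U hU] := finite_parabolics n2 uv fam.
set M := 3 * ln (size U)%:R : R.
(* Gives c L >= 2 |M| + c > M, so the bound M / L is below c; the added 1 keeps L positive even if M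
   = 0. *)
have [eps eps0 hL] := step_length_large n (2 * `|M| / c + 1).
have L0 : 0 < step_length n eps.
  by apply: lt_le_trans hL; rewrite ltr_wpDl // divr_ge0 ?mulr_ge0 // ltW.
have [e e0 he] := pdist_almost_inside B eps0.
have := cvgF e e0; apply: filterS2 Fpos => t t0 [near_P _].
have inside y : tiled_set (rho t) B y -> exists V, [/\ V != 0, y = pt V & almost_inside B eps V].
  by move=> /near_P[z Pz yz]; exact: he Pz yz.
have := family_entropy_bound n2 uv fam hU t0 eps0 L0 inside (x_in t t0).
rewrite -/M /=; case: (entropy _ _ _) => [d| |] //=; last by move=> /andP[_]; rewrite leNgt ltry.
rewrite !lee_fin => /andP[d0 dM]; apply: cA; rewrite /= sub0r normrN ger0_norm //.
apply: le_lt_trans dM _; rewrite ltr_pdivrMr //.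
have h : 2 * `|M| + c <= c * step_length n eps.
  have := ler_wpM2l (ltW c0) hL; rewrite mulrDr mulr1 mulrCA divff ?gt_eqF // mulr1.
  by [].
by have := ler_norm M; have := normr_ge0 M; lra.
Qed.

Theorem theorem1 (R : realType) (n : nat) (J : coxeter_diagram n)
  (J_hyperbolic : hyperbolic R J) (J_circular : circular J)
  (u v : 'I_n.+1 -> 'cV[R]_n.+1) (uv_simplex : coxeter_simplex J u v)
  (B : GL R n) (rho : R -> representation R J)
  (rho_family : simplicial_deformation_family v B rho)
  (x : R -> pspace R n) (x_in : forall t : R, 0 < t -> tiled_set (rho t) B (x t)) :
  let delta := fun t : R =>
    entropy (hilbert_dist (tiled_set (rho t) B)) (fun g => pgl_act (rho t g)) (x t) in
  (delta t @[t --> 0^'+] --> 0%E) /\ (delta t @[t --> +oo] --> 0%E).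
Proof.
have [n2 _] := J_circular; split; apply: (cvg_entropy n2 uv_simplex rho_family x_in).
- exact: nbhs_right_gt.
- exact: sdf_cvg0 rho_family.
- exact: nbhs_pinfty_gt.
- exact: sdf_cvgy rho_family.
Qed.
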